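(* For every integer $d\ge1$ there is a finite constant $C_d$ depending only on $d$ such that, for all $0<\mu\le L<\infty$ and $\sigma^2=0$, there is a gradient-only algorithm, given $d,L,\mu$ but no accuracy parameter, which for every $f\in\mathcal C_d(L,\mu)$ returns an exact sample from $\nu_f$ (its output has law exactly $\nu_f$), terminates almost surely, has a query count $T$ that is a stopping time of the physical-transcript filtration, and satisfies $$\sup_{f\in\mathcal C_d(L,\mu)}\mathbb E[T]\le C_d\log(1+\kappa),\qquad \kappa=L/\mu.$$
   Context: Norms are Euclidean and logarithms natural. $\mathcal C_d(L,\mu)$ is the set of all $f\in C^1(\mathbb R^d)$ with $\frac\mu2\|x-y\|^2\le f(x)-f(y)-\langle\nabla f(y),x-y\rangle\le\frac L2\|x-y\|^2$ for all $x,y\in\mathbb R^d$, and whose unique minimizer $x_f^\star$ satisfies $\|x_f^\star\|\le\mu^{-1/2}$. The target is $\nu_f(dx)=Z_f^{-1}e^{-f(x)}dx$, $Z_f=\int_{\mathbb R^d}e^{-f}$. Algorithms. A (gradient-only) algorithm is a measurable randomized procedure whose rules do not depend on $f$ except through replies. It makes sequential queries: at the $t$-th query it selects $x_t\in\mathbb R^d$ from previous queries, replies and internal randomness, and receives a reply $g_t\in\mathbb R^d$. With $\sigma^2=0$ (zero conditional variance and conditional mean $\nabla f(x_t)$ given the complete incoming history, consisting of $x_t$, all previous queries and replies, and all internal randomness already generated), $g_t=\nabla f(x_t)$ almost surely. No other information on $f$ (in particular no potential values) is available; exact real arithmetic and internal random generation are free. The number of queries $T$ must be a stopping time for the physical filtration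 $\mathcal F_t=\sigma(x_1,g_1,\dots,x_t,g_t)$, $\mathcal F_0=\{\varnothing,\Omega\}$; the output may additionally use private randomness. *)

(* Defs.v *)
From HB Require Import structures.
From mathcomp Require Import all_boot all_order all_algebra.
From mathcomp Require Import all_classical all_reals all_analysis.

Set Implicit Arguments.
Unset Strict Implicit.
Unset Printing Implicit Defensive.

Import Order.TTheory GRing.Theory Num.Theory.
Import numFieldNormedType.Exports.

Local Open Scope classical_set_scope.
Local Open Scope ring_scope.

(* The library norm on 'rV[R]_d is the sup norm; it induces the same topology
   and the same notion of differentiability as enorm. *)
Definition dotp (R : realType) (d : nat) (x y : 'rV[R]_d) : R :=
  \sum_(i < d) x 0 i * y 0 i.

Definition enorm (R : realType) (d : nat) (x : 'rV[R]_d) : R :=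
  Num.sqrt (dotp x x).

Definition grad (R : realType) (d : nat) (f : 'rV[R]_d -> R) (x : 'rV[R]_d) :
  'rV[R]_d := \row_(i < d) 'D_(delta_mx 0 i) f x.

Definition is_C1 (R : realType) (d : nat) (f : 'rV[R]_d -> R) : Prop :=
  (forall x, differentiable f x) /\ continuous (grad f).

Definition Cclass (R : realType) (d : nat) (L mu : R) : set ('rV[R]_d -> R) :=
  [set f | [/\ is_C1 f,
    (forall x y,
       mu / 2 * enorm (x - y) ^+ 2 <= f x - f y - dotp (grad f y) (x - y)
       <= L / 2 * enorm (x - y) ^+ 2) &
    exists2 xs, forall y, y != xs -> f xs < f y & enorm xs <= (Num.sqrt mu)^-1]].

(* Product sigma-algebra on R^n (the one generated by the coordinates); it is
   the Borel sigma-algebra, as R is second countable. *)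
Definition measure_rV_display : measure_display.
Proof. exact: default_measure_display. Qed.

Section measurable_rV.
Variables (R : realType) (n : nat).

Let coors : 'I_n -> 'rV[R]_n -> measurableTypeR R := fun i x => x 0 i.

Let rV_set0 : g_sigma_preimage coors set0.
Proof. exact: sigma_algebra0. Qed.

Let rV_setC A : g_sigma_preimage coors A -> g_sigma_preimage coors (~` A).
Proof. exact: sigma_algebraC. Qed.

Let rV_bigcup (F : _^nat) : (forall i, g_sigma_preimage coors (F i)) ->
  g_sigma_preimage coors (\bigcup_i (F i)).
Proof. exact: sigma_algebra_bigcup. Qed.

HB.instance Definition _ := @isMeasurable.Build measure_rV_display
  'rV[R]_n (g_sigma_preimage coors) rV_set0 rV_setC rV_bigcup.

End measurable_rV.

Lemma measurable_coord (R : realType) (n : nat) (i : 'I_n) :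
  measurable_fun [set: 'rV[R]_n] (fun x => x 0 i : measurableTypeR R).
Proof.
move=> _ Y mY; rewrite setTI; apply: sub_sigma_algebra => /=.
rewrite -bigcup_seq/=; exists i => /=; first by rewrite mem_index_enum.
by exists Y => //; rewrite setTI.
Qed.

Lemma measurable_fun_rV (R : realType) (n : nat) (d : measure_display)
    (T : measurableType d) (f : T -> 'rV[R]_n) :
  (forall i, measurable_fun [set: T] (fun x => f x 0 i : measurableTypeR R)) ->
  measurable_fun [set: T] f.
Proof.
move=> mf _ B mB; rewrite setTI.
have sub : g_sigma_preimage (fun i (x : 'rV[R]_n) => x 0 i : measurableTypeR R)
    `<=` [set A : set 'rV[R]_n | measurable (f @^-1` A)].
  apply: smallest_sub.
    split => /=; first by rewrite preimage_set0.
      by move=> A mA; rewrite setTD preimage_setC; exact: measurableC.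
    by move=> F mF; rewrite preimage_bigcup; exact: bigcup_measurable.
  rewrite -bigcup_seq; apply: bigcup_sub => i _ A [C mC <-] /=.
  by rewrite setTI; move: (mf i measurableT C mC); rewrite setTI.
exact: sub mB.
Qed.

Definition consrV (R : realType) (n : nat) (p : measurableTypeR R * 'rV[R]_n) :
  'rV[R]_n.+1 := row_mx (p.1 : R)%:M p.2 : 'rV[R]_(1 + n).

Lemma measurable_consrV (R : realType) (n : nat) :
  measurable_fun setT (@consrV R n).
Proof.
apply: measurable_fun_rV => i.
case: (split_ordP (i : 'I_(1 + n))) => j ->.
  have -> : (fun x => consrV x 0 (lshift n j) : measurableTypeR R) =
      (@fst (measurableTypeR R) 'rV[R]_n).
    apply/funext => x; transitivity ((x.1 : R)%:M 0 j); first exact: row_mxEl.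
    by rewrite ord1 mxE eqxx mulr1n.
  exact: measurable_fst.
have -> : (fun x => consrV x 0 (rshift 1 j) : measurableTypeR R) =
    (fun v : 'rV[R]_n => v 0 j) \o (@snd (measurableTypeR R) 'rV[R]_n).
  by apply/funext => x; exact: row_mxEr.
apply: measurableT_comp; first exact: measurable_coord.
exact: measurable_snd.
Qed.

Definition unconsrV (R : realType) (n : nat) (v : 'rV[R]_n.+1) :
  measurableTypeR R * 'rV[R]_n := (v 0 ord0, \row_i v 0 (lift ord0 i)).

Lemma measurable_unconsrV (R : realType) (n : nat) :
  measurable_fun setT (@unconsrV R n).
Proof.
apply/measurable_fun_pairP; split; first exact: measurable_coord.
apply: measurable_fun_rV => i.
have -> : (fun x => (snd \o @unconsrV R n) x 0 i : measurableTypeR R) =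
    (fun v : 'rV[R]_n.+1 => v 0 (lift ord0 i)).
  by apply/funext => v; rewrite /= mxE.
exact: measurable_coord.
Qed.

Lemma consrVK (R : realType) (n : nat) : cancel (@consrV R n) (@unconsrV R n).
Proof.
move=> [a v]; rewrite /unconsrV /consrV; congr (_, _).
  have -> : ord0 = lshift n (ord0 : 'I_1) :> 'I_(1 + n) by apply/val_inj.
  transitivity ((a : R)%:M 0 (ord0 : 'I_1)); first exact: row_mxEl.
  by rewrite mxE eqxx mulr1n.
apply/rowP => i; rewrite mxE.
have -> : lift ord0 i = rshift 1 i :> 'I_(1 + n) by apply/val_inj.
exact: row_mxEr.
Qed.

Section lebesgue_rV_step.
Variables (R : realType) (n : nat).
Variable mu : {sigma_finite_measure set 'rV[R]_n -> \bar R}.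

Definition lebesgue_rV_step : set 'rV[R]_n.+1 -> \bar R :=
  pushforward (@lebesgue_measure R \x mu)%E (@consrV R n).

HB.instance Definition _ := Measure.copy lebesgue_rV_step
  (measure_function_pushforward__canonical__measure_function_Measure
     _ (@measurable_consrV R n)).

Let step_sigma_finite : sigma_finite setT lebesgue_rV_step.
Proof.
have /sigma_finiteP[F [TF ndF Foo]] := sigma_finiteT (@lebesgue_measure R).
have /sigma_finiteP[G [TG ndG Goo]] := sigma_finiteT mu.
exists (fun k => @unconsrV R n @^-1` (F k `*` G k)).
  apply/seteqP; split => // v _.
  have [k _ Fk] : (\bigcup_k F k) (unconsrV v).1 by rewrite -TF.
  have [l _ Gl] : (\bigcup_k G k) (unconsrV v).2 by rewrite -TG.
  exists (maxn k l) => //; split.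
    by move: Fk; exact/subsetPset/ndF/leq_maxl.
  by move: Gl; exact/subsetPset/ndG/leq_maxr.
move=> k; have [mF Fk] := Foo k; have [mG Gk] := Goo k; split.
  rewrite -[X in measurable X]setTI; apply: measurable_unconsrV => //.
  exact: measurableX.
rewrite /lebesgue_rV_step /pushforward -comp_preimage.
have -> : @unconsrV R n \o @consrV R n = id by apply/funext; exact: consrVK.
rewrite preimage_id product_measure1E// lte_mul_pinfty//.
by rewrite ge0_fin_numE.
Qed.

HB.instance Definition _ :=
  Measure_isSigmaFinite.Build _ _ _ lebesgue_rV_step step_sigma_finite.

End lebesgue_rV_step.

Fixpoint lebesgue_rV (R : realType) (n : nat) :
    {sigma_finite_measure set 'rV[R]_n -> \bar R} :=
  match n with
  | 0 => \d_(0 : 'rV[R]_0)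
  | m.+1 => lebesgue_rV_step (lebesgue_rV R m)
  end.

Definition partition_function (R : realType) (d : nat) (f : 'rV[R]_d -> R) :
  \bar R := (\int[lebesgue_rV R d]_x (expR (- f x))%:E)%E.

Definition target (R : realType) (d : nat) (f : 'rV[R]_d -> R)
    (B : set 'rV[R]_d) : \bar R :=
  ((partition_function f)^-1 *
   \int[lebesgue_rV R d]_(x in B) (expR (- f x))%:E)%E.

(* All internal randomness, including the private randomness of the output, is
   carried by a seed drawn once.  After t queries the rules see the seed and the
   past (query, reply) pairs: if stop_rule t holds, output_rule t is returned;
   otherwise query_rule t is the next query point. *)
Record algorithm (R : realType) (d : nat) := Algorithm {
  seed_display : measure_display;
  seed : measurableType seed_display;
  seed_law : probability seed R;
  query_rule : forall t : nat,
    {mfun (seed * t.-tuple ('rV[R]_d * 'rV[R]_d))%type >-> 'rV[R]_d};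
  stop_rule : forall t : nat,
    {mfun (seed * t.-tuple ('rV[R]_d * 'rV[R]_d))%type >-> bool};
  output_rule : forall t : nat,
    {mfun (seed * t.-tuple ('rV[R]_d * 'rV[R]_d))%type >-> 'rV[R]_d} }.

Fixpoint history (R : realType) (d : nat) (A : algorithm R d) (u : seed A)
    (g : nat -> 'rV[R]_d) (t : nat) : t.-tuple ('rV[R]_d * 'rV[R]_d) :=
  match t with
  | 0 => [tuple]
  | s.+1 => let h := history u g s in
            [tuple of rcons h (query_rule A s (u, h), g s)]
  end.

(* An execution of A on f with oracle noise sigma^2 = 0.  Indices start at 0:
   reply r t answers query r t, the (t+1)-st query.  Queries and replies are
   continued past the stopping of A; nothing below depends on the continuation. *)
Record exact_run (R : realType) (d : nat) (A : algorithm R d)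
    (f : 'rV[R]_d -> R) := ExactRun {
  run_display : measure_display;
  run_space : measurableType run_display;
  run_prob : probability run_space R;
  run_seed : {mfun run_space >-> seed A};
  reply : nat -> {mfun run_space >-> 'rV[R]_d};
  run_seed_law : forall B, measurable B ->
    distribution run_prob run_seed B = seed_law A B;
  reply_exact : forall t, {ae run_prob, forall w,
    let h := history (run_seed w) (fun s => reply s w) t in
    reply t w = grad f (query_rule A t (run_seed w, h))} }.

Section run.
Variables (R : realType) (d : nat) (A : algorithm R d) (f : 'rV[R]_d -> R).
Variable r : exact_run A f.

Definition run_history (t : nat) (w : run_space r) :
  t.-tuple ('rV[R]_d * 'rV[R]_d) :=
  history (run_seed r w) (fun s => reply r s w) t.

Definition query (t : nat) (w : run_space r) : 'rV[R]_d :=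
  query_rule A t (run_seed r w, run_history t w).

Definition stops (t : nat) (w : run_space r) : bool :=
  stop_rule A t (run_seed r w, run_history t w).

Definition query_count (w : run_space r) : \bar R :=
  ereal_inf [set t%:R%:E | t in [set t | stops t w]].

Definition expected_query_count : \bar R := (\int[run_prob r]_w query_count w)%E.

Definition physical_filtration (t : nat) : set (set (run_space r)) :=
  g_sigma_preimage (fun (i : 'I_t) (w : run_space r) => (query i w, reply r i w)).

Definition is_stopping_time (T : run_space r -> \bar R) : Prop :=
  forall t : nat, physical_filtration t [set w | (T w <= t%:R%:E)%E].

Definition terminates_as : Prop :=
  {ae run_prob r, forall w, (query_count w < +oo)%E}.

Definition returns (w : run_space r) (y : 'rV[R]_d) : Prop :=
  exists2 t : nat, query_count w = t%:R%:E &
    y = output_rule A t (run_seed r w, run_history t w).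

Definition output_law (B : set 'rV[R]_d) : \bar R :=
  run_prob r [set w | exists2 y, returns w y & B y].

End run.

(* Main.v *)
From HB Require Import structures.
Require Import Defs.
From mathcomp Require Import all_boot all_order all_algebra.
From mathcomp Require Import all_classical all_reals all_analysis.
From mathcomp Require Import measurable_realfun perm ring lra.

Set Implicit Arguments.
Unset Strict Implicit.
Unset Printing Implicit Defensive.

Import Order.TTheory GRing.Theory Num.Theory.
Import numFieldNormedType.Exports.

Local Open Scope classical_set_scope.
Local Open Scope ring_scope.

(* Proof idea.  The sublevel set K = {f <= min f + 1} contains a ball of radius
   sqrt(2/L) and lies in the ball of radius 3/sqrt(mu) around 0.  The central-cut
   ellipsoid method keeps an affine image c + (unit ball) A of the unit ball
   around K; it queries the gradient, in the coordinates u of the ellipsoid, at 0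
   and at d points near 0 on the axes.  A gradient of length more than 16 d gives
   a cut that reduces the volume by a constant factor, so O_d(log kappa) queries
   lead to an ellipsoid where all d + 1 gradients are short.  There
   h(u) = f(c + uA) satisfies h <= h(0) + 1 on a cube of fixed size and grows at
   least linearly away from 0, so proposals from a density with a slow exponential
   decay can be accepted with a probability bounded below in terms of d only.

   Rejection sampling needs a coin of probability exp(-(h(u) - h(0)) + explicit
   terms), but potential values are not available.  Such a coin is the event that
   a Poisson process of rate t |-> d/dt h(tu) + drift on [0, 1] has no point, and
   this rate is nonnegative and increasing for a suitable drift.  The points of
   the process under the graph of a decreasing rate l with l(0) <= K are found by
   a chain (y, g): all points of the unit-rate planar process in [0, g] x [0, y]
   have been excluded, so the next candidate above y over [0, g] is at height
   y + Exp(g) and abscissa g U.  One gradient decides whether it lies under the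
   graph; if not, monotonicity of l shrinks the strip to g U.  The width halves on
   average, so the coin costs O(log (1 + K)) = O_d(log kappa) queries.

   The output law and the number of queries are read off supersolutions of the
   one-step equations of the resulting Markov chain. *)

(** * Uniform variables from coin tosses *)

(** Equality of laws comes out of inequalities alone. A supersolution bounds the probability of an
    output in [B] from above only; used for [B] and its complement, with bounds that add up to one,
    it forces equality because the machine terminates almost surely. Termination in turn follows
    from the finite expected count, so no limit law of the chain is ever computed.

    A single drift along the ray would have to be about M|u| to keep the rate nonnegative near the
    origin, and the proposal would then have to make up for a factor exp(M|u|), which an acceptance
    probability cannot. Cutting the ray where convexity guarantees a slope of |u|/8 lets the drift
    turn negative there: the total tilt then decreases linearly in |u| and absorbs the weight
    exp(|u|/16) of the slowly decaying proposal.

    A cut reduces the volume but may stretch the ellipsoid in other directions. Its stretch is at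
    most exp(tau/2), and it divides the volume by at least the same factor, so the total stretch
    stays polynomial in kappa; the bound K on the rates feels it only through log K. *)

Section digits.
Variable R : realType.

Definition dbl (x : R) : R := if 1 / 2 <= x then 2 * x - 1 else 2 * x.

Definition digits (x : R) : nat -> bool := fun n => 1 / 2 <= iter n dbl x.

Definition dyadic (w : seq bool) : R := foldr (fun (b : bool) v => ((b : nat)%:R + v) / 2) 0 w.

Lemma dbl_itv x : 0 <= x < 1 -> 0 <= dbl x < 1.
Proof. by rewrite /dbl; case: ifPn; lra. Qed.

Lemma mkseq_digits x n :
  mkseq (digits x) n.+1 = (1 / 2 <= x) :: mkseq (digits (dbl x)) n.
Proof.
rewrite /mkseq/= (iotaDl 1 0 n) -map_comp; congr (_ :: _).
by apply: eq_map => k; rewrite /digits/= -iterSr.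
Qed.

Lemma dyadic_itv w : 0 <= dyadic w <= 1 - 2^-1 ^+ size w.
Proof.
elim: w => [|b w IH] /=; first by rewrite expr0 subrr lexx.
by rewrite exprS; case: b => /=; lra.
Qed.

(** Reading a digit replaces x by [dbl x], and each branch of [dbl] maps its half of the unit
    interval affinely onto the whole; the claim for b :: w is the claim for w, rescaled. *)
Lemma digits_dyadic w x : 0 <= x < 1 ->
  (mkseq (digits x) (size w) = w) <-> dyadic w <= x < dyadic w + 2^-1 ^+ size w.
Proof.
elim: w x => [|b w IH] x x01; first by rewrite /= expr0 add0r; split.
rewrite /= mkseq_digits exprS; have := dyadic_itv w.
have {}IH := IH _ (dbl_itv x01).
have : dbl x = (if 1 / 2 <= x then 2 * x - 1 else 2 * x) by [].
set m := mkseq (digits (dbl x)) _ in IH *; set y := dbl x in IH *; case: IH => IH1 IH2.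
set p := (_ ^+ size w) in IH1 IH2 * => yE d01.
split=> [[bE /IH1]|H].
  by move: bE yE; case: ifPn; case: b => //=; lra.
have bE : (1 / 2 <= x) = b.
  by apply/idP/idP; case: b H => /=; lra.
rewrite bE; congr (_ :: _); apply: IH2; move: yE; rewrite bE.
by case: b bE H => /=; lra.
Qed.

End digits.

Lemma countable_bigcup_measurable d (T : measurableType d) (I : countType)
    (D : set I) (F : I -> set T) :
  (forall i, D i -> measurable (F i)) -> measurable (\bigcup_(i in D) F i).
Proof.
move=> mF; rewrite bigcup_mkcond; apply: countable_bigcupT_measurable => // i.
by case: ifPn => // /set_mem; exact: mF.
Qed.

Section coin.

Definition cyl (w : seq bool) : set (nat -> bool) :=
  [set o | mkseq o (size w) = w].

Definition cylinders : set (set (nat -> bool)) :=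
  [set C | C = set0 \/ exists w, C = cyl w].

Definition coin := g_sigma_algebraType cylinders.

(** Binary words form a tree, so two cylinders are nested or disjoint. *)
Lemma cylI v w : (size v <= size w)%N ->
  cyl v `&` cyl w = if take (size v) w == v then cyl w else set0.
Proof.
move=> vw; have tk (o : nat -> bool) : take (size v) (mkseq o (size w)) =
    mkseq o (size v) by rewrite /mkseq -map_take take_iota (minn_idPl vw).
case: eqP => [vE|nvE]; apply/seteqP; split => o //=.
- by case.
- by move=> ow; split => //; rewrite /cyl/= -tk ow.
- by move=> [ov ow]; apply: nvE; rewrite -[in LHS]ow tk ov.
Qed.

Lemma measurable_cyl w : measurable (cyl w : set coin).
Proof. by apply: sub_sigma_algebra; right; exists w. Qed.

Lemma measurable_fun_coin d (T : measurableType d) (f : T -> coin) :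
  (forall n, measurable_fun setT (f ^~ n)) -> measurable_fun setT f.
Proof.
move=> mf; apply: (@measurability _ _ _ _ setT f cylinders) => //.
move=> _ [C [->|[w ->]] <-]; rewrite setTI ?preimage_set0//.
rewrite (_ : _ @^-1` _ =
    \bigcap_(i in `I_(size w)) (f ^~ i @^-1` [set nth false w i])).
  apply: bigcap_measurableType => i _; rewrite -[X in measurable X]setTI.
  exact: mf.
apply/seteqP; split => x.
  by move=> fx i /= iw; rewrite -[in RHS]fx nth_mkseq.
move=> fx /=; apply: (@eq_from_nth _ false).
  by rewrite size_mkseq.
by move=> i; rewrite size_mkseq => iw; rewrite nth_mkseq// fx.
Qed.

Lemma measurable_coin_coord n : measurable_fun setT (fun o : coin => o n).
Proof.
suff H b : measurable [set o : coin | o n = b].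
  move=> _ Y _; rewrite setTI.
  have -> : (fun o : coin => o n) @^-1` Y =
    \bigcup_(b in Y) [set o : coin | o n = b].
    by apply/seteqP; split=> o /=; [exists (o n)|by move=> [c Yc ->]].
  by apply: countable_bigcup_measurable => x _; exact: H.
have -> : [set o : coin | o n = b] =
    \bigcup_(w in [set w | size w = n.+1 /\ nth false w n = b]) cyl w.
  apply/seteqP; split=> o /=.
    move=> ob; exists (mkseq o n.+1) => /=; last by rewrite /cyl/= size_map size_iota.
    by rewrite size_map size_iota -/(mkseq o n.+1) nth_mkseq.
  by move=> [w [sw wb]]; rewrite /cyl/= => ow; rewrite -wb -ow sw nth_mkseq.
by apply: countable_bigcup_measurable => w _; exact: measurable_cyl.
Qed.

Lemma measurable_digits (R : realType) :
  measurable_fun setT (@digits R : measurableTypeR R -> coin).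
Proof.
apply: measurable_fun_coin => n; apply: measurable_fun_ler.
  exact: measurable_cst.
elim: n => [|n IH]; [exact: measurable_id|rewrite /= /dbl]; apply: measurable_fun_ifT.
- by apply: measurable_fun_ler => //; exact: measurable_cst.
- apply: measurable_funB; last exact: measurable_cst.
  by apply: measurable_funM => //; exact: measurable_cst.
- by apply: measurable_funM => //; exact: measurable_cst.
Qed.

End coin.

Section coin_law.
Variable R : realType.

Let digits_mfun : {mfun measurableTypeR R >-> coin} :=
  HB.pack (@digits R) (isMeasurableFun.Build _ _ (measurableTypeR R) coin _ (@measurable_digits R)).

(** Fair independent tosses, realised as the binary digits of a uniform variable; [locked] keeps
    this realisation from being unfolded. *)
Definition coinP : probability coin R :=
  locked (distribution (uniform_prob (@ltr01 R)) digits_mfun : probability coin R).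

Lemma coinP_cyl w : coinP (cyl w) = (2^-1 ^+ size w)%:E.
Proof.
rewrite /coinP -lock.
have mA : measurable (@digits R @^-1` cyl w : set (measurableTypeR R)).
  rewrite -[X in measurable X]setTI; apply: measurable_digits => //.
  exact: measurable_cyl.
transitivity (\int[uniform_prob (@ltr01 R)]_x
    (\1_(@digits R @^-1` cyl w : set (measurableTypeR R)) x)%:E)%E.
  by rewrite integral_indic// setIT.
rewrite integral_uniform//; last by apply/measurable_EFinP; exact: measurable_indic.
(* The endpoint 1 is dropped because [digits_dyadic] describes expansions on [0, 1[ only. *)
rewrite subr0 invr1 mul1e -integral_itv_bndo_bndc; last first.
  by apply/measurable_funTS/measurable_EFinP; exact: measurable_indic.
have /andP[d0 d1] := dyadic_itv R w; set p := (_ ^+ _) in d1 *.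
have p0 : 0 < p by rewrite exprn_gt0// invr_gt0.
transitivity (\int[lebesgue_measure]_(x in `[0%R, 1%R[)
    (\1_(`[dyadic R w, dyadic R w + p[ : set (measurableTypeR R)) x)%:E)%E.
  apply: eq_integral => x; rewrite inE/= in_itv/= => x01.
  have [H1 H2] := digits_dyadic w x01; rewrite !indicE; congr (_%:R%:E).
  congr nat_of_bool; apply/idP/idP; rewrite !inE/= in_itv/=; [exact: H1|exact: H2].
rewrite integral_indic// setIidl.
  apply: (etrans (lebesgue_measure_itv `[dyadic R w, dyadic R w + p[)).
  by rewrite /= lte_fin ltrDl p0 -EFinB addrC addKr.
move=> x /=; rewrite !in_itv/=; lra.
Qed.

Definition bitsum (o : coin) (n : nat) : R :=
  \sum_(k < n) (o k : nat)%:R * 2^-1 ^+ k.+1.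

Lemma bitsum_digits x n : 0 <= x < 1 ->
  x = bitsum (digits x) n + 2^-1 ^+ n * iter n (@dbl R) x.
Proof.
move=> x01; elim: n => [|n IH]; first by rewrite /bitsum big_ord0 expr0 mul1r add0r.
rewrite {1}IH /bitsum big_ord_recr/= -addrA; congr (_ + _).
by rewrite exprS {2}/dbl /digits; case: ifPn => _ /=; field.
Qed.

Lemma bitsum_nd o : nondecreasing_seq (bitsum o).
Proof.
apply/nondecreasing_seqP => n; rewrite /bitsum big_ord_recr/= lerDl.
by rewrite mulr_ge0// exprn_ge0.
Qed.

Lemma bitsum_cvg o : cvgn (bitsum o).
Proof.
apply: nondecreasing_is_cvgn; first exact: bitsum_nd.
exists 1 => _ [n _ <-]; suff : bitsum o n <= 1 - 2^-1 ^+ n.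
  by move/le_trans; apply; rewrite gerBl exprn_ge0.
elim: n => [|n IH]; first by rewrite /bitsum big_ord0 expr0 subrr.
rewrite /bitsum big_ord_recr/=; move: IH; rewrite /bitsum exprS.
have := exprn_ge0 n (_ : 0 <= 2^-1 :> R); rewrite invr_ge0 ler0n => /(_ erefl).
by case: (o n) => /=; lra.
Qed.

(** The sum is 0 or 1 on the two constant sequences only; replacing these values by 2^-1 makes
    [unif_itv] hold for every outcome, so that logarithms and strict bounds need no exceptional
    set. *)
Definition unif (o : coin) : R :=
  if 0 < limn (bitsum o) < 1 then limn (bitsum o) else 2^-1.

Lemma unif_itv o : 0 < unif o < 1.
Proof. by rewrite /unif; case: ifPn => // _; lra. Qed.

Lemma measurable_unif : measurable_fun setT unif.
Proof.
have ml : measurable_fun setT (fun o => limn (bitsum o) : measurableTypeR R).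
  apply: (@measurable_fun_cvg _ _ _ _ (fun n o => bitsum o n)) => [n|o _].
    apply: measurable_sum => k; apply: measurable_funM => //.
    apply: (@measurableT_comp _ _ _ _ _ _ (fun b : bool => (b : nat)%:R : R)) => //.
    exact: measurable_coin_coord.
  exact: bitsum_cvg.
apply: measurable_fun_ifT => //; apply: measurable_and; exact: measurable_fun_ltr.
Qed.

Lemma unif_digits x : 0 < x < 1 -> unif (digits x) = x.
Proof.
move=> x01; have x01' : 0 <= x < 1 by lra.
have it n : 0 <= iter n (@dbl R) x < 1 by elim: n => //= n; exact: dbl_itv.
suff : bitsum (digits x) @ \oo --> x.
  by move=> /cvg_lim xE; rewrite /unif xE// x01.
have H : (fun n => 2^-1 ^+ n : R) @ \oo --> (0 : R).
  by apply: cvg_expr; rewrite ger0_norm; lra.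
apply: (@squeeze_cvgr _ _ _ _ (fun n => x - 2^-1 ^+ n) (fun=> x)).
- near=> n; have := bitsum_digits n x01'; have := it n.
  have : 0 <= 2^-1 ^+ n :> R by rewrite exprn_ge0// invr_ge0.
  move: (_ ^+ _) (bitsum _ _) (iter _ _ _) => p b y p0 y01 xE.
  by apply/andP; split; nra.
- by rewrite -[X in _ --> X]subr0; apply: cvgB => //; exact: cvg_cst.
- exact: cvg_cst.
Unshelve. all: by end_near.
Qed.

(** [coinP] is the image of the uniform law under [digits], and [unif] inverts [digits] on ]0,
    1[. *)
Lemma integral_unif (phi : R -> \bar R) :
  measurable_fun setT (phi : measurableTypeR R -> \bar R) ->
  (forall x, 0 <= phi x)%E ->
  (\int[coinP]_o phi (unif o) = \int[lebesgue_measure]_(x in `]0%R, 1%R[) phi x)%E.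
Proof.
move=> mphi phi0.
have mphiu : measurable_fun setT (phi \o unif) by exact: measurableT_comp measurable_unif.
rewrite /coinP -lock /= /distribution ge0_integral_pushforward//=; last exact: measurable_digits.
rewrite preimage_setT integral_uniform//=; last first.
  exact: (measurableT_comp mphiu (@measurable_digits R)).
rewrite subr0 invr1 mul1e integral_itv_bndoo; last first.
  by apply: measurable_funTS; exact: (measurableT_comp mphiu (@measurable_digits R)).
by apply: eq_integral => x; rewrite inE/= in_itv/= => x01; rewrite unif_digits.
Qed.

End coin_law.

(** * Splitting one sequence of tosses into two independent ones *)

Section split.
Variable R : realType.

Definition unzip (o : coin) : coin * coin :=
  ((fun n => o n.*2) : coin, (fun n => o n.*2.+1) : coin).

Lemma measurable_unzip : measurable_fun setT unzip.
Proof.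
apply/measurable_fun_pairP; split.
  exact: (measurable_fun_coin (fun n => measurable_coin_coord n.*2)).
exact: (measurable_fun_coin (fun n => measurable_coin_coord n.*2.+1)).
Qed.

Lemma measurable_unzip1 : measurable_fun setT (fun o : coin => (unzip o).1).
Proof. by apply: (measurableT_comp measurable_fst); exact: measurable_unzip. Qed.

Lemma measurable_unzip2 : measurable_fun setT (fun o : coin => (unzip o).2).
Proof. by apply: (measurableT_comp measurable_snd); exact: measurable_unzip. Qed.

Definition zipbits (v w : seq bool) : seq bool :=
  flatten [seq [:: p.1; p.2] | p <- zip v w].

Lemma size_zipbits v w : size v = size w -> size (zipbits v w) = (size v).*2.
Proof.
rewrite /zipbits; elim: v w => [|b v IH] [|c w]//= [vw].
by rewrite IH// doubleS.
Qed.

Lemma mkseqS (T : Type) (o : nat -> T) n :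
  mkseq o n.+1 = o 0%N :: mkseq (fun k => o k.+1) n.
Proof. by rewrite /mkseq/= (iotaDl 1 0) -map_comp. Qed.

Lemma unzip_cyl v w : size v = size w ->
  unzip @^-1` (cyl v `*` cyl w) = cyl (zipbits v w).
Proof.
move=> vw; suff H (o : coin) : cyl (zipbits v w) o <->
    cyl v (unzip o).1 /\ cyl w (unzip o).2.
  by apply/seteqP; split=> o /=; case: (H o).
rewrite /cyl/= size_zipbits//.
elim: v w o vw => [|b v IH] [|c w]//= o [vw].
rewrite doubleS !mkseqS /=.
have [H1 H2] := IH w (fun k => o k.+2) vw.
split=> [[<- <- /H1[Hv Hw]]|[[<- Hv] [<- Hw]]]; first by rewrite -{2}Hv -{2}Hw.
by rewrite H2.
Qed.

(** Rectangles of words of equal length: their preimages under [unzip] are single cylinders. *)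
Let cyl2 : set (set (coin * coin)%type) := [set C | C = set0 \/
  exists v w, size v = size w /\ C = cyl v `*` cyl w].

Let cyl2_setI : setI_closed cyl2.
Proof.
have H v w v' w' : size v = size w -> size v' = size w' ->
    (size v <= size v')%N -> cyl2 (cyl v `*` cyl w `&` cyl v' `*` cyl w').
  move=> vw vw' vv'; rewrite -setXI !cylI//; last by rewrite -vw -vw'.
  case: ifP => _; last by left; rewrite set0X.
  case: ifP => _; last by left; rewrite setX0.
  by right; exists v', w'.
move=> A B [->|[v [w [vw ->]]]] [->|[v' [w' [vw' ->]]]];
  rewrite ?(set0I, setI0); try by left.
by case: (leqP (size v) (size v')) => [|/ltnW] vv'; [|rewrite setIC]; exact: H.
Qed.

(** A cylinder in one factor is the countable union of the rectangles over all words of the same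
    length in the other. *)
Let cyl2_measurable : @measurable _ (coin * coin)%type = <<s cyl2 >>.
Proof.
apply/seteqP; split.
  apply: smallest_sub; first exact: smallest_sigma_algebra.
  have mf : @measurable_fun _ _ (g_sigma_algebraType cyl2) coin setT fst.
    apply: (@measurability _ _ (g_sigma_algebraType cyl2) coin setT fst cylinders) => //.
    move=> _ [C [->|[v ->]] <-]; rewrite setTI ?preimage_set0//.
    have -> : fst @^-1` cyl v = \bigcup_(w in [set w | size v = size w])
        (cyl v `*` cyl w : set (g_sigma_algebraType cyl2)).
      apply/seteqP; split=> -[x y] /=; last by move=> [w _ []].
      move=> ov.
      by exists (mkseq y (size v)); rewrite /= ?size_mkseq//; split => //=; rewrite /cyl/= size_mkseq.
    apply: countable_bigcup_measurable => w vw; apply: sub_sigma_algebra.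
    by right; exists v, w.
  have ms : @measurable_fun _ _ (g_sigma_algebraType cyl2) coin setT snd.
    apply: (@measurability _ _ (g_sigma_algebraType cyl2) coin setT snd cylinders) => //.
    move=> _ [C [->|[v ->]] <-]; rewrite setTI ?preimage_set0//.
    have -> : snd @^-1` cyl v = \bigcup_(w in [set w | size w = size v])
        (cyl w `*` cyl v : set (g_sigma_algebraType cyl2)).
      apply/seteqP; split=> -[x y] /=; last by move=> [w _ []].
      move=> ov.
      by exists (mkseq x (size v)); rewrite /= ?size_mkseq//; split => //=; rewrite /cyl/= size_mkseq.
    apply: countable_bigcup_measurable => w vw; apply: sub_sigma_algebra.
    by right; exists w, v.
  by move=> C [] [A mA <-]; [exact: mf|exact: ms].
apply: smallest_sub; first exact: sigma_algebra_measurable.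
move=> _ [->|[v [w [_ ->]]]]; first exact: measurable0.
by apply: measurableX; exact: measurable_cyl.
Qed.

(** Uniqueness of measures on the intersection-stable generator [cyl2]: both sides give 2^-(2n) to a
    rectangle of words of length n. *)
Lemma unzip_law A : measurable A ->
  pushforward (coinP R) unzip A = (coinP R \x coinP R)%E A.
Proof.
have cyl0 : cyl [::] = setT by apply/seteqP; split.
pose m : {measure set (coin * coin) -> \bar R} :=
  measure_function_pushforward__canonical__measure_function_Measure (coinP R) measurable_unzip.
rewrite -[LHS]/(m A).
apply: (@measure_unique _ R (coin * coin)%type cyl2 (fun=> setT) cyl2_measurable cyl2_setI _ _ m
  (coinP R \x coinP R)%E).
- by move=> _; right; exists [::], [::]; rewrite cyl0 setXTT.
- by rewrite bigcup_const.
- move=> _ [->|[v [w [vw ->]]]]; first by rewrite !measure0.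
  transitivity (coinP R (cyl v) * coinP R (cyl w))%E; last exact/esym/(product_measure1E (coinP R) (coinP R)
    (measurable_cyl v) (measurable_cyl w)).
  rewrite !coinP_cyl -EFinM -exprD -vw addnn -(size_zipbits vw) -coinP_cyl.
  by rewrite -unzip_cyl.
- by move=> _; rewrite /m/= /pushforward preimage_setT probability_setT ltry.
Qed.

Lemma integral_unzip (phi : coin * coin -> \bar R) :
  measurable_fun setT phi -> (forall x, 0 <= phi x)%E ->
  (\int[coinP R]_o phi (unzip o) =
   \int[coinP R]_a \int[coinP R]_b phi (a, b))%E.
Proof.
move=> mphi phi0; rewrite -[RHS]fubini_tonelli1//.
transitivity (\int[pushforward (coinP R) unzip]_x phi x)%E.
  by rewrite ge0_integral_pushforward//; exact: measurable_unzip.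
apply: eq_measure_integral => [|? A mA _]; first exact: measurable_unzip.
exact: unzip_law.
Qed.

End split.

Arguments unzip : simpl never.

(** * Lebesgue measure on row vectors *)

Section lebesgue_line.
Variable R : realType.
Local Notation leb := (@lebesgue_measure R).

Lemma integral_shift (a : R) (phi : R -> \bar R) :
  measurable_fun setT (phi : measurableTypeR R -> \bar R) ->
  (forall x, 0 <= phi x)%E ->
  (\int[leb]_x phi (x + a)%R = \int[leb]_x phi x)%E.
Proof.
move=> mphi phi0.
have mD : measurable_fun setT (fun x : measurableTypeR R => x + a : measurableTypeR R).
  by apply: measurable_funD; [exact: measurable_id|exact: measurable_cst].
pose m : {measure set (measurableTypeR R) -> \bar R} :=
  measure_function_pushforward__canonical__measure_function_Measure leb mD.
have mE A : measurable A -> leb A = m A.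
  apply: lebesgue_measure_unique => X [[x y]] _ <-.
  transitivity (leb ((fun z => z + a) @^-1` `]x, y]%classic)); last by [].
  rewrite (_ : _ @^-1` _ = `]x - a, y - a]%classic); last first.
    by apply/seteqP; split=> z /=; rewrite !in_itv/=; lra.
  rewrite !lebesgue_measure_itv/= !lte_fin ltrD2r; case: ifP => // _.
  by rewrite -!EFinB opprB addrA subrK.
transitivity (\int[m]_x phi x)%E.
  rewrite ge0_integral_pushforward//.
by apply: eq_measure_integral => A mA _; exact/esym/mE.
Qed.

End lebesgue_line.

Section lebesgue_space.
Variable R : realType.
Local Notation leb := (@lebesgue_measure R).
Local Notation lambda := (lebesgue_rV R).

Lemma measurable_addrV n d (T : measurableType d) (f g : T -> 'rV[R]_n) :
  measurable_fun setT f -> measurable_fun setT g ->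
  measurable_fun setT (fun x => f x + g x).
Proof.
move=> mf mg; apply: measurable_fun_rV => i.
rewrite (_ : (fun x => _) = (fun x => f x 0 i + g x 0 i)); last first.
  by apply/funext => x; rewrite mxE.
by apply: measurable_funD; apply: (measurableT_comp (measurable_coord i)).
Qed.

Lemma measurable_scalerV n d (T : measurableType d) (a : T -> R) (f : T -> 'rV[R]_n) :
  measurable_fun setT a -> measurable_fun setT f ->
  measurable_fun setT (fun x => a x *: f x).
Proof.
move=> ma mf; apply: measurable_fun_rV => i.
rewrite (_ : (fun x => _) = (fun x => a x * f x 0 i)); last first.
  by apply/funext => x; rewrite mxE.
by apply: measurable_funM => //; apply: (measurableT_comp (measurable_coord i)).
Qed.

Lemma measurable_mulmx m n d (T : measurableType d) (f : T -> 'rV[R]_m)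
    (A : T -> 'M[R]_(m, n)) :
  measurable_fun setT f ->
  (forall i j, measurable_fun setT (fun x => A x i j : measurableTypeR R)) ->
  measurable_fun setT (fun x => f x *m A x).
Proof.
move=> mf mA; apply: measurable_fun_rV => j.
rewrite (_ : (fun x => _) = (fun x => \sum_k f x 0 k * A x k j)); last first.
  by apply/funext => x; rewrite mxE.
apply: measurable_sum => k.
apply: measurable_funM; last exact: mA.
exact: (measurableT_comp (measurable_coord k)).
Qed.

Lemma integral_consrV n (phi : 'rV[R]_n.+1 -> \bar R) :
  measurable_fun setT phi -> (forall x, 0 <= phi x)%E ->
  (\int[lambda n.+1]_x phi x = \int[leb]_a \int[lambda n]_v phi (consrV (a, v)))%E.
Proof.
move=> mphi phi0.
transitivity (\int[leb \x lambda n]_p phi (consrV p))%E.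
  rewrite [LHS](@ge0_integral_pushforward _ _ _ _ _ (@consrV R n))//.
  exact: measurable_consrV.
rewrite fubini_tonelli1//.
by apply: measurableT_comp => //; exact: measurable_consrV.
Qed.

Lemma consrVD n (a b : R) (v w : 'rV[R]_n) :
  consrV (a + b, v + w) = consrV (a, v) + consrV (b, w) :> 'rV[R]_n.+1.
Proof.
transitivity (row_mx ((a%:M : 'M[R]_1) + b%:M) (v + w)).
  by rewrite /consrV/= (raddfD (@scalar_mx R 1)).
exact: (esym (add_row_mx (a%:M : 'M[R]_1) v (b%:M : 'M[R]_1) w)).
Qed.

Lemma measurable_pair_integral d1 d2 (T1 : measurableType d1)
    (T2 : measurableType d2) (mu : {sigma_finite_measure set T2 -> \bar R})
    (f : T1 * T2 -> \bar R) :
  measurable_fun setT f -> (forall x, 0 <= f x)%E ->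
  measurable_fun setT (fun x => \int[mu]_y f (x, y))%E.
Proof. exact: measurable_fun_fubini_tonelli_F. Qed.

Lemma integral_shiftrV n (a : 'rV[R]_n) (phi : 'rV[R]_n -> \bar R) :
  measurable_fun setT phi -> (forall x, 0 <= phi x)%E ->
  (\int[lambda n]_x phi (x + a)%R = \int[lambda n]_x phi x)%E.
Proof.
elim: n a phi => [|n IH] a phi mphi phi0.
  by apply: eq_integral => x _; congr phi; apply/rowP => -[].
have ma : measurable_fun setT (fun x : 'rV[R]_n.+1 => x + a).
  by apply: measurable_addrV => //; exact: measurable_cst.
rewrite integral_consrV//; last by apply: measurableT_comp.
have [b [v aE]] : exists b v, a = consrV (b, v).
  exists (a 0 ord0), (\row_i a 0 (lift ord0 i)); apply/rowP => i.
  case: (split_ordP (i : 'I_(1 + n))) => j ->.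
    apply: (etrans _ (esym (row_mxEl _ _ _ _))); rewrite ord1 mxE eqxx mulr1n.
    by congr (a 0 _); apply/val_inj.
  apply: (etrans _ (esym (row_mxEr _ _ _ _))); rewrite mxE.
  by congr (a 0 _); apply/val_inj.
transitivity (\int[leb]_c \int[lambda n]_w phi (consrV ((c + b)%R, w)))%E.
  apply: eq_integral => c _; rewrite aE; under eq_integral do rewrite -consrVD.
  rewrite (IH v (fun w => phi (consrV ((c + b)%R, w))))//.
  apply: measurableT_comp => //.
  apply: (measurableT_comp (@measurable_consrV R n)).
  exact: pair1_measurable.
rewrite (@integral_shift R b (fun c : measurableTypeR R => \int[lambda n]_w phi (consrV (c, w)))%E).
- by rewrite integral_consrV.
- apply: (@measurable_pair_integral _ _ (measurableTypeR R) _ (lambda n) (fun p => phi (consrV p))) => //.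
  by apply: measurableT_comp => //; exact: measurable_consrV.
- by move=> x; exact: integral_ge0.
Qed.

Definition rbox n (a b : R) : set 'rV[R]_n := [set x | forall i, a <= x 0 i <= b].

Lemma measurable_rbox n a b : measurable (@rbox n a b).
Proof.
rewrite (_ : rbox _ _ = \bigcap_(i in [set: 'I_n]) (fun x : 'rV[R]_n => x 0 i) @^-1` `[a, b]).
  apply: fin_bigcap_measurable => // i _; rewrite -[X in measurable X]setTI.
  exact: measurable_coord.
by apply/seteqP; split=> x /= H i; have := H i; rewrite /= in_itv/= => // /(_ I).
Qed.

Lemma rbox_consrV n a b (c : R) (v : 'rV[R]_n) :
  rbox a b (consrV (c, v)) <-> a <= c <= b /\ rbox a b v.
Proof.
have E0 : consrV (c, v) 0 ord0 = c by have := consrVK (c, v); rewrite /unconsrV => -[].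
have ES i : consrV (c, v) 0 (lift ord0 i) = v 0 i.
  by have := consrVK (c, v); rewrite /unconsrV => -[_ /rowP/(_ i)]; rewrite mxE.
split=> [H|[H1 H2] i]; first by split=> [|i]; [rewrite -E0|rewrite -ES]; exact: H.
by case: (unliftP ord0 i) => [j|] ->; rewrite ?ES ?E0.
Qed.

Lemma lebesgue_rbox n (a b : R) : a <= b ->
  lambda n (rbox a b) = ((b - a) ^+ n)%:E.
Proof.
move=> ab; elim: n => [|n IH].
  rewrite expr0 /= diracE (_ : _ \in _ = true)//; apply/mem_set.
  by move=> -[].
transitivity (\int[lambda n.+1]_x (\1_(@rbox n.+1 a b) x)%:E)%E.
  by rewrite integral_indic ?setIT//; exact: measurable_rbox.
rewrite integral_consrV; last by [].
- transitivity (\int[leb]_x ((\1_(`[a, b] : set (measurableTypeR R)) x)%:E * ((b - a) ^+ n)%:E))%E.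
    apply: eq_integral => x _; rewrite indicE; case: (boolP (x \in _)) => xab.
      rewrite mul1e -IH; transitivity (\int[lambda n]_v (\1_(@rbox n a b) v)%:E)%E; last first.
        by rewrite integral_indic ?setIT//; exact: measurable_rbox.
      apply: eq_integral => v _; rewrite !indicE; congr (_%:R%:E); congr nat_of_bool.
      move: xab; rewrite inE/= in_itv/= => xab.
      have [H1 H2] := rbox_consrV a b x v.
      by apply/idP/idP; rewrite !inE => H; [case: (H1 H)|exact: H2].
    rewrite mul0e; apply: integral0_eq => v _; rewrite indicE.
    case: (boolP (_ \in _)) => // /set_mem H; have [xx _] := (rbox_consrV a b x v).1 H.
    by move: xab; rewrite notin_setE/= in_itv/= => /negP; rewrite xx.
  rewrite ge0_integralZr//; last by rewrite lee_fin exprn_ge0// subr_ge0.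
    rewrite integral_indic// setIT; apply: (etrans (congr1 (fun z => (z * _)%E) (lebesgue_measure_itv `[a, b]))).
    rewrite /= lte_fin; case: ltgtP ab => // [ab _|<- _]; last by rewrite subrr exprS mul0r mul0e.
    by rewrite exprS EFinM EFinB.
  by apply/measurable_EFinP; exact: measurable_indic.
- by apply/measurable_EFinP; apply: measurable_indic; exact: measurable_rbox.
Qed.

(** The argument for uniqueness of Haar measure. With F the indicator of the symmetric unit cube,
    Tonelli and translation invariance turn (int F(xA)) (int phi) into (int phi(xA)) (int F), so the
    two functionals of phi are proportional, with a factor given by the volume of the preimage of
    the cube. *)
Lemma integral_linear n (A : 'M[R]_n) : A \in unitmx ->
  exists2 k : R, 0 < k & forall phi : 'rV[R]_n -> \bar R,
    measurable_fun setT phi -> (forall x, 0 <= phi x)%E ->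
    (\int[lambda n]_x phi (x *m A) = k%:E * \int[lambda n]_x phi x)%E.
Proof.
move=> uA.
pose F (x : 'rV[R]_n) : \bar R := (\1_(@rbox n (-1) 1) x)%:E.
have mF : measurable_fun setT F by apply/measurable_EFinP; apply: measurable_indic; exact: measurable_rbox.
have F0 x : (0 <= F x)%E by rewrite lee_fin.
have mA : measurable_fun setT (fun x : 'rV[R]_n => x *m A) by apply: measurable_mulmx.
have Fsym x : F (- x) = F x.
  rewrite /F !indicE; congr (_%:R%:E); congr nat_of_bool.
  by apply/idP/idP; rewrite !inE => H i; have := H i; rewrite !mxE; lra.
have key phi : measurable_fun setT phi -> (forall x, 0 <= phi x)%E ->
   ((\int[lambda n]_x F (x *m A)) * (\int[lambda n]_x phi x) =
    (\int[lambda n]_x phi (x *m A)) * (\int[lambda n]_x F x))%E.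
  move=> mphi phi0.
  pose sub (p : 'rV[R]_n * 'rV[R]_n) := p.1 *m A + (-1) *: p.2.
  have msub : measurable_fun setT sub.
    apply: measurable_addrV; first by apply: (measurableT_comp mA); exact: measurable_fst.
    by apply: measurable_scalerV; [exact: measurable_cst|exact: measurable_snd].
  have mfstA : measurable_fun setT (fun p : 'rV[R]_n * 'rV[R]_n => p.1 *m A).
    by apply: (measurableT_comp mA); exact: measurable_fst.
  have mG : measurable_fun setT (fun p : 'rV[R]_n * 'rV[R]_n => F (p.1 *m A) * phi (p.2 + p.1 *m A)%R)%E.
    apply: emeasurable_funM; first exact: (measurableT_comp mF).
    by apply: (measurableT_comp mphi); apply: measurable_addrV => //; exact: measurable_snd.
  have mH : measurable_fun setT (fun p : 'rV[R]_n * 'rV[R]_n => F (sub p) * phi (p.1 *m A))%E.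
    by apply: emeasurable_funM; [exact: (measurableT_comp mF)|exact: (measurableT_comp mphi)].
  have mFA : measurable_fun setT (fun x => F (x *m A)) by exact: (measurableT_comp mF).
  have mphiA : measurable_fun setT (fun x => phi (x *m A)) by exact: (measurableT_comp mphi).
  have mtr y : measurable_fun setT (fun x : 'rV[R]_n => x + y).
    by apply: measurable_addrV => //; exact: measurable_cst.
  have G0 p : (0 <= F (p.1 *m A) * phi (p.2 + p.1 *m A)%R)%E by exact: mule_ge0.
  have H0 p : (0 <= F (sub p) * phi (p.1 *m A))%E by exact: mule_ge0.
  transitivity (\int[lambda n]_x \int[lambda n]_y (F (x *m A) * phi (y + x *m A)%R))%E.
    rewrite -ge0_integralZr//; last by exact: integral_ge0.
    apply: eq_integral => x _; rewrite ge0_integralZl//.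
      by rewrite (integral_shiftrV (x *m A)).
    exact: (measurableT_comp mphi).
  apply: etrans (fubini_tonelli _ mG G0) _.
  transitivity (\int[lambda n]_y \int[lambda n]_x (F (sub (x, y)) * phi (x *m A)))%E.
    apply: eq_integral => y _; rewrite /fubini_G.
    (* Shifting x by y A^-1 turns y + xA into xA inside phi, and xA into xA - y inside F. *)
    rewrite -(integral_shiftrV (- (y *m invmx A)) (phi := fun x => F (x *m A) * phi (y + x *m A)%R)%E).
    - apply: eq_integral => x _; rewrite /sub /= scaleN1r mulmxDl mulNmx mulmxKV//.
      by rewrite addrCA subrr addr0.
    - apply: emeasurable_funM; first exact: mFA.
      by apply: (measurableT_comp mphi); apply: measurable_addrV => //; exact: measurable_cst.
    - by move=> x; exact: (G0 (x, y)).
  apply: etrans (esym (fubini_tonelli _ mH H0)) _; rewrite /fubini_F.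
  rewrite -ge0_integralZr//; last by exact: integral_ge0.
  apply: eq_integral => x _ /=; rewrite ge0_integralZr//.
    rewrite muleC; congr (_ * _)%E; rewrite -[RHS](integral_shiftrV (- (x *m A)))//.
    by apply: eq_integral => y _; rewrite -Fsym /sub/= scaleN1r opprB.
  apply: (measurableT_comp mF); apply: (measurableT_comp msub); exact: pair1_measurable.
(* S and S' bound the sup-norm distortion of A and of its inverse; they enclose the preimage of the
   cube between two boxes, so that its volume is positive and finite. *)
pose S := \sum_i \sum_j `|A i j|; pose S' := \sum_i \sum_j `|invmx A i j|.
have bd (B : 'M[R]_n) (x : 'rV[R]_n) r j : (forall i, `|x 0 i| <= r) -> 0 <= r ->
    `|(x *m B) 0 j| <= r * \sum_i \sum_j `|B i j|.
  move=> xr r0; rewrite mxE (le_trans (ler_norm_sum _ _ _))// mulr_sumr ler_sum// => i _.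
  rewrite normrM ler_pM// (bigD1 j)//= lerDl; exact: sumr_ge0.
have S0 : 0 <= S by apply: sumr_ge0 => i _; exact: sumr_ge0.
have S'0 : 0 <= S' by apply: sumr_ge0 => i _; exact: sumr_ge0.
have mB : measurable [set x : 'rV[R]_n | rbox (-1) 1 (x *m A)].
  by rewrite -[X in measurable X]setTI; apply: mA => //; exact: measurable_rbox.
have FAE : (\int[lambda n]_x F (x *m A) = lambda n [set x | rbox (-1) 1 (x *m A)])%E.
  by rewrite -[in RHS](setIT [set x | _]) -integral_indic.
have FAoo : (\int[lambda n]_x F (x *m A) < +oo)%E.
  rewrite FAE; apply: (@le_lt_trans _ _ (lambda n (rbox (- S') S'))).
    apply: le_measure; rewrite ?inE//; first exact: measurable_rbox.
    move=> x /= xA i; have := bd (invmx A) (x *m A) 1 i.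
    by rewrite mulmxK// ler_norml mul1r; apply=> // k; rewrite ler_norml; exact: xA.
  by rewrite lebesgue_rbox ?ltry//; lra.
have FA0 : (0 < \int[lambda n]_x F (x *m A))%E.
  rewrite FAE; pose r := (1 + S)^-1; have r0 : 0 < r by rewrite invr_gt0; lra.
  apply: (@lt_le_trans _ _ (lambda n (rbox (- r) r))).
    by rewrite lebesgue_rbox ?lte_fin ?exprn_gt0//; lra.
  apply: le_measure; rewrite ?inE//; first exact: measurable_rbox.
  move=> x /= xr i; rewrite -ler_norml (le_trans (bd A x r i _ _))//.
  - by move=> k; rewrite ler_norml; exact: xr.
  - exact: ltW.
  - by rewrite -/S /r ler_pdivrMl; lra.
have FE : (\int[lambda n]_x F x = (2 ^+ n)%:E)%E.
  transitivity (lambda n (rbox (-1) 1)).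
    by rewrite integral_indic ?setIT//; exact: measurable_rbox.
  by rewrite lebesgue_rbox; [congr (_ ^+ _)%:E; lra|lra].
move: FAoo FA0 key; rewrite FE; case: (\int[lambda n]_x F (x *m A))%E => [I| |]// _; rewrite lte_fin => I0 key.
exists (I / 2 ^+ n) => [|phi mphi phi0]; first by rewrite divr_gt0// exprn_gt0.
have := key _ mphi phi0; have p2 : 2 ^+ n != 0 :> R by rewrite expf_neq0.
move=> /(congr1 (fun z => ((2 ^+ n)^-1)%:E * z)%E).
rewrite muleA -EFinM mulrC => ->; rewrite muleC -muleA -EFinM mulfV// mule1//.
Qed.

End lebesgue_space.

(** * Lebesgue measure as a weighted law of random points *)

Section full_support.
Variable R : realType.
Local Notation leb := (@lebesgue_measure R).
Local Notation lambda := (lebesgue_rV R).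

Definition first_one (o : coin) : nat :=
  if pselect (exists n, o n) is left h then ex_minn h else 0.

Definition first_cyl n := cyl (rcons (nseq n false) true).

Lemma first_cylP n (o : coin) :
  first_cyl n o <-> o n /\ forall k, (k < n)%N -> ~~ o k.
Proof.
rewrite /first_cyl /cyl/= size_rcons size_nseq; split=> [H|[on H]].
  have E k : (k <= n)%N -> o k = nth false (rcons (nseq n false) true) k.
    by move=> kn; rewrite -H nth_mkseq// ltnS.
  split=> [|k kn]; first by rewrite E// nth_rcons size_nseq ltnn eqxx.
  by rewrite E ?(ltnW kn)// nth_rcons size_nseq kn nth_nseq kn.
apply: (@eq_from_nth _ false); first by rewrite size_mkseq size_rcons size_nseq.
move=> k; rewrite size_mkseq ltnS => kn; rewrite nth_mkseq ?ltnS//.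
rewrite nth_rcons size_nseq; case: ltngtP kn => // [kn _|-> _]//.
by rewrite nth_nseq kn; exact/negbTE/H.
Qed.

Lemma first_oneE n o : first_cyl n o -> first_one o = n.
Proof.
move=> /first_cylP[on H]; rewrite /first_one; case: pselect => [h|[]]; last by exists n.
case: ex_minnP => m om mmin; apply/eqP; rewrite eqn_leq mmin//=.
by rewrite leqNgt; apply/negP => /H; rewrite om.
Qed.

Lemma first_cyl_ex (o : coin) : (exists n, o n) <-> exists n, first_cyl n o.
Proof.
split=> [h|[n /first_cylP[on _]]]; last by exists n.
case: (ex_minnP h) => m om mmin; exists m; apply/first_cylP; split=> // k km.
by apply/negP => /mmin; rewrite leqNgt km.
Qed.

Lemma measurable_first_cyl n : measurable (first_cyl n : set coin).
Proof. exact: measurable_cyl. Qed.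

Lemma measurable_first_one : measurable_fun setT first_one.
Proof.
have mD : measurable (\bigcup_n first_cyl n : set coin).
  by apply: bigcup_measurable => n _; exact: measurable_first_cyl.
move=> _ Y _; rewrite setTI.
have -> : first_one @^-1` Y = (\bigcup_(n in Y) first_cyl n) `|`
   (if pselect (Y 0%N) then ~` \bigcup_n first_cyl n else set0).
  apply/seteqP; split=> o /=.
    move=> Yo; have [[n ho]|h] := pselect (exists n, first_cyl n o).
      by left; exists n => //; rewrite -(first_oneE ho).
    right; have h0 : first_one o = 0%N.
      by rewrite /first_one; case: pselect => // k; case: h; apply/first_cyl_ex.
    by move: Yo; rewrite h0; case: pselect => // _ _ [n _ ho]; apply: h; exists n.
  move=> [[n Yn ho]|]; first by rewrite (first_oneE ho).
  case: pselect => // Y0 h; have -> : first_one o = 0%N.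
    rewrite /first_one; case: pselect => // k; case: h.
    by have [j hj] := (first_cyl_ex o).1 k; exists j.
  exact: Y0.
apply: measurableU; first by apply: bigcup_measurable => n _; exact: measurable_first_cyl.
by case: (pselect _) => [h|h] //=; exact: measurableC.
Qed.

(** The inverse 2^(n+1) of the probability of [first_cyl n]. On the sequence without success, where
    [first_one] takes its default 0, the weight vanishes. *)
Definition first_weight (o : coin) : R :=
  if pselect (exists n, o n) then 2 ^+ (first_one o).+1 else 0.

Lemma measurable_first_weight : measurable_fun setT first_weight.
Proof.
rewrite (_ : first_weight = (fun o => \1_(\bigcup_n first_cyl n) o * 2 ^+ (first_one o).+1)).
  apply: measurable_funM.
    by apply: measurable_indic; apply: bigcup_measurable => n _; exact: measurable_first_cyl.
  apply: (@measurableT_comp _ _ _ _ _ _ (fun n : nat => 2 ^+ n.+1 : R)) => //.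
  exact: measurable_first_one.
apply/funext => o; rewrite /first_weight indicE; case: pselect => /= h.
  have [n ho] := (first_cyl_ex o).1 h.
  by rewrite mem_set ?mul1r//; exists n.
by rewrite memNset ?mul0r// => -[n _ ho]; apply: h; apply/first_cyl_ex; exists n.
Qed.

(** Enumerates the integers as 0, -1, 1, -2, ...: the index of z is at most 2|z|, which keeps the
    weights exponential in the point. *)
Definition intcode (n : nat) : int := if odd n then Negz n./2 else Posz n./2.

Definition intdecode (z : int) : nat :=
  match z with Posz k => k.*2 | Negz k => k.*2.+1 end.

Lemma intdecodeK : cancel intdecode intcode.
Proof.
by case=> k; rewrite /intcode/= ?odd_double/= ?doubleK//= uphalf_double.
Qed.

Lemma intcodeK : cancel intcode intdecode.
Proof.
move=> n; rewrite /intcode; case: ifPn => on /=; rewrite -[RHS]odd_double_half.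
  by rewrite on.
by rewrite (negbTE on).
Qed.

Lemma integral_unit_intervals (phi : R -> \bar R) :
  measurable_fun setT (phi : measurableTypeR R -> \bar R) ->
  (forall x, 0 <= phi x)%E ->
  (\sum_(n <oo) \int[leb]_(u in `]0%R, 1%R[) phi ((intcode n)%:~R + u)%R =
   \int[leb]_x phi x)%E.
Proof.
move=> mphi phi0.
pose I n : set (measurableTypeR R) := `[(intcode n)%:~R, (intcode n)%:~R + 1[%classic.
have IT : \bigcup_n I n = setT.
  apply/seteqP; split=> // x _; exists (intdecode (Num.floor x)) => //.
  by rewrite /I/= intdecodeK in_itv/= -[1]/(1%:~R) -intrD; exact: floor_itv.
have tI : trivIset setT I.
  move=> i j _ _ [x []]; rewrite /I/= !in_itv/= => /andP[ix xi] /andP[jx xj].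
  apply: (can_inj intcodeK); apply/eqP; rewrite eq_le.
  have H (p q : int) : p%:~R <= x -> x < q%:~R + 1 -> p <= q.
    by move=> px xq; rewrite -ltzD1 -(ltr_int R) intrD; exact: le_lt_trans xq.
  by rewrite !H.
rewrite -IT ge0_integral_bigcup//; last 2 first.
- by move=> k; exact: measurable_itv.
- by rewrite IT.
apply: eq_eseriesr => n _.
rewrite [RHS]integral_mkcond -(integral_shift (intcode n)%:~R); last 2 first.
- apply/(measurable_restrictT _ _).1; [exact: measurable_itv|exact: measurable_funTS].
- by move=> x; rewrite patchE; case: ifP.
rewrite (@integral_itv_obnd_cbnd _ 0 (BLeft 1) (fun u => phi ((intcode n)%:~R + u)%R)); last first.
  apply/measurable_funTS/(measurableT_comp mphi).
  by apply: measurable_funD; [exact: measurable_cst|exact: measurable_id].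
rewrite integral_mkcond; apply: eq_integral => x _; rewrite !patchE.
rewrite (_ : (x + (intcode n)%:~R \in I n) = (x \in `[0, 1[%classic)); last first.
  by apply/idP/idP; rewrite !inE /I/= !in_itv/=; lra.
by rewrite addrC.
Qed.

(** Importance sampling: a geometric index selects a unit interval, in which the point is uniform.
    Its density is the inverse of [full_weight]. *)
Definition full_point (o : coin) : R :=
  (intcode (first_one (unzip o).1))%:~R + unif R (unzip o).2.

Definition full_weight (o : coin) : R := first_weight (unzip o).1.

(** The index n of the interval is at most 2|x| + 1, and 2^(n+1) <= e^(n+1). In other words, the
    density of the point decays at most exponentially. *)
Lemma full_weight_bound o : 0 <= full_weight o <= expR (2 * `|full_point o| + 2).
Proof.
rewrite /full_weight /full_point /first_weight; case: (pselect _) => [h|h] /=; last by rewrite lexx expR_ge0.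
rewrite exprn_ge0//=.
set n := first_one _; have /andP[u0 u1] := unif_itv R (unzip o).2; move: (unif _ _) u0 u1 => u u0 u1.
have H : n%:R <= 2 * `|(intcode n)%:~R + u| + 1.
  rewrite -[n in n%:R]intcodeK; case: (intcode n) => k /=.
    rewrite -muln2 natrM ger0_norm; first by rewrite -pmulrn; lra.
    by rewrite -pmulrn addr_ge0// ltW.
  rewrite -muln2 -addn1 natrD natrM NegzE mulrNz -pmulrn ler0_norm; rewrite -addn1 natrD;
    have : 0 <= k%:R :> R := ler0n _ _; lra.
apply: (@le_trans _ _ (expR 1 ^+ n.+1)).
  by apply: lerXn2r; rewrite ?nnegrE ?expR_ge0//; have := @expR_ge1Dx R 1; lra.
by rewrite -expRM_natl mulr1 ler_expR -natr1; lra.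
Qed.

Lemma measurable_full_point : measurable_fun setT (full_point : coin -> measurableTypeR R).
Proof.
apply: measurable_funD.
  apply: (@measurableT_comp _ _ _ _ _ _ (fun n : nat => (intcode n)%:~R : R)) => //.
  apply: (measurableT_comp measurable_first_one).
  exact: measurable_unzip1.
apply: (measurableT_comp (@measurable_unif R)).
exact: measurable_unzip2.
Qed.

Lemma measurable_full_weight : measurable_fun setT full_weight.
Proof.
apply: (measurableT_comp measurable_first_weight).
exact: measurable_unzip1.
Qed.

(** On [first_cyl n] the weight cancels the probability, and what remains is the integral over the
    n-th unit interval. *)
Lemma integral_full_point (phi : R -> \bar R) :
  measurable_fun setT (phi : measurableTypeR R -> \bar R) ->
  (forall x, 0 <= phi x)%E ->
  (\int[coinP R]_o ((full_weight o)%:E * phi (full_point o)) = \int[leb]_x phi x)%E.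
Proof.
move=> mphi phi0.
pose z (a : coin) : R := (intcode (first_one a))%:~R.
have mz : measurable_fun setT z.
  apply: (@measurableT_comp _ _ _ _ _ _ (fun n : nat => (intcode n)%:~R : R)) => //.
  exact: measurable_first_one.
pose G (p : coin * coin) : \bar R := ((first_weight p.1)%:E * phi (z p.1 + unif R p.2)%R)%E.
have w0 a : 0 <= first_weight a.
  by rewrite /first_weight; case: (pselect _) => h //=; rewrite exprn_ge0.
have mG : measurable_fun setT G.
  apply: emeasurable_funM.
    by apply/measurable_EFinP; apply: (measurableT_comp measurable_first_weight); exact: measurable_fst.
  apply: (measurableT_comp mphi); apply: measurable_funD.
    by apply: (measurableT_comp mz); exact: measurable_fst.
  by apply: (measurableT_comp (@measurable_unif R)); exact: measurable_snd.
rewrite (integral_unzip mG)/=; last by move=> x; rewrite mule_ge0// lee_fin.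
pose psi n := (\int[leb]_(u in `]0%R, 1%R[) phi ((intcode n)%:~R + u)%R)%E.
have psi0 n : (0 <= psi n)%E by exact: integral_ge0.
have mphic c : measurable_fun setT (fun u : measurableTypeR R => phi (c + u)%R).
  apply: (measurableT_comp mphi).
  by apply: measurable_funD; [exact: measurable_cst|exact: measurable_id].
rewrite -integral_unit_intervals//.
transitivity (\int[coinP R]_(a in \bigcup_n first_cyl n) ((first_weight a)%:E * psi (first_one a)))%E.
  rewrite [RHS]integral_mkcond; apply: eq_integral => a _; rewrite patchE.
  rewrite /G/= ge0_integralZl//; last 2 first.
  - by apply: (measurableT_comp (mphic (z a))); exact: measurable_unif.
  - by rewrite lee_fin.
  rewrite (integral_unif (phi := fun u => phi (z a + u)%R))//.
  case: ifPn => //; rewrite notin_setE => h.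
  rewrite /first_weight; case: (pselect _) => [k|_] /=; last by rewrite mul0e.
  by have [n hn] := (first_cyl_ex a).1 k; case: h; exists n.
have mC := measurable_first_cyl.
rewrite ge0_integral_bigcup//; last 3 first.
- apply: measurable_funTS; apply: emeasurable_funM.
    by apply/measurable_EFinP; exact: measurable_first_weight.
  by apply: (measurableT_comp (_ : measurable_fun setT psi)) => //; exact: measurable_first_one.
- by move=> a _; rewrite mule_ge0// lee_fin.
- by move=> i j _ _ [a [ai aj]]; rewrite -(first_oneE ai) -(first_oneE aj).
apply: eq_eseriesr => n _.
transitivity (\int[coinP R]_(a in first_cyl n) ((2 ^+ n.+1)%:E * psi n))%E.
  apply: eq_integral => a; rewrite inE => an; rewrite /first_weight (first_oneE an).
  by case: (pselect _) => //= -[]; apply/first_cyl_ex; exists n.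
have PC : coinP R (first_cyl n) = (2^-1 ^+ n.+1)%:E.
  by rewrite /first_cyl coinP_cyl size_rcons size_nseq.
transitivity ((2 ^+ n.+1)%:E * psi n * coinP R (first_cyl n))%E.
  exact: integral_cst.
rewrite PC muleAC -EFinM.
by rewrite -exprMn mulfV ?expr1n ?mul1e.
Qed.

Fixpoint rV_point n (o : coin) : 'rV[R]_n :=
  match n with
  | 0 => 0
  | m.+1 => consrV ((full_point (unzip o).1 : measurableTypeR R), rV_point m (unzip o).2)
  end.

Fixpoint rV_weight n (o : coin) : R :=
  match n with
  | 0 => 1
  | m.+1 => full_weight (unzip o).1 * rV_weight m (unzip o).2
  end.

Lemma measurable_rV_point n : measurable_fun setT (@rV_point n).
Proof.
elim: n => [|n IH] /=; first exact: measurable_cst.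
apply: (measurableT_comp (@measurable_consrV R n)).
apply/measurable_fun_pair.
  apply: (measurableT_comp measurable_full_point).
  exact: measurable_unzip1.
apply: (measurableT_comp IH).
exact: measurable_unzip2.
Qed.

Lemma measurable_rV_weight n : measurable_fun setT (@rV_weight n).
Proof.
elim: n => [|n IH] /=; first exact: measurable_cst.
apply: measurable_funM.
  apply: (measurableT_comp measurable_full_weight).
  exact: measurable_unzip1.
apply: (measurableT_comp IH).
exact: measurable_unzip2.
Qed.

Lemma rV_weight_bound n o : 0 <= rV_weight n o <=
  expR (2 * (\sum_i `|rV_point n o 0 i|) + 2 * n%:R).
Proof.
elim: n o => [|n IH] o /=; first by rewrite big_ord0 !mulr0 addr0 expR0 ler01 lexx.
have /andP[IH0 IH1] := IH (unzip o).2.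
have /andP[F0 F1] := full_weight_bound (unzip o).1.
rewrite mulr_ge0//=; apply: le_trans (ler_pM F0 IH0 F1 IH1) _.
have E0 (c : R) (v : 'rV[R]_n) : consrV (c, v) 0 ord0 = c.
  by have := consrVK ((c : measurableTypeR R), v); rewrite /unconsrV => -[].
have ES (c : R) (v : 'rV[R]_n) i : consrV (c, v) 0 (lift ord0 i) = v 0 i.
  by have := consrVK ((c : measurableTypeR R), v); rewrite /unconsrV => -[_ /rowP/(_ i)]; rewrite mxE.
rewrite -expRD ler_expR big_ord_recl E0; under [in leRHS]eq_bigr do rewrite ES.
by rewrite -natr1; lra.
Qed.

Lemma integral_rV_point n (phi : 'rV[R]_n -> \bar R) :
  measurable_fun setT phi -> (forall x, 0 <= phi x)%E ->
  (\int[coinP R]_o ((rV_weight n o)%:E * phi (rV_point n o)) = \int[lambda n]_x phi x)%E.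
Proof.
elim: n phi => [|n IH] phi mphi phi0.
  have -> : (\int[lambda 0]_x phi x = phi 0%R)%E.
    by apply: etrans (integral_dirac _ measurableT mphi) _; rewrite diracT mul1e.
  under eq_integral do rewrite /= mul1e.
  transitivity (phi 0%R * coinP R setT)%E; first exact: integral_cst.
  by rewrite probability_setT mule1.
have mfst : measurable_fun setT (fun p : coin * coin => p.1) by exact: measurable_fst.
have msnd : measurable_fun setT (fun p : coin * coin => p.2) by exact: measurable_snd.
pose G (p : coin * coin) : \bar R := ((full_weight p.1 * rV_weight n p.2)%:E *
   phi (consrV ((full_point p.1 : measurableTypeR R), rV_point n p.2)))%E.
have fw0 a : 0 <= full_weight a by have /andP[] := full_weight_bound a.
have rw0 a : 0 <= rV_weight n a by have /andP[] := rV_weight_bound n a.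
have mG : measurable_fun setT G.
  apply: emeasurable_funM.
    apply/measurable_EFinP; apply: measurable_funM.
      exact: (measurableT_comp measurable_full_weight).
    exact: (measurableT_comp (measurable_rV_weight n)).
  apply: (measurableT_comp mphi); apply: (measurableT_comp (@measurable_consrV R n)).
  apply/measurable_fun_pair; first exact: (measurableT_comp measurable_full_point).
  exact: (measurableT_comp (@measurable_rV_point n) msnd).
rewrite (integral_unzip mG)/=; last by move=> x; rewrite mule_ge0// lee_fin mulr_ge0.
rewrite integral_consrV//.
have mcons c : measurable_fun setT (fun v : 'rV[R]_n => phi (consrV ((c : measurableTypeR R), v))).
  apply: (measurableT_comp mphi); apply: (measurableT_comp (@measurable_consrV R n)).
  exact: pair1_measurable.
rewrite -[RHS](integral_full_point (phi := fun c => \int[lambda n]_v phi (consrV ((c : measurableTypeR R), v)))%E).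
- apply: eq_integral => a _; rewrite -(IH _ (mcons (full_point a)))//.
  rewrite -ge0_integralZl//; last 3 first.
  - apply: emeasurable_funM; first by apply/measurable_EFinP; exact: measurable_rV_weight.
    by apply: (measurableT_comp (mcons _)); exact: measurable_rV_point.
  - by move=> x _; rewrite mule_ge0// lee_fin.
  - by rewrite lee_fin.
  by apply: eq_integral => b _; rewrite /G/= EFinM muleA.
- apply: (@measurable_pair_integral _ _ _ (measurableTypeR R) _ (lambda n) (fun p => phi (consrV p))) => //.
  by apply: measurableT_comp => //; exact: measurable_consrV.
- by move=> x; exact: integral_ge0.
Qed.

End full_support.

(** * Continuous functions are measurable for the coordinate sigma-algebra *)

Section continuous_measurable.
Variable R : realType.

Lemma floor_coord_measurable n k (z : 'rV[int]_n) :
  measurable [set x : 'rV[R]_n | forall i, Num.floor (x 0 i * 2 ^+ k) = z 0 i].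
Proof.
rewrite (_ : [set x | _] = \bigcap_(i in [set: 'I_n])
    (fun x : 'rV[R]_n => x 0 i * 2 ^+ k) @^-1` `[(z 0 i)%:~R, (z 0 i)%:~R + 1[).
  apply: fin_bigcap_measurable => // i _; rewrite -[X in measurable X]setTI.
  have : measurable_fun setT (fun x : 'rV[R]_n => x 0 i * 2 ^+ k).
    by apply: measurable_funM; [exact: measurable_coord|exact: measurable_cst].
  by apply => //; exact: measurable_itv.
apply/seteqP; split=> x /= H i => [_|]; rewrite /= ?in_itv/=.
  by rewrite -H -[1]/(1%:~R) -intrD floor_itv.
apply: floor_def; have := H i I; rewrite /= in_itv/=.
by rewrite intrD.
Qed.

(** f is the pointwise limit of its compositions with rounding down to the grid of mesh 2^-k; these
    are constant on countably many measurable cells. *)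
Lemma continuous_measurable_rV n (f : 'rV[R]_n -> R) :
  continuous f -> measurable_fun setT f.
Proof.
move=> cf; pose fl k (x : 'rV[R]_n) : 'rV[int]_n := \row_i Num.floor (x 0 i * 2 ^+ k).
pose un k (z : 'rV[int]_n) : 'rV[R]_n := \row_i ((z 0 i)%:~R / 2 ^+ k).
apply: (@measurable_fun_cvg _ _ _ _ (fun k x => f (un k (fl k x)))) => [k|x _].
  move=> _ Y mY; rewrite setTI.
  rewrite (_ : _ @^-1` Y = \bigcup_(z in [set z | Y (f (un k z))])
      [set x : 'rV[R]_n | forall i, Num.floor (x 0 i * 2 ^+ k) = z 0 i]).
    by apply: countable_bigcup_measurable => z _; exact: floor_coord_measurable.
  apply/seteqP; split=> x /=; first by move=> Yx; exists (fl k x) => //= i; rewrite mxE.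
  move=> [z Yz H]; suff -> : fl k x = z by [].
  by apply/rowP => i; rewrite mxE.
apply: (@cvg_comp _ _ _ (fun k => un k (fl k x)) f \oo (nbhs x) (nbhs (f x))); last exact: cf.
have p2 k : 0 < 2 ^+ k :> R by rewrite exprn_gt0.
apply/cvg_ballP => e e0.
have H : (fun n => 2^-1 ^+ n : R) @ \oo --> (0 : R).
  by apply: cvg_expr; rewrite ger0_norm; lra.
have /cvgrPdist_lt/(_ _ e0) := H.
apply: filterS => k; rewrite sub0r normrN ger0_norm ?exprn_ge0// => ke; split=> // i j.
rewrite (ord1 i) /ball/= [un k _ 0 j]mxE [fl k x 0 j]mxE (le_lt_trans _ ke)//.
have -> : x 0 j - (Num.floor (x 0 j * 2 ^+ k))%:~R / 2 ^+ k =
    (x 0 j * 2 ^+ k - (Num.floor (x 0 j * 2 ^+ k))%:~R) * (2 ^+ k)^-1.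
  by rewrite mulrBl mulfK// gt_eqF.
rewrite normrM [X in _ * X]ger0_norm ?invr_ge0 ?(ltW (p2 k))//.
rewrite exprVn ler_piMl ?invr_ge0 ?(ltW (p2 k))//.
by have := floor_itv (x 0 j * 2 ^+ k); rewrite intrD ler_norml; lra.
Qed.

End continuous_measurable.

(** * From Markov chains to algorithms *)

Section first_hit.
Variable R : realType.
Implicit Type S : nat -> bool.

Definition first_hit S : \bar R := ereal_inf [set t%:R%:E | t in [set t | S t]].

Lemma first_hit_min S t : S t -> (forall s, (s < t)%N -> ~~ S s) ->
  first_hit S = t%:R%:E.
Proof.
move=> St Smin; apply/eqP; rewrite eq_le; apply/andP; split.
  by apply: ereal_inf_lbound; exists t.
apply: le_ereal_inf_tmp => _ [s Ss <-]; rewrite lee_fin ler_nat leqNgt.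
by apply/negP => /Smin; rewrite Ss.
Qed.

Lemma first_hit_none S : (forall s, ~~ S s) -> first_hit S = +oo%E.
Proof.
move=> nS; rewrite /first_hit (_ : [set _ | _ in _] = set0) ?ereal_inf0//.
by apply/seteqP; split=> // x [t /= St]; move: (nS t); rewrite St.
Qed.

Variant first_hit_spec S : \bar R -> Prop :=
| FirstHit t of S t & (forall s, (s < t)%N -> ~~ S s) : first_hit_spec S t%:R%:E
| NoHit of (forall s, ~~ S s) : first_hit_spec S +oo%E.

Lemma first_hitP S : first_hit_spec S (first_hit S).
Proof.
have [h|h] := pselect (exists t, S t).
  case: (ex_minnP h) => t St tmin.
  have H s : (s < t)%N -> ~~ S s.
    by move=> st; apply/negP => /tmin; rewrite leqNgt st.
  by rewrite (first_hit_min St H); exact: FirstHit.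
have H s : ~~ S s by apply/negP => Ss; apply: h; exists s.
by rewrite first_hit_none//; exact: NoHit.
Qed.

Lemma first_hit_le S t : (first_hit S <= t%:R%:E)%E <-> exists2 s, (s <= t)%N & S s.
Proof.
case: first_hitP => [k Sk kmin|nS]; last first.
  by split=> // -[s _ Ss]; move: (nS s); rewrite Ss.
rewrite lee_fin ler_nat; split=> [kt|[s st Ss]]; first by exists k.
by apply: leq_trans st; rewrite leqNgt; apply/negP => /kmin; rewrite Ss.
Qed.

Lemma measurable_first_hit d (T : measurableType d) (S : nat -> T -> bool) :
  (forall n, measurable_fun setT (S n)) ->
  measurable_fun setT (fun x => first_hit (S ^~ x)).
Proof.
move=> mS; pose u n x : \bar R := if S n x then n%:R%:E else +oo%E.
rewrite (_ : (fun x => _) = (fun x => einfs (u ^~ x) 0)).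
  apply: measurable_fun_einfs => n; rewrite /u.
  by apply: measurable_fun_ifT => //; exact: measurable_cst.
apply/funext => x; rewrite /einfs /first_hit; apply/eqP; rewrite eq_le; apply/andP; split.
  apply: le_ereal_inf_tmp => _ [n _ <-]; rewrite /u; case: ifPn => [Sn|_]; last exact: leey.
  by apply: ereal_inf_lbound; exists n.
apply: le_ereal_inf_tmp => _ [n Sn <-]; apply: ereal_inf_lbound; exists n => //.
by rewrite /u Sn.
Qed.

End first_hit.

(** * Measurability of executions *)

Section run_measurability.
Variables (R : realType) (d : nat) (A : algorithm R d) (f : 'rV[R]_d -> R).
Variable r : exact_run A f.

Lemma nth_history (u : seed A) (g : nat -> 'rV[R]_d) x0 t i : (i < t)%N ->
  nth x0 (history u g t) i = (query_rule A i (u, history u g i), g i).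
Proof.
elim: t => // t IH; rewrite ltnS /= nth_rcons size_tuple => it.
by case: ltngtP it => // [it _|-> _]; [exact: IH|].
Qed.

Lemma measurable_run_history t : measurable_fun setT (@run_history _ _ _ _ r t).
Proof.
elim/ltn_ind: t => t IH.
apply/measurable_fun_tnthP => i.
rewrite (_ : _ \o _ = fun w => (query_rule A i (run_seed r w, run_history i w), reply r i w)).
  apply/measurable_fun_pair; last exact: measurable_funPT.
  apply: measurableT_comp => //; apply/measurable_fun_pair; first exact: measurable_funPT.
  exact: IH.
apply/funext => w /=; rewrite (tnth_nth (0, 0)).
exact: nth_history.
Qed.

Lemma measurable_run_input t :
  measurable_fun setT (fun w => (run_seed r w, run_history t w)).
Proof.
apply/measurable_fun_pair; [exact: measurable_funPT|exact: measurable_run_history].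
Qed.

Lemma measurable_query_count : measurable_fun setT (@query_count _ _ _ _ r).
Proof.
apply: measurable_first_hit => t.
by apply: measurableT_comp => //; exact: measurable_run_input.
Qed.

Lemma query_count_le t (w : run_space r) :
  (query_count w <= t%:R%:E)%E <-> exists2 s, (s <= t)%N & stops s w.
Proof. exact: first_hit_le. Qed.

Definition returns_in (B : set 'rV[R]_d) : set (run_space r) :=
  [set w | exists2 y, returns w y & B y].

Lemma measurable_returns_in B : measurable B -> measurable (returns_in B).
Proof.
move=> mB; rewrite (_ : returns_in B = \bigcup_t
   ((@query_count _ _ _ _ r @^-1` [set t%:R%:E]) `&`
    ((fun w => output_rule A t (run_seed r w, run_history t w)) @^-1` B))).
  apply: bigcup_measurable => t _; apply: measurableI; rewrite -[X in measurable X]setTI.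
    by apply: measurable_query_count => //; exact: emeasurable_set1.
  have : measurable_fun setT (fun w => output_rule A t (run_seed r w, run_history t w)).
    by apply: measurableT_comp => //; exact: measurable_run_input.
  exact.
apply/seteqP; split=> w.
  by move=> [y [t Tt ->] By]; exists t.
by move=> [t _ [Tt Bt]]; exists (output_rule A t (run_seed r w, run_history t w)) => //; exists t.
Qed.

Lemma returns_in_setC B w : (query_count w < +oo)%E -> ~ returns_in B w ->
  returns_in (~` B) w.
Proof.
move=> wT nB; have : exists t : nat, query_count w = t%:R%:E.
  move: wT; rewrite (_ : query_count w = first_hit R (fun t => stops t w))//.
  by case: first_hitP => [t _ _|_]; [exists t|rewrite ltxx].
move=> [t Tt]; exists (output_rule A t (run_seed r w, run_history t w)); first by exists t.
by move=> Bt; apply: nB; exists (output_rule A t (run_seed r w, run_history t w)) => //; exists t.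
Qed.

Lemma exact_replies_ae : {ae run_prob r, forall w, forall t,
  reply r t w = grad f (query t w)}.
Proof. by apply: ae_foralln => t; exact: reply_exact. Qed.

End run_measurability.

(** * Markov chains driven by a sequence of tosses *)

Section chain.
Variables (R : realType) (dZ : measure_display) (Z : measurableType dZ).
Variable step : Z * coin -> Z.
Hypothesis mstep : measurable_fun setT step.

(** Unrolled at the first step, as the one-step equations require; [chainS] unrolls it at the last
    step, the order in which an algorithm replays it. *)
Fixpoint chain (n : nat) (z : Z) (o : coin) : Z :=
  match n with
  | 0 => z
  | m.+1 => chain m (step (z, (unzip o).1)) (unzip o).2
  end.

Definition draw (n : nat) (o : coin) : coin :=
  (unzip (iter n (fun o => (unzip o).2) o)).1.

Lemma chainS n z o : chain n.+1 z o = step (chain n z o, draw n o).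
Proof.
elim: n z o => // n IH z o.
by rewrite -[LHS]/(chain n.+1 (step (z, (unzip o).1)) (unzip o).2) IH /draw iterSr.
Qed.

Lemma measurable_chain n : measurable_fun setT (fun p : Z * coin => chain n p.1 p.2).
Proof.
elim: n => [|n IH] /=; first exact: measurable_fst.
have mhd : measurable_fun setT (fun p : Z * coin => (unzip p.2).1).
  by apply: (measurableT_comp measurable_unzip1); exact: measurable_snd.
have mtl : measurable_fun setT (fun p : Z * coin => (unzip p.2).2).
  by apply: (measurableT_comp measurable_unzip2); exact: measurable_snd.
apply: (measurableT_comp IH (g := fun p : Z * coin =>
  (step (p.1, (unzip p.2).1), (unzip p.2).2))).
apply/measurable_fun_pair => //; apply: (measurableT_comp mstep).
by apply/measurable_fun_pair => //; exact: measurable_fst.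
Qed.

Lemma measurable_chain_from n z : measurable_fun setT (chain n z).
Proof.
by apply: (measurableT_comp (measurable_chain n) (g := pair z)); exact: pair1_measurable.
Qed.

Definition expect (g : Z -> \bar R) (n : nat) (z : Z) : \bar R :=
  (\int[coinP R]_o g (chain n z o))%E.

Section expect.
Variable g : Z -> \bar R.
Hypothesis mg : measurable_fun setT g.
Hypothesis g0 : forall z, (0 <= g z)%E.

Lemma measurable_expect n : measurable_fun setT (expect g n).
Proof.
apply: (@measurable_fun_fubini_tonelli_F _ _ _ _ _ (coinP R) (fun p => g (chain n p.1 p.2))) => //.
by apply: (measurableT_comp mg); exact: measurable_chain.
Qed.

Lemma expect_ge0 n z : (0 <= expect g n z)%E.
Proof. exact: integral_ge0. Qed.

Lemma expect0 z : expect g 0 z = g z.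
Proof.
rewrite /expect /=; transitivity (g z * coinP R setT)%E; first exact: integral_cst.
by rewrite probability_setT mule1.
Qed.

(** The Markov property: the two halves of [unzip], used for the first step and for the remaining
    ones, are independent. *)
Lemma expectS n z : expect g n.+1 z = (\int[coinP R]_a expect g n (step (z, a)))%E.
Proof.
rewrite /expect /=.
apply: (integral_unzip (phi := fun p => g (chain n (step (z, p.1)) p.2))) => //.
apply: (measurableT_comp mg); apply: (measurableT_comp (measurable_chain n)
  (g := fun p : coin * coin => (step (z, p.1), p.2))).
apply/measurable_fun_pair; last exact: measurable_snd.
by apply: (measurableT_comp mstep); apply/measurable_fun_pair; [exact: measurable_cst|exact: measurable_fst].
Qed.

Lemma measurable_expect_step n z : measurable_fun setT (fun a => expect g n (step (z, a))).
Proof.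
apply: (measurableT_comp (measurable_expect n)); apply: (measurableT_comp mstep).
exact: pair1_measurable.
Qed.

End expect.

Variable inv : set Z.
Hypothesis inv_step : forall z a, inv z -> inv (step (z, a)).

Lemma expect_le_supersolution (g H : Z -> \bar R) :
  measurable_fun setT g -> (forall z, 0 <= g z)%E ->
  (forall z, inv z -> measurable_fun setT (fun a => H (step (z, a)))) ->
  (forall z, inv z -> g z <= H z)%E ->
  (forall z, inv z -> \int[coinP R]_a H (step (z, a)) <= H z)%E ->
  forall n z, inv z -> (expect g n z <= H z)%E.
Proof.
move=> mg g0 mH gH superH; elim=> [|n IH] z iz; first by rewrite expect0//; exact: gH.
rewrite expectS//; apply: le_trans (superH _ iz).
apply: ge0_le_integral => //.
- by move=> a _; exact: expect_ge0.
- exact: measurable_expect_step.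
- exact: mH.
- by move=> a _; apply: IH; exact: inv_step.
Qed.

(** A Foster-Lyapunov bound: the n-th summand is the probability of still running at time n, so the
    sum is a truncated mean running time, and the bound does not depend on the truncation m. *)
Lemma sum_expect_le_supersolution (done : Z -> bool) (V : Z -> \bar R) :
  measurable_fun setT done ->
  (forall z a, done z -> done (step (z, a))) ->
  (forall z, inv z -> 0 <= V z)%E ->
  (forall z, inv z -> measurable_fun setT (fun a => V (step (z, a)))) ->
  (forall z, inv z -> ~~ done z -> 1 + \int[coinP R]_a V (step (z, a)) <= V z)%E ->
  forall m z, inv z ->
  (\sum_(n < m) expect (fun z => (~~ done z)%:R%:E) n z <= V z)%E.
Proof.
move=> mdone dstep V0 mV superV; set g := fun z => _.
have mg : measurable_fun setT g.
  apply: (@measurableT_comp _ _ _ _ _ _ (fun b : bool => (~~ b)%:R%:E : \bar R)) => //.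
have g0 z : (0 <= g z)%E by rewrite lee_fin.
have dn n z o : done z -> done (chain n z o).
  by elim: n z o => // n IH z o dz /=; apply: IH; exact: dstep.
elim=> [|m IH] z iz; first by rewrite big_ord0; exact: V0.
have [dz|ndz] := boolP (done z).
  rewrite big1 ?V0// => n _; apply: integral0_eq => o _.
  by rewrite /g dn.
rewrite big_ord_recl expect0// {1}/g ndz; apply: le_trans (superV _ iz ndz).
apply: leeD2l => //; under eq_bigr do rewrite lift0 expectS//.
rewrite -ge0_integral_sum//; last 2 first.
- by move=> n; exact: measurable_expect_step.
- by move=> n a _; exact: expect_ge0.
apply: ge0_le_integral => //.
- by move=> a _; apply: sume_ge0 => n _; exact: expect_ge0.
- by apply: emeasurable_sum => n; exact: measurable_expect_step.
- exact: mV.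
- by move=> a _; apply: IH; exact: inv_step.
Qed.

End chain.

(** * Running a Markov chain as a query algorithm *)

Section machine.
Variables (R : realType) (d : nat) (dZ : measure_display) (Z : measurableType dZ).
Variables (z0 : Z) (ask : Z -> 'rV[R]_d) (next : (Z * 'rV[R]_d) * coin -> Z).
Variables (done : Z -> bool) (out : Z -> 'rV[R]_d).
Hypothesis mask : measurable_fun setT ask.
Hypothesis mnext : measurable_fun setT next.
Hypothesis mdone : measurable_fun setT done.
Hypothesis mout : measurable_fun setT out.

(** Step m consumes reply 2m; the replies of odd index answer announcements and are discarded. *)
Fixpoint replay (o : coin) (g : nat -> 'rV[R]_d) (n : nat) : Z :=
  match n with
  | 0 => z0
  | m.+1 => next ((replay o g m, g m.*2), draw m o)
  end.

Definition input t := (coin * t.-tuple ('rV[R]_d * 'rV[R]_d))%type.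

Definition entry t (p : input t) (i : nat) : 'rV[R]_d * 'rV[R]_d := nth (0, 0) p.2 i.

Definition state t (n : nat) (p : input t) : Z := replay p.1 (fun i => (entry p i).2) n.

(* Whether the machine has halted is decided by private randomness, while the
   number of queries has to be a stopping time of the transcript: every other
   query is spent on announcing the halt, by a nonzero query point. *)
Definition announce (b : bool) : 'rV[R]_d := if b then const_mx 1 else 0.

(** At t = 2m + 1 reply 2m is already known, so the announcement concerns the state after m + 1
    steps. *)
Definition ask_rule t (p : input t) : 'rV[R]_d :=
  if odd t then announce (done (state (uphalf t) p)) else ask (state t./2 p).

(** Reads the last query and nothing of the seed: this is what places the halting events in the
    physical filtration. *)
Definition halt_rule t (p : input t) : bool :=
  [&& ~~ odd t, (0 < t)%N & (entry p t.-1).1 != 0].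

Definition result_rule t (p : input t) : 'rV[R]_d := out (state t./2 p).

Lemma measurable_draw n : measurable_fun setT (draw n).
Proof.
apply: (measurableT_comp measurable_unzip1).
elim: n => [|n IH]; first exact: measurable_id.
exact: (measurableT_comp measurable_unzip2 IH).
Qed.

Lemma measurable_entry t i : measurable_fun setT (fun p : input t => entry p i).
Proof.
have [it|ti] := ltnP i t; last first.
  rewrite (_ : (fun p => _) = cst (0, 0)); first exact: measurable_cst.
  by apply/funext => p; rewrite /entry nth_default// size_tuple.
rewrite (_ : (fun p => _) = (fun p : input t => tnth p.2 (Ordinal it))).
  by apply: (measurableT_comp (measurable_tnth _)); exact: measurable_snd.
by apply/funext => p; rewrite (tnth_nth (0, 0)).
Qed.

Lemma measurable_state t n : measurable_fun setT (@state t n).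
Proof.
elim: n => [|n IH] /=; first exact: measurable_cst.
apply: (measurableT_comp mnext (g := fun p : input t => ((state n p, (entry p n.*2).2), draw n p.1))).
apply/measurable_fun_pair; first apply/measurable_fun_pair => //.
  by apply: (measurableT_comp measurable_snd); exact: measurable_entry.
by apply: (measurableT_comp (measurable_draw n)); exact: measurable_fst.
Qed.

Lemma measurable_ask_rule t : measurable_fun setT (@ask_rule t).
Proof.
rewrite /ask_rule; case: (odd t); last first.
  exact: (measurableT_comp mask (@measurable_state t t./2)).
apply: (@measurableT_comp _ _ _ _ _ _ announce) => //.
exact: (measurableT_comp mdone (@measurable_state t (uphalf t))).
Qed.

Lemma measurable_neq0 : measurable_fun setT (fun x : 'rV[R]_d => x != 0).
Proof.
apply: (measurable_fun_bool true) => //; rewrite setTI.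
rewrite (_ : _ @^-1` _ = \bigcup_(i in [set: 'I_d]) ((fun x : 'rV[R]_d => x 0 i) @^-1` [set~ 0])).
  apply: countable_bigcup_measurable => i _; rewrite -[X in measurable X]setTI.
  by apply: measurable_coord => //; exact: measurableC.
apply/seteqP; split=> x /=.
  move=> x0; apply: contrapT => H; move/negP: x0; apply; apply/eqP/rowP => i.
  by rewrite mxE; apply: contrapT => xi; apply: H; exists i.
by move=> [i _ /= xi]; apply/negP => /eqP xE; apply: xi; rewrite xE mxE.
Qed.

Lemma measurable_halt_rule t : measurable_fun setT (@halt_rule t).
Proof.
rewrite /halt_rule; case: (~~ odd t && (0 < t)%N) (andbA (~~ odd t) (0 < t)%N) => E.
  rewrite (_ : (fun _ => _) = (fun p : input t => (entry p t.-1).1 != 0)).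
    apply: (measurableT_comp measurable_neq0).
    by apply: (measurableT_comp measurable_fst); exact: measurable_entry.
  by apply/funext => p; rewrite E.
rewrite (_ : (fun _ => _) = cst false); first exact: measurable_cst.
by apply/funext => p; rewrite E.
Qed.

Lemma measurable_result_rule t : measurable_fun setT (@result_rule t).
Proof. exact: (measurableT_comp mout (@measurable_state t t./2)). Qed.

Definition machine : algorithm R d := @Algorithm R d _ coin (coinP R)
  (fun t => HB.pack (@ask_rule t) (isMeasurableFun.Build _ _ _ _ _ (@measurable_ask_rule t)))
  (fun t => HB.pack (@halt_rule t) (isMeasurableFun.Build _ _ _ _ _ (@measurable_halt_rule t)))
  (fun t => HB.pack (@result_rule t) (isMeasurableFun.Build _ _ _ _ _ (@measurable_result_rule t))).

Section execution.
Variables (f : 'rV[R]_d -> R) (r : exact_run machine f).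
Hypothesis mgrad : measurable_fun setT (grad f).
Hypothesis d0 : (0 < d)%N.
Hypothesis z0_running : ~~ done z0.

Definition transition (p : Z * coin) : Z := next ((p.1, grad f (ask p.1)), p.2).

Lemma measurable_transition : measurable_fun setT transition.
Proof.
apply: (measurableT_comp mnext (g := fun p : Z * coin => ((p.1, grad f (ask p.1)), p.2))).
apply/measurable_fun_pair; last exact: measurable_snd.
apply/measurable_fun_pair; first exact: measurable_fst.
by apply: (measurableT_comp mgrad); apply: (measurableT_comp mask); exact: measurable_fst.
Qed.

Let Zn n (w : run_space r) : Z := chain transition n z0 (run_seed r w).

Lemma announce_neq0 b : (announce b != 0) = b.
Proof.
case: b; last by rewrite /announce eqxx.
by apply/negP => /eqP/rowP/(_ (Ordinal d0)); rewrite !mxE => /eqP; rewrite oner_eq0.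
Qed.

(** The first n steps use the replies 0, 2, ..., 2n - 2, the last of which belongs to a history of
    length t as soon as 2n - 2 < t. *)
Lemma state_history w t n : (n.*2 <= t.+1)%N ->
  state n (run_seed r w, run_history t w) =
  replay (run_seed r w) (fun i => reply r i w) n.
Proof.
rewrite /state /=; elim: n => // n IH nt /=; rewrite IH; last first.
  by apply: leq_trans nt; rewrite doubleS; exact: leqW (leqnSn _).
by rewrite /entry nth_history.
Qed.

Lemma replay_chain w : (forall t, reply r t w = grad f (query t w)) ->
  forall n, replay (run_seed r w) (fun i => reply r i w) n = Zn n w.
Proof.
move=> gw; elim=> // n IH; rewrite /Zn chainS -/(Zn n w) /= IH /transition/=.
rewrite gw /query /= /ask_rule odd_double doubleK.
by rewrite state_history ?IH// ltnW.
Qed.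

Lemma stopsE w t : (forall t, reply r t w = grad f (query t w)) ->
  stops t w = [&& ~~ odd t, (0 < t)%N & done (Zn t./2 w)].
Proof.
move=> gw; rewrite /stops /= /halt_rule; case: (boolP (odd t)) => //= te.
case: t te => // t; rewrite /= negbK => te.
rewrite /entry nth_history//= /ask_rule te announce_neq0.
rewrite -[uphalf t]/(t.+1)./2.
rewrite state_history ?replay_chain//.
by rewrite -[X in (_ <= X)%N]odd_double_half /= te add0n.
Qed.

(** The machine stops at twice the index of the first halted state, and each earlier state
    contributes 2 to the series. *)
Lemma query_count_bound w : (forall t, reply r t w = grad f (query t w)) ->
  (query_count w <= \sum_(n <oo) (2 * (~~ done (Zn n w))%:R)%:E)%E.
Proof.
move=> gw; rewrite (_ : query_count w = first_hit R (fun t => stops t w))//.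
have p0 n : (0%R <= (2 * (~~ done (Zn n w))%:R)%:E :> \bar R)%E by rewrite lee_fin mulr_ge0.
case: first_hitP => [t|] .
  rewrite stopsE// => /and3P[te t0 dt] tmin.
  have H n : (n < t./2)%N -> ~~ done (Zn n w).
    case: n => [|n] nt; first exact: z0_running.
    have := tmin n.+1.*2; rewrite stopsE// odd_double/= doubleK; apply.
    by rewrite -[X in (_ < X)%N]odd_double_half (negbTE te) add0n ltn_double.
  apply: le_trans (nneseries_lim_ge t./2 _) => //.
  rewrite big_mkord (eq_bigr (fun=> (2 : R)%:E)) => [|i _]; last by rewrite H ?mulr1.
  rewrite sumEFin lee_fin sumr_const card_ord.
  have -> : 2 *+ t./2 = (t./2.*2)%:R :> R by rewrite -mul2n natrM mulr_natr.
  by rewrite ler_nat -[X in (X <= _)%N]odd_double_half (negbTE te).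
move=> ns; have H n : ~~ done (Zn n w).
  case: n => [|n]; first exact: z0_running.
  by have := ns n.+1.*2; rewrite stopsE// odd_double/= doubleK.
rewrite leye_eq; apply/eqP/eqyP => A A0.
apply: le_trans (nneseries_lim_ge (Num.bound A) _) => //.
rewrite big_mkord (eq_bigr (fun=> (2 : R)%:E)) => [|i _]; last by rewrite H ?mulr1.
rewrite sumEFin lee_fin sumr_const card_ord.
have -> : 2 *+ Num.bound A = 2 * (Num.bound A)%:R :> R by rewrite mulr_natr.
by have := archi_boundP (ltW A0); have := ler0n R (Num.bound A); lra.
Qed.

Lemma returns_chain w B : (forall t, reply r t w = grad f (query t w)) ->
  returns_in (r := r) B w -> exists n, done (Zn n w) /\ B (out (Zn n w)).
Proof.
move=> gw [y [t Tt ->] By]; exists t./2.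
have : stops t w.
  move: Tt; rewrite (_ : query_count w = first_hit R (fun t => stops t w))//.
  by case: first_hitP => [k Sk _ [/eqP]|//]; rewrite eqr_nat => /eqP <-.
rewrite stopsE// => /and3P[te t0 ->]; split=> //.
move: By; rewrite /= /result_rule state_history ?replay_chain//.
by rewrite -[X in (_ <= X.+1)%N]odd_double_half (negbTE te) add0n.
Qed.

(** Having stopped by time t means that one of the announcements before t was nonzero. This holds
    for every outcome, with no exceptional null set. *)
Lemma machine_stopping_time : is_stopping_time (query_count (r := r)).
Proof.
move=> t; rewrite /physical_filtration (_ : [set w | _] = \bigcup_s
    (if (s <= t)%N && ~~ odd s && (0 < s)%N then [set w | query (r := r) s.-1 w != 0] else set0)).
  apply: sigma_algebra_bigcup => s; case: ifPn => [/andP[/andP[st _] s0]|_]; last exact: sigma_algebra0.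
  have st' : (s.-1 < t)%N by rewrite prednK.
  apply: sub_sigma_algebra; rewrite -bigcup_seq; exists (Ordinal st'); first by rewrite /= mem_index_enum.
  exists [set p : 'rV[R]_d * 'rV[R]_d | p.1 != 0].
    have := measurableT_comp measurable_neq0 (@measurable_fst _ _ 'rV[R]_d 'rV[R]_d).
    by move=> /(_ measurableT [set true]); rewrite setTI; apply.
  by rewrite setTI.
have E s w : stops (r := r) s w = [&& ~~ odd s, (0 < s)%N & query (r := r) s.-1 w != 0].
  by case: s => // s; rewrite /stops /= /halt_rule /= /entry nth_history.
apply/seteqP; split=> w /=.
  move=> /query_count_le[s st]; rewrite E => /and3P[so s0 sq].
  by exists s => //; rewrite st so s0.
move=> [s _]; case: ifPn => // /andP[/andP[st so] s0] sq.
by apply/query_count_le; exists s => //; rewrite E so s0.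
Qed.

Lemma chain_pushforward (B : set Z) n : measurable B ->
  run_prob r (Zn n @^-1` B) = coinP R [set o | B (chain transition n z0 o)].
Proof.
move=> mB; have mC : measurable [set o | B (chain transition n z0 o)].
  by rewrite -[X in measurable X]setTI; exact: (measurable_chain_from measurable_transition).
exact: (run_seed_law r mC).
Qed.

Section verification.
Variables (inv : set Z) (V : Z -> \bar R) (H : set 'rV[R]_d -> Z -> \bar R).
Hypothesis inv0 : inv z0.
Hypothesis inv_step : forall z a, inv z -> inv (transition (z, a)).
Hypothesis done_stuck : forall z g a, done z -> next ((z, g), a) = z.
Hypothesis V_ge0 : forall z, inv z -> (0 <= V z)%E.
Hypothesis mV : forall z, inv z -> measurable_fun setT (fun a => V (transition (z, a))).
Hypothesis superV : forall z, inv z -> ~~ done z ->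
  (1 + \int[coinP R]_a V (transition (z, a)) <= V z)%E.
Hypothesis V_fin : (V z0 < +oo)%E.
Hypothesis H_ge0 : forall B z, inv z -> (0 <= H B z)%E.
Hypothesis mH : forall B z, measurable B -> inv z ->
  measurable_fun setT (fun a => H B (transition (z, a))).
Hypothesis H_done : forall B z, inv z -> done z -> B (out z) -> (1 <= H B z)%E.
Hypothesis superH : forall B z, measurable B -> inv z ->
  (\int[coinP R]_a H B (transition (z, a)) <= H B z)%E.
Hypothesis H_total : forall B, measurable B -> (H B z0 + H (~` B) z0 = 1)%E.

(* The factor 2 accounts for the announcements. *)
Lemma machine_expected_count : (expected_query_count r <= 2%:E * V z0)%E.
Proof.
pose g z : \bar R := (~~ done z)%:R%:E.
have mtr := measurable_transition.
have mg : measurable_fun setT g.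
  exact: (@measurableT_comp _ _ _ _ _ _ (fun b : bool => (~~ b)%:R%:E : \bar R)).
have mseed : measurable_fun setT (run_seed r) by exact: measurable_funPT.
have mZ n : measurable_fun setT (Zn n).
  apply: (measurableT_comp (measurable_chain mtr n) (g := fun w => (z0, run_seed r w : coin))).
  by apply/measurable_fun_pair => //; exact: measurable_cst.
have mgZ n : measurable_fun setT (fun w => g (Zn n w)) by exact: (measurableT_comp mg).
apply: (@le_trans _ _ (\int[run_prob r]_w (\sum_(n <oo) (2%:E * g (Zn n w))))%E).
  apply: ae_ge0_le_integral => //.
  - move=> w _; rewrite (_ : query_count w = first_hit R (fun t => stops t w))//.
    by case: first_hitP.
  - exact: measurable_query_count.
  - by move=> w _; apply: nneseries_ge0 => n _ _; rewrite mule_ge0// lee_fin.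
  - apply: ge0_emeasurable_sum => [n w _ _|n _]; first by rewrite mule_ge0// lee_fin.
    exact: measurable_funeM.
  - apply: filterS (exact_replies_ae r) => w gw _.
    by apply: le_trans (query_count_bound gw) _; apply: lee_nneseries.
rewrite integral_nneseries//; last 2 first.
- by move=> n; exact: measurable_funeM.
- by move=> n w _; rewrite mule_ge0// lee_fin.
have gE n : (\int[run_prob r]_w (2%:E * g (Zn n w)) = 2%:E * expect transition g n z0)%E.
  transitivity (2%:E * \int[run_prob r]_w g (Zn n w))%E.
    by apply: ge0_integralZl => // w _; rewrite lee_fin.
  congr (_ * _)%E.
  rewrite /expect; have mgc : measurable_fun setT (fun o => g (chain transition n z0 o)).
    exact: (measurableT_comp mg (measurable_chain_from mtr n z0)).
  transitivity (\int[pushforward (run_prob r) (run_seed r)]_o g (chain transition n z0 o))%E.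
    apply/esym; apply: etrans (ge0_integral_pushforward mseed (run_prob r) measurableT mgc _) _ => //.
    by move=> o _; rewrite lee_fin.
  apply: eq_measure_integral => // A mA _; exact: run_seed_law.
under eq_eseriesr do rewrite gE.
have e0 n : (0 <= expect transition g n z0)%E.
  by apply: integral_ge0 => o _; rewrite lee_fin.
rewrite nneseriesZl; last by move=> n _; exact: e0.
apply: lee_wpmul2l => //; apply: lime_le.
  by apply: is_cvg_nneseries => n _ _; exact: e0.
near=> m; rewrite big_mkord; apply: (sum_expect_le_supersolution mtr inv_step) => //.
by move=> z a dz; rewrite /transition done_stuck.
Unshelve. all: by end_near.
Qed.

Lemma machine_terminates : terminates_as r.
Proof.
have : (run_prob r).-integrable setT (@query_count _ _ _ _ r).
  apply/integrableP; split; first exact: measurable_query_count.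
  apply: le_lt_trans (_ : 2%:E * V z0 < +oo)%E; last by rewrite lte_mul_pinfty.
  apply: le_trans machine_expected_count; rewrite le_eqVlt; apply/orP; left; apply/eqP.
  apply: eq_integral => w _; apply: gee0_abs.
  rewrite (_ : query_count w = first_hit R (fun t => stops t w))//.
  by case: first_hitP.
move=> /(integrable_ae measurableT); apply: filterS => w /(_ I).
by move=> /fin_numPlt/andP[].
Qed.

(** Up to a null set, an output in B means that the chain halts in B at some step. As halted states
    are frozen these events increase with the step, and the supersolution bounds each of them. *)
Lemma output_law_le B : measurable B -> (output_law r B <= H B z0)%E.
Proof.
move=> mB; have mtr := measurable_transition.
pose D : set Z := [set z | done z /\ B (out z)].
have mD : measurable D.
  rewrite (_ : D = (done @^-1` [set true]) `&` (out @^-1` B)).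
    by apply: measurableI; rewrite -[X in measurable X]setTI; [exact: mdone|exact: mout].
  by apply/seteqP; split=> z /=.
have mseed : measurable_fun setT (run_seed r) by exact: measurable_funPT.
have mZ n : measurable_fun setT (Zn n).
  apply: (measurableT_comp (measurable_chain mtr n) (g := fun w => (z0, run_seed r w : coin))).
  by apply/measurable_fun_pair => //; exact: measurable_cst.
have mZD n : measurable (Zn n @^-1` D) by rewrite -[X in measurable X]setTI; exact: mZ.
have mU : measurable (\bigcup_n (Zn n @^-1` D)) by exact: bigcup_measurable.
apply: (@le_trans _ _ (run_prob r (\bigcup_n (Zn n @^-1` D)))).
  have [N [mN N0 subN]] := exact_replies_ae r.
  apply: (@le_trans _ _ (run_prob r (\bigcup_n (Zn n @^-1` D) `|` N))).
    apply: le_measure; rewrite ?inE//; [exact: measurable_returns_in|exact: measurableU|].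
    move=> w Bw; have [Nw|nNw] := pselect (N w); [by right|left].
    have gw : forall t, reply r t w = grad f (query t w).
      by apply: contrapT => h; apply: nNw; exact: subN.
    by have [n [dn Bn]] := returns_chain gw Bw; exists n.
  by apply: le_trans (measureU2 _ _ _) _ => //; rewrite [X in (_ + X)%E]N0 adde0.
have ndD : nondecreasing_seq (fun n => Zn n @^-1` D).
  apply/nondecreasing_seqP => n; apply/subsetPset => w [dw Bw].
  by rewrite /D/= /Zn chainS -/(Zn n w) /transition done_stuck.
have cv := nondecreasing_cvg_mu (mu := run_prob r) mZD mU ndD.
rewrite -(cvg_lim _ cv)//; apply: lime_le; first by apply/cvg_ex; eexists; exact: cv.
near=> n; rewrite /= chain_pushforward//.
pose g z : \bar R := (\1_D z)%:E.
have mg : measurable_fun setT g by apply/measurable_EFinP; exact: measurable_indic.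
apply: le_trans (expect_le_supersolution mtr inv_step mg _ _ _ _ n inv0) => //.
- rewrite /expect /g le_eqVlt; apply/orP; left; apply/eqP; apply/esym.
  transitivity (\int[coinP R]_o (\1_[set o | D (chain transition n z0 o)] o)%:E)%E.
    by apply: eq_integral => o _; rewrite !indicE; congr (_%:R%:E).
  rewrite integral_indic ?setIT//; rewrite -[X in measurable X]setTI.
  exact: (measurable_chain_from mtr).
- by move=> z; rewrite lee_fin.
- by move=> z iz; exact: mH.
- move=> z iz; rewrite /g indicE; case: (boolP (z \in D)) => [/set_mem[dz Bz]|_].
    exact: H_done.
  exact: H_ge0.
- by move=> z iz; exact: superH.
Unshelve. all: by end_near.
Qed.

(** Almost sure termination gives the laws of B and of its complement a sum of at least one, while
    their upper bounds sum to exactly one; so neither bound can be strict. *)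
Lemma machine_output_law B : measurable B -> output_law r B = H B z0.
Proof.
move=> mB; apply/eqP; rewrite eq_le output_law_le//=.
have mBC : measurable (~` B) by exact: measurableC.
have H1 : (1 <= output_law r B + output_law r (~` B))%E.
  have [N [mN N0 subN]] := machine_terminates.
  have mR C : measurable C -> measurable (returns_in (r := r) C) by exact: measurable_returns_in.
  rewrite -(probability_setT (run_prob r)).
  apply: (@le_trans _ _ (run_prob r ((returns_in (r := r) B `|` returns_in (r := r) (~` B)) `|` N))).
    apply: le_measure; rewrite ?inE//; first by apply: measurableU => //; apply: measurableU; exact: mR.
    move=> w _; have [Nw|nNw] := pselect (N w); [by right|left].
    have Tw : (query_count w < +oo)%E by apply: contrapT => h; apply: nNw; exact: subN.
    by have [Bw|nBw] := pselect (returns_in (r := r) B w); [left|right; exact: returns_in_setC].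
  apply: le_trans (measureU2 _ _ _) _ => //; first by apply: measurableU; exact: mR.
  by rewrite [X in (_ + X)%E]N0 adde0; apply: measureU2; exact: mR.
have HC := output_law_le mBC; have HT := H_total mB.
have Bf : H B z0 \is a fin_num.
  by have := H_ge0 B inv0; have := H_ge0 (~` B) inv0; move: HT; case: (H B z0) => //; case: (H (~` B) z0).
have Cf : H (~` B) z0 \is a fin_num.
  by have := H_ge0 B inv0; have := H_ge0 (~` B) inv0; move: HT; case: (H B z0) => //; case: (H (~` B) z0).
by have := le_trans H1 (leeD2l _ HC); rewrite -HT leeD2rE.
Qed.

End verification.

End execution.
End machine.

(** * Convexity and the ellipsoid method *)

Section euclidean.
Variables (R : realType) (d : nat).
Implicit Types (x y z : 'rV[R]_d) (a : R).

Lemma dotpC x y : dotp x y = dotp y x.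
Proof. by apply: eq_bigr => i _; rewrite mulrC. Qed.

Lemma dotpDl x y z : dotp (x + y) z = dotp x z + dotp y z.
Proof. by rewrite /dotp -big_split; apply: eq_bigr => i _; rewrite mxE mulrDl. Qed.

Lemma dotpZl a x y : dotp (a *: x) y = a * dotp x y.
Proof. by rewrite /dotp mulr_sumr; apply: eq_bigr => i _; rewrite mxE mulrA. Qed.

Lemma dotpNl x y : dotp (- x) y = - dotp x y.
Proof. by rewrite -scaleN1r dotpZl mulN1r. Qed.

Lemma dotpDr x y z : dotp x (y + z) = dotp x y + dotp x z.
Proof. by rewrite dotpC dotpDl dotpC [dotp z x]dotpC. Qed.

Lemma dotpZr a x y : dotp x (a *: y) = a * dotp x y.
Proof. by rewrite dotpC dotpZl dotpC. Qed.

Lemma dotpNr x y : dotp x (- y) = - dotp x y.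
Proof. by rewrite dotpC dotpNl dotpC. Qed.

Lemma dotp0l y : dotp 0 y = 0.
Proof. by rewrite /dotp big1// => i _; rewrite mxE mul0r. Qed.

Lemma dotp0r x : dotp x 0 = 0.
Proof. by rewrite dotpC dotp0l. Qed.

Lemma dotp_ge0 x : 0 <= dotp x x.
Proof. by apply: sumr_ge0 => i _; rewrite -expr2 sqr_ge0. Qed.

Lemma dotp_eq0 x : dotp x x = 0 -> x = 0.
Proof.
move=> /eqP; rewrite psumr_eq0; last by move=> i _; rewrite -expr2 sqr_ge0.
move=> /allP x0; apply/rowP => i; rewrite mxE.
by have := x0 i (mem_index_enum _); rewrite /= mulf_eq0 orbb => /eqP.
Qed.

Lemma dotp_delta i j : dotp (delta_mx 0 i) (delta_mx 0 j : 'rV[R]_d) = (i == j)%:R.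
Proof.
rewrite /dotp (bigD1 i)//= big1 ?addr0 => [|k ki]; last by rewrite !mxE eqxx/= (negPf ki) mul0r.
by rewrite !mxE !eqxx mul1r.
Qed.

Lemma enorm_ge0 x : 0 <= enorm x.
Proof. exact: sqrtr_ge0. Qed.

Lemma enorm_sqr x : enorm x ^+ 2 = dotp x x.
Proof. by rewrite sqr_sqrtr// dotp_ge0. Qed.

Lemma cauchy_schwarz x y : dotp x y ^+ 2 <= dotp x x * dotp y y.
Proof.
have [y0|y0] := eqVneq (dotp y y) 0.
  by rewrite (dotp_eq0 y0) !dotp0r expr0n mulr0.
have yp : 0 < dotp y y by rewrite lt0r y0 dotp_ge0.
have := dotp_ge0 (dotp y y *: x - dotp x y *: y).
rewrite !(dotpDl, dotpDr, dotpNl, dotpNr, dotpZl, dotpZr) (dotpC y x) => H.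
by rewrite -subr_ge0 -(pmulr_rge0 _ yp); apply: le_trans H _; lra.
Qed.

Lemma dotp_le_enorm x y : `|dotp x y| <= enorm x * enorm y.
Proof.
rewrite -ler_sqr ?nnegrE ?mulr_ge0 ?enorm_ge0//.
by rewrite exprMn !enorm_sqr real_normK ?num_real// cauchy_schwarz.
Qed.

Lemma enormD x y : enorm (x + y) <= enorm x + enorm y.
Proof.
rewrite -ler_sqr ?nnegrE ?addr_ge0 ?enorm_ge0//.
rewrite sqrrD !enorm_sqr !(dotpDl, dotpDr) (dotpC y x) -!enorm_sqr.
by have := ler_norm (dotp x y); have := dotp_le_enorm x y; lra.
Qed.

Lemma enormZ a x : enorm (a *: x) = `|a| * enorm x.
Proof.
by rewrite /enorm dotpZl dotpZr mulrA -expr2 sqrtrM ?sqr_ge0// sqrtr_sqr.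
Qed.

Lemma enormN x : enorm (- x) = enorm x.
Proof. by rewrite -scaleN1r enormZ normrN normr1 mul1r. Qed.

Lemma enorm_coord x i : `|x 0 i| <= enorm x.
Proof.
rewrite -ler_sqr ?nnegrE ?enorm_ge0// enorm_sqr real_normK ?num_real//.
rewrite /dotp (bigD1 i)//= -expr2 lerDl.
by apply: sumr_ge0 => j _; rewrite -expr2 sqr_ge0.
Qed.

Lemma dotp_mulmx x y (A : 'M[R]_d) : dotp (x *m A) y = dotp x (y *m A^T).
Proof.
have dotpE u v : dotp u v = (u *m v^T) 0 0 by rewrite mxE; apply: eq_bigr => i _; rewrite mxE.
by rewrite !dotpE trmx_mul trmxK mulmxA.
Qed.

Lemma dotp_sumr (I : finType) x (F : I -> 'rV[R]_d) : dotp x (\sum_i F i) = \sum_i dotp x (F i).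
Proof.
by rewrite (big_morph (dotp x) (fun u v => dotpDr x u v) (dotp0r x)).
Qed.

End euclidean.

(** The gradient of u |-> f (c + u A) by the chain rule for row vectors. *)
Definition frame_grad (R : realType) d (f : 'rV[R]_d -> R) (c : 'rV[R]_d) (A : 'M[R]_d) u :=
  grad f (c + u *m A) *m A^T.

Section potential.
Variables (R : realType) (d : nat) (L mu : R) (f : 'rV[R]_d -> R).
Hypotheses (mu0 : 0 < mu) (muL : mu <= L) (fC : Cclass L mu f).

Let L0 : 0 < L. Proof. exact: lt_le_trans muL. Qed.

Lemma gradient_lower x y : f y + dotp (grad f y) (x - y) <= f x.
Proof.
case: fC => _ /(_ x y)/andP[H _] _.
have : 0 <= mu / 2 * enorm (x - y) ^+ 2 by rewrite mulr_ge0 ?sqr_ge0// divr_ge0// ltW.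
move=> ?; lra.
Qed.

Lemma gradient_upper x y :
  f x <= f y + dotp (grad f y) (x - y) + L / 2 * enorm (x - y) ^+ 2.
Proof. by case: fC => _ /(_ x y)/andP[_ H] _; lra. Qed.

Lemma gradient_monotone x y : 0 <= dotp (grad f x - grad f y) (x - y).
Proof.
have := gradient_lower x y; have := gradient_lower y x.
rewrite -(opprB x y) dotpNr dotpDl dotpNl; lra.
Qed.

Lemma gradient_lipschitz x y :
  dotp (grad f x - grad f y) (x - y) <= L * enorm (x - y) ^+ 2.
Proof.
have := gradient_upper x y; have := gradient_upper y x.
rewrite -(opprB x y) dotpNr dotpDl dotpNl enormN; lra.
Qed.

Lemma minimizerP : exists xs, [/\ forall x, f xs <= f x,
  forall x, enorm (x - xs) ^+ 2 <= 2 / L -> f x <= f xs + 1,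
  forall x, f x <= f xs + 1 -> enorm (x - xs) ^+ 2 <= 2 / mu &
  enorm xs <= (Num.sqrt mu)^-1].
Proof.
case: fC => _ H [xs xmin xsn].
have fmin x : f xs <= f x.
  by have [->//|/xmin/ltW] := eqVneq x xs.
have g0 : grad f xs = 0.
  (* A gradient step of length 1/L from the minimizer would gain |grad f xs|^2 / (2L) by the upper
     quadratic bound, so the gradient vanishes there. *)
  have := fmin (xs - L^-1 *: grad f xs).
  have := gradient_upper (xs - L^-1 *: grad f xs) xs.
  have -> : xs - L^-1 *: grad f xs - xs = - (L^-1 *: grad f xs) by rewrite addrAC subrr add0r.
  rewrite enormN enormZ dotpNr dotpZr exprMn real_normK ?num_real//.
  rewrite enorm_sqr; set D := dotp _ _ => h1 h2.
  apply: dotp_eq0; apply/eqP; rewrite eq_le dotp_ge0 andbT -/D.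
  have E : L / 2 * ((L^-1) ^+ 2 * D) = L^-1 * D / 2 by field; rewrite gt_eqF.
  have : L^-1 * D <= 0 by move: h1; rewrite E; lra.
  by rewrite pmulr_rle0// invr_gt0.
exists xs; split => // x.
  move=> hx; have := gradient_upper x xs; rewrite g0 dotp0l addr0.
  have : L / 2 * enorm (x - xs) ^+ 2 <= L / 2 * (2 / L) by rewrite ler_wpM2l// divr_ge0// ltW.
  have -> : L / 2 * (2 / L) = 1 by field; rewrite gt_eqF.
  lra.
move=> hx; have /andP[+ _] := H x xs; rewrite g0 dotp0l subr0 => h1.
rewrite ler_pdivlMr// mulrC; lra.
Qed.

Section frame.
Variables (c : 'rV[R]_d) (A : 'M[R]_d).
Local Notation h u := (f (c + u *m A)).
Local Notation gradh := (frame_grad f c A).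

Let diffE u v : (c + u *m A) - (c + v *m A) = (u - v) *m A.
Proof. by rewrite mulmxBl opprD addrACA subrr add0r. Qed.

Lemma frame_lower u v : h v + dotp (gradh v) (u - v) <= h u.
Proof.
have := gradient_lower (c + u *m A) (c + v *m A).
by rewrite diffE dotpC dotp_mulmx dotpC.
Qed.

Lemma frame_monotone u v : 0 <= dotp (gradh u - gradh v) (u - v).
Proof.
have := gradient_monotone (c + u *m A) (c + v *m A).
by rewrite diffE dotpC dotp_mulmx dotpC mulmxBl.
Qed.

Lemma frame_lipschitz u v :
  dotp (gradh u - gradh v) (u - v) <= L * enorm ((u - v) *m A) ^+ 2.
Proof.
have := gradient_lipschitz (c + u *m A) (c + v *m A).
by rewrite diffE dotpC dotp_mulmx dotpC mulmxBl.
Qed.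

End frame.
End potential.

(** * An ellipsoid around a cut ball *)

Section cut.
Variables (R : realType) (d : nat) (tau : R).
Hypothesis tau8 : 0 < tau <= 8^-1.

(* The image of the unit ball under u |-> u *m cut_mx g - tau *: g is an
   ellipsoid containing the part of the unit ball where dotp u g <= tau. *)
Definition cut_mx (g : 'rV[R]_d) : 'M[R]_d :=
  (1 + 4 * tau ^+ 2)%:M + (- tau - 4 * tau ^+ 2) *: (g^T *m g).

Lemma mul_cut_mx (g x : 'rV[R]_d) : x *m cut_mx g =
  (1 + 4 * tau ^+ 2) *: x - ((tau + 4 * tau ^+ 2) * dotp x g) *: g.
Proof.
rewrite mulmxDr -scalemxAr mulmxA mul_mx_scalar; congr (_ + _).
have -> : x *m g^T = (dotp x g)%:M.
  by rewrite [LHS]mx11_scalar; congr _%:M; rewrite mxE; apply: eq_bigr => i _; rewrite mxE.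
by apply/rowP => i; rewrite mul_scalar_mx !mxE; ring.
Qed.

Variable g : 'rV[R]_d.
Hypothesis g1 : dotp g g = 1.

(** The symmetric matrix [cut_mx g] has eigenvalue 1 - tau along g and 1 + 4 tau^2 on its orthogonal
    complement. *)
Lemma enorm_cut_mx x : enorm (x *m cut_mx g) <= (1 + 4 * tau ^+ 2) * enorm x.
Proof.
have b0 : 0 <= 1 + 4 * tau ^+ 2 by have := sqr_ge0 tau; lra.
rewrite -ler_sqr ?nnegrE ?mulr_ge0 ?enorm_ge0// exprMn !enorm_sqr mul_cut_mx.
rewrite !(dotpDl, dotpDr, dotpNl, dotpNr, dotpZl, dotpZr) g1 (dotpC g x).
have := cauchy_schwarz x g; rewrite g1 mulr1; move: (dotp x g) (dotp x x) => s r sr.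
have s20 := sqr_ge0 s.
have : 0 <= (tau + 4 * tau ^+ 2) * (2 * (1 + 4 * tau ^+ 2) - (tau + 4 * tau ^+ 2)) * s ^+ 2.
  case/andP: tau8 => t0 t8; have t2 := sqr_ge0 tau.
  by rewrite mulr_ge0// mulr_ge0//; lra.
lra.
Qed.

(** With s = dotp u g, the preimage w has coordinate (s + tau) / (1 - tau) along g and orthogonal
    part divided by 1 + 4 tau^2. That w lies in the unit ball reduces to a quadratic inequality in s
    on [-1, tau]. *)
Lemma cut_ball u : dotp u u <= 1 -> dotp u g <= tau ->
  exists w, u = w *m cut_mx g - tau *: g /\ dotp w w <= 1.
Proof.
move=> u1 ut; have /andP[t0 t8] := tau8.
set s := dotp u g in ut *; pose b := 1 + 4 * tau ^+ 2; pose a := 1 - tau.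
have s1 : s ^+ 2 <= dotp u u by have := cauchy_schwarz u g; rewrite g1 mulr1.
have sm1 : - 1 <= s.
  rewrite leNgt; apply/negP => s2; suff : 1 < s ^+ 2 by lra.
  by nra.
have b0 : 0 < b by rewrite /b; have := sqr_ge0 tau; lra.
have a0 : 0 < a by rewrite /a; lra.
exists (b^-1 *: (u - s *: g) + ((s + tau) / a) *: g).
have gu : dotp g u = s by rewrite dotpC.
have wg : dotp (b^-1 *: (u - s *: g) + ((s + tau) / a) *: g) g = (s + tau) / a.
  by rewrite !(dotpDl, dotpNl, dotpZl) g1 mulr1 -/s subrr mulr0 add0r mulr1.
split.
  apply/rowP => i; rewrite mul_cut_mx wg !mxE -/b.
  have -> : tau + 4 * tau ^+ 2 = b - a by rewrite /a /b; ring.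
  by field; rewrite !gt_eqF.
rewrite !(dotpDl, dotpDr, dotpNl, dotpNr, dotpZl, dotpZr) g1 gu -/s.
rewrite [leLHS](_ : _ = b^-1 ^+ 2 * (dotp u u - s ^+ 2) + ((s + tau) / a) ^+ 2); last by ring.
have bs : b^-1 ^+ 2 * (dotp u u - s ^+ 2) <= b^-1 ^+ 2 * (1 - s ^+ 2).
  by rewrite ler_wpM2l ?sqr_ge0//; lra.
apply: (le_trans (lerD bs (lexx _))); rewrite -subr_ge0.
pose N r := a ^+ 2 * b ^+ 2 - (1 - r ^+ 2) * a ^+ 2 - (r + tau) ^+ 2 * b ^+ 2.
rewrite [leRHS](_ : _ = N s / (a ^+ 2 * b ^+ 2)); last first.
  by rewrite /N; field; rewrite !gt_eqF.
rewrite divr_ge0//; last by rewrite mulr_ge0// sqr_ge0.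
(* N is a concave quadratic polynomial vanishing at -1. *)
have NE : (1 + tau) * N s = (1 + s) * N tau + (b ^+ 2 - a ^+ 2) * (1 + tau) * (1 + s) * (tau - s).
  by rewrite /N /a; ring.
have ab : a ^+ 2 <= b ^+ 2.
  by rewrite ler_sqr ?nnegrE ?ltW// /a /b; have := sqr_ge0 tau; lra.
(* The coefficient 4 of tau^2 in [cut_mx] and tau <= 1/8 are used here: after the factor tau^2, a
   term of at least 9 (7/8)^2 faces one of at most 4 (17/16)^2. *)
have Nt : 0 <= N tau.
  have -> : N tau = tau ^+ 2 * (a ^+ 2 * (9 + 16 * tau ^+ 2) - 4 * (1 + 4 * tau ^+ 2) ^+ 2).
    by rewrite /N /a /b; ring.
  rewrite mulr_ge0 ?sqr_ge0//.
  have a2 : (7 / 8) ^+ 2 <= a ^+ 2 by rewrite ler_sqr ?nnegrE /a; lra.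
  have t2 : tau ^+ 2 <= 8^-1 ^+ 2 by rewrite ler_sqr ?nnegrE; lra.
  have t20 := sqr_ge0 tau; move: (tau ^+ 2) (a ^+ 2) t2 t20 a2 => q A t2 t20 a2.
  by nra.
have st : 0 <= (1 + s) * N tau by rewrite mulr_ge0//; lra.
have st2 : 0 <= (b ^+ 2 - a ^+ 2) * (1 + tau) * (1 + s) * (tau - s).
  by rewrite !mulr_ge0//; lra.
have : 0 <= (1 + tau) * N s by rewrite NE addr_ge0.
by rewrite pmulr_rge0//; lra.
Qed.

(** The determinant is (1 - tau) (1 + 4 tau^2)^(d-1); both logarithms are bounded by ln (1 + x) <=
    x. *)
Lemma det_cut_mx : (0 < d)%N -> 0 < \det (cut_mx g) /\ ln (\det (cut_mx g)) <= - tau + d%:R * (4 * tau ^+ 2).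
Proof.
move=> d0; have /andP[t0 t8] := tau8.
pose b := 1 + 4 * tau ^+ 2; pose k := - tau - 4 * tau ^+ 2.
have b1 : 1 <= b by rewrite /b; have := sqr_ge0 tau; lra.
have b0 : b != 0 by rewrite gt_eqF//; lra.
have gg : g *m g^T = 1%:M.
  by rewrite [LHS]mx11_scalar; congr _%:M; rewrite mxE -g1; apply: eq_bigr => i _; rewrite mxE.
(* Matrix determinant lemma: the bordered matrix B is made block triangular in two ways, one
   exposing the scalar 1 + k/b and the other [cut_mx g]. *)
pose B := block_mx (1%:M : 'M[R]_1) g ((- k) *: g^T) (b%:M : 'M[R]_d).
have E1 : B *m block_mx 1%:M 0 ((k / b) *: g^T) 1%:M = block_mx ((1 + k / b)%:M : 'M[R]_1) g 0 (b%:M).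
  rewrite mulmx_block !mulmx1 !mulmx0 !add0r -scalemxAr gg mul_scalar_mx scalerA.
  rewrite mulrCA divff// mulr1 -scalerDl addNr scale0r scalemx1 raddfD/=.
  by congr block_mx; rewrite raddfD.
have E2 : B *m block_mx 1%:M (- g) 0 1%:M = block_mx 1%:M 0 ((- k) *: g^T) (cut_mx g).
  rewrite mulmx_block !mulmx1 !mulmx0 !addr0 !mul1mx addNr.
  have -> : ((- k) *: g^T) *m - g = k *: (g^T *m g) by rewrite mulmxN -scalemxAl scaleNr opprK.
  by rewrite addrC.
have D1 : \det B = (1 + k / b) * b ^+ d.
  have := congr1 determinant E1; rewrite det_mulmx det_lblock det_ublock !det_scalar1 det1.
  by rewrite !mulr1 det_scalar.
have D2 : \det B = \det (cut_mx g).
  have := congr1 determinant E2; rewrite det_mulmx det_lblock det_ublock !det1.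
  by rewrite !mulr1 mul1r.
have DE : \det (cut_mx g) = (1 - tau) * b ^+ d.-1.
  rewrite -D2 D1 -[in LHS](prednK d0) exprS mulrA; congr (_ * _).
  by rewrite mulrDl mul1r divfK// /b /k; ring.
have bd0 : 0 < b ^+ d.-1 by rewrite exprn_gt0//; lra.
rewrite DE; split; first by rewrite mulr_gt0//; lra.
rewrite lnM ?posrE//; last by lra.
rewrite lerD//; first by apply: le_ln1Dx; lra.
have -> : ln (b ^+ d.-1) = d.-1%:R * ln b by rewrite lnXn ?mulr_natl//; lra.
have lb : ln b <= 4 * tau ^+ 2.
  by apply: le_ln1Dx; have := sqr_ge0 tau; lra.
by rewrite ler_pM ?ler0n ?ln_ge0// ler_nat leq_pred.
Qed.

End cut.

(** * Geometry of an ellipsoid around the sublevel set *)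

Section localized.
Variables (R : realType) (d : nat) (L mu : R) (f : 'rV[R]_d -> R).
Hypotheses (mu0 : 0 < mu) (muL : mu <= L) (fC : Cclass L mu f).
Variable xs : 'rV[R]_d.
Hypothesis fmin : forall x, f xs <= f x.
Hypothesis fball : forall x, enorm (x - xs) ^+ 2 <= 2 / L -> f x <= f xs + 1.

Let L0 : 0 < L. Proof. exact: lt_le_trans muL. Qed.

Definition localized (c : 'rV[R]_d) (A : 'M[R]_d) :=
  forall x, f x <= f xs + 1 -> exists u, x = c + u *m A /\ dotp u u <= 1.

Definition det_floor : R := Num.sqrt (2 / L) ^+ d / d`!%:R.

Lemma det_floor_gt0 : 0 < det_floor.
Proof. by rewrite divr_gt0 ?ltr0n ?fact_gt0// exprn_gt0// sqrtr_gt0 divr_gt0. Qed.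

(** A volume bound without volumes: the points xs + rho e_i and xs - rho e_i lie in the ellipsoid,
    so half the difference of their coordinates shows that row i of the inverse has norm at most
    1/rho. Leibniz' formula then bounds the determinant of the inverse, whence the d! in
    [det_floor]. *)
Lemma localized_det c A : localized c A -> det_floor <= `|\det A|.
Proof.
move=> loc; pose rho := Num.sqrt (2 / L).
have rho0 : 0 < rho by rewrite sqrtr_gt0 divr_gt0.
have H i : exists w : 'rV[R]_d, w *m A = delta_mx 0 i /\ enorm w <= rho^-1.
  have P (e : R) : e ^+ 2 = 1 -> exists u, xs + (e * rho) *: delta_mx 0 i = c + u *m A /\ enorm u <= 1.
    move=> e1; have [|u [uE u1]] := loc (xs + (e * rho) *: delta_mx 0 i).
      apply: fball; rewrite addrAC subrr add0r enorm_sqr dotpZl dotpZr dotp_delta eqxx mulr1.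
      by rewrite -expr2 exprMn e1 mul1r sqr_sqrtr// divr_ge0// ltW.
    by exists u; split=> //; rewrite -(ler_sqr (enorm_ge0 u)) ?nnegrE// enorm_sqr expr1n.
  have [u [uE u1]] := P 1 (expr1n _ _).
  have [v [vE v1]] := P (- 1) (sqrr_sign R 1).
  exists ((2 * rho)^-1 *: (u - v)); split.
    rewrite -scalemxAl mulmxBl.
    have -> : u *m A - v *m A = (2 * rho) *: delta_mx 0 i.
      have -> : u *m A - v *m A = (c + u *m A) - (c + v *m A) by rewrite opprD addrACA subrr add0r.
      by rewrite -uE -vE opprD addrACA subrr add0r -scaleNr -scalerDl; congr (_ *: _); ring.
    by rewrite scalerA mulVf ?scale1r// gt_eqF// mulr_gt0.
  rewrite enormZ gtr0_norm ?invr_gt0 ?mulr_gt0// invfM -mulrA mulrCA ler_piMr ?invr_ge0 ?(ltW rho0)//.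
  by have := enormD u (- v); rewrite enormN; lra.
pose w i := sval (cid (H i)).
have wA i : w i *m A = delta_mx 0 i by case: (svalP (cid (H i))).
have wn i : enorm (w i) <= rho^-1 by case: (svalP (cid (H i))).
pose W : 'M[R]_d := \matrix_(i, j) w i 0 j.
have WA : W *m A = 1%:M.
  apply/row_matrixP => i; rewrite row_mul.
  have -> : row i W = w i by apply/rowP => j; rewrite !mxE.
  by rewrite wA rowE mulmx1.
have dW : `|\det W| <= d`!%:R * rho^-1 ^+ d.
  rewrite /determinant; apply: le_trans (ler_norm_sum _ _ _) _.
  apply: (@le_trans _ _ (\sum_(s : 'S_d) rho^-1 ^+ d)).
    apply: ler_sum => s _; rewrite normrM normrX normrN normr1 expr1n mul1r normr_prod.
    rewrite -[X in _ ^+ X](card_ord d) -prodr_const; apply: ler_prod => i _.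
    by rewrite normr_ge0/= mxE (le_trans (enorm_coord _ _)).
  by rewrite sumr_const card_Sn mulr_natl.
have := congr1 (fun M => `|\det M|) WA; rewrite det_mulmx det1 normr1 normrM => WA1.
have A0 : 0 <= `|\det A| by [].
have F0 : 0 < d`!%:R :> R by rewrite ltr0n fact_gt0.
have r0 : 0 < rho ^+ d by rewrite exprn_gt0.
have E : rho ^+ d = rho ^+ d * `|\det W| * `|\det A| by rewrite -mulrA WA1 mulr1.
rewrite /det_floor -/rho ler_pdivrMr// [leLHS]E [leRHS]mulrC.
rewrite ler_wpM2r//; apply: le_trans (ler_wpM2l (ltW r0) dW) _.
by rewrite mulrCA -exprMn divff ?gt_eqF// expr1n mulr1.
Qed.

Lemma localized_unitmx c A : localized c A -> A \in unitmx.
Proof.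
move=> /localized_det H; rewrite unitmxE unitfE -normr_gt0.
exact: lt_le_trans det_floor_gt0 H.
Qed.

(** In the sublevel set f exceeds its value at the test point v by at most 1, so by convexity M
    (dotp u g - dotp v g) <= 1, a half-space that [cut_ball] can handle. *)
Lemma localized_cut c A v tau g M : 0 < tau <= 8^-1 -> localized c A ->
  frame_grad f c A v = M *: g -> dotp g g = 1 -> 0 < M -> M^-1 + dotp v g <= tau ->
  localized (c - tau *: (g *m A)) (cut_mx tau g *m A).
Proof.
move=> t8 loc gE g1 M0 Mt x fx; have [u [xE u1]] := loc x fx; move: fx; rewrite xE => fx.
have ug : dotp u g <= tau.
  have := frame_lower mu0 fC c A u v; rewrite gE dotpZl.
  rewrite dotpDr dotpNr ![dotp g _]dotpC; have := fmin (c + v *m A) => h1 h2.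
  have : M * (dotp u g - dotp v g) <= 1 by lra.
  by rewrite mulrC -ler_pdivlMr// mul1r; lra.
have [w [-> w1]] := cut_ball t8 g1 u1 ug; exists w; split=> //.
by rewrite mulmxBl -scalemxAl mulmxA addrCA addrC -addrA.
Qed.

Section centered.
Variables (c : 'rV[R]_d) (A : 'M[R]_d) (eps M : R).
Hypothesis loc : localized c A.
Local Notation h u := (f (c + u *m A)).
Local Notation gradh := (frame_grad f c A).

(** The index d stands for the centre, since no coordinate has that number. *)
Definition test_point (i : nat) : 'rV[R]_d := \row_j (eps * (j == i :> nat)%:R).

Lemma test_pointd : test_point d = 0.
Proof. by apply/rowP => j; rewrite !mxE ltn_eqF ?ltn_ord ?mulr0. Qed.

Lemma test_point_ord (i : 'I_d) : test_point i = eps *: delta_mx 0 i.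
Proof. by apply/rowP => j; rewrite !mxE eqxx. Qed.

Hypotheses (eps0 : 0 < eps) (M0 : 0 < M) (epsM : eps * M = 1).
Hypothesis testM : forall i, (i <= d)%N -> enorm (gradh (test_point i)) <= M.

Lemma gradh0_le : enorm (gradh 0) <= M.
Proof. by rewrite -test_pointd testM. Qed.

(** Outside the unit ball h exceeds the minimum by more than 1. Convexity along the segment from the
    preimage v of the minimizer to u, through a point p at distance 4 from v, turns this into linear
    growth of slope 1/4; the term M bounds h 0 minus the minimum. *)
Lemma growth u : (enorm u - 5) / 4 - M <= h u - h 0.
Proof.
have fx : f xs <= f xs + 1 by rewrite lerDl.
have [v [xE v1]] := loc fx.
have {}v1 : enorm v <= 1 by rewrite -(ler_sqr (enorm_ge0 v)) ?nnegrE// enorm_sqr expr1n.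
have h0 : h 0 <= f xs + M.
  have := frame_lower mu0 fC c A v 0; rewrite -xE subr0.
  have := dotp_le_enorm (gradh 0) v; have := gradh0_le; have := enorm_ge0 v.
  rewrite ler_norml => n1 n2 /andP[n3 _] n4.
  have : enorm (gradh 0) * enorm v <= M * 1 by rewrite ler_pM ?enorm_ge0.
  lra.
suff : (enorm u - 5) / 4 <= h u - f xs by lra.
have := enormD (u - v) v; rewrite subrK => tri.
have [r4|r4] := leP 4 (enorm (u - v)); last by have := fmin (c + u *m A); lra.
set r := enorm (u - v) in r4 tri *.
(* Since v lies in the unit ball, a point at distance 4 from v has norm at least 3 and is outside
   the ellipsoid. *)
pose th := 4 / r.
have th0 : 0 < th by rewrite divr_gt0//; lra.
have th1 : th <= 1 by rewrite ler_pdivrMr ?mul1r//; lra.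
pose p := v + th *: (u - v).
have np : 3 <= enorm p.
  have := enormD p (- v); rewrite enormN /p addrAC subrr add0r enormZ gtr0_norm// -/r.
  by rewrite divfK ?gt_eqF//; lra.
have hp : f xs + 1 < h p.
  rewrite ltNge; apply/negP => /loc[w [wE w1]].
  have pw : p = w by apply: (can_inj (mulmxK (localized_unitmx loc))); exact: addrI wE.
  have : enorm w <= 1 by rewrite -(ler_sqr (enorm_ge0 w)) ?nnegrE// enorm_sqr expr1n.
  by rewrite -pw; lra.
have := frame_lower mu0 fC c A u p; have := frame_lower mu0 fC c A v p; rewrite -xE.
have -> : u - p = (1 - th) *: (u - v) by apply/rowP => j; rewrite !mxE; ring.
have -> : v - p = (- th) *: (u - v) by apply/rowP => j; rewrite !mxE; ring.
rewrite !dotpZr; set D := dotp _ _ => c1 c2.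
have c3 : h p - f xs <= th * (h u - f xs) by nra.
have c4 : 1 < th * (h u - f xs) by lra.
have : r / 4 < h u - f xs.
  by rewrite -(ltr_pM2l th0); apply: le_lt_trans c4; rewrite /th mulrA divfK ?divff// gt_eqF//; lra.
lra.
Qed.

(** By convexity s times the slope is at least h (s u) - h 0, and 8M + 10 is the radius from which
    the lower bound of [growth] exceeds one eighth of the norm. *)
Lemma radial_slope u s : 0 < s -> 8 * M + 10 <= s * enorm u ->
  enorm u / 8 <= dotp (gradh (s *: u)) u.
Proof.
move=> s0 su; have := growth (s *: u); rewrite enormZ gtr0_norm// => g1.
have := frame_lower mu0 fC c A 0 (s *: u).
rewrite sub0r dotpNr dotpZr => g2.
have : s * (enorm u / 8) <= s * dotp (gradh (s *: u)) u by lra.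
by rewrite ler_pM2l.
Qed.

(** The cube lies in the simplex spanned by 0 and the points eps e_i, at which h <= h 0 + 1 because
    their gradients are at most M and eps M = 1; convexity extends the bound to the simplex. *)
Lemma cube_potential (u : 'rV[R]_d) : (0 < d)%N -> (forall i, 0 <= u 0 i <= eps / d%:R) -> h u <= h 0 + 1.
Proof.
move=> d0 ui; have dp : 0 < d%:R :> R by rewrite ltr0n.
pose th i := u 0 i / eps.
have th0 i : 0 <= th i by rewrite divr_ge0 ?(ltW eps0)//; case/andP: (ui i).
have sth : \sum_i th i <= 1.
  apply: (@le_trans _ _ (\sum_(i < d) d%:R^-1)).
    by apply: ler_sum => i _; rewrite /th ler_pdivrMr// mulrC; case/andP: (ui i).
  by rewrite sumr_const card_ord -[leLHS]mulr_natr mulVf ?gt_eqF.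
have hv (i : 'I_d) : h (test_point i) <= h 0 + 1.
  have := frame_lower mu0 fC c A 0 (test_point i); rewrite sub0r dotpNr.
  have := dotp_le_enorm (gradh (test_point i)) (test_point i).
  have : enorm (test_point i) = eps.
    by rewrite test_point_ord enormZ gtr0_norm// /enorm dotp_delta eqxx sqrtr1 mulr1.
  move=> ->; have := testM (ltnW (ltn_ord i)); rewrite ler_norml => t1 /andP[_ t2].
  have : enorm (gradh (test_point i)) * eps <= M * eps by rewrite ler_pM2r.
  by rewrite (mulrC M) epsM; lra.
have E : \sum_i th i *: test_point i = u.
  apply/rowP => j; rewrite summxE (bigD1 j)//= big1 ?addr0.
    by rewrite !mxE eqxx mulr1 /th divfK// gt_eqF.
  by move=> i ij; rewrite !mxE [_ == _](negPf _) ?mulr0// eq_sym.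
have s1 : \sum_i th i * (h u + dotp (gradh u) (test_point i - u)) <= (\sum_i th i) * (h 0 + 1).
  rewrite mulr_suml; apply: ler_sum => i _; rewrite ler_wpM2l//; apply: le_trans (hv i).
  exact: (frame_lower mu0 fC).
have s2 : \sum_i th i * (h u + dotp (gradh u) (test_point i - u)) =
   (\sum_i th i) * (h u - dotp (gradh u) u) + dotp (gradh u) u.
  rewrite -[X in _ = _ + dotp _ X]E dotp_sumr mulr_suml -big_split/=; apply: eq_bigr => i _.
  by rewrite dotpDr dotpNr dotpZr; ring.
have s3 : (1 - \sum_i th i) * (h u - dotp (gradh u) u) <= (1 - \sum_i th i) * (h 0 + 1).
  rewrite ler_wpM2l ?subr_ge0//.
  by have := frame_lower mu0 fC c A 0 u; rewrite sub0r dotpNr; lra.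
by move: s1 s2 s3; set S := \sum_i th i; lra.
Qed.

End centered.
End localized.

(** * The thinning chain *)

Section uniform_pair.
Variable R : realType.
Local Notation leb := (@lebesgue_measure R).

Lemma integral_uniform_pair (phi : R * R -> \bar R) :
  measurable_fun setT (phi : measurableTypeR R * measurableTypeR R -> \bar R) ->
  (forall x, 0 <= phi x)%E ->
  (\int[coinP R]_o phi (unif R (unzip o).1, unif R (unzip o).2) =
   \int[leb]_(v in `]0%R, 1%R[) \int[leb]_(u in `]0%R, 1%R[) phi (v, u))%E.
Proof.
move=> mphi phi0.
have mf : measurable_fun setT (fun p : coin * coin => (unif R p.1, unif R p.2)).
  apply/measurable_fun_pair.
    by apply: (measurableT_comp (@measurable_unif R)); exact: measurable_fst.
  by apply: (measurableT_comp (@measurable_unif R)); exact: measurable_snd.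
rewrite (integral_unzip (phi := fun p => phi (unif R p.1, unif R p.2)))//; last first.
  exact: (measurableT_comp mphi mf).
pose G (p : R * R) : \bar R := ((\1_(`]0%R, 1%R[%classic : set R) p.2)%:E * phi p)%E.
pose F (v : R) : \bar R := (\int[leb]_(u in `]0%R, 1%R[) phi (v, u))%E.
have F0 v : (0 <= F v)%E by exact: integral_ge0.
have FE v : F v = (\int[leb]_u ((\1_(`]0%R, 1%R[%classic : set R) u)%:E * phi (v, u)))%E.
  rewrite /F integral_mkcond; apply: eq_integral => u _; rewrite patchE indicE.
  by case: ifP => _; rewrite ?mul1e ?mul0e.
have mF : measurable_fun setT (F : measurableTypeR R -> \bar R).
  rewrite (_ : F = fun v => \int[leb]_u ((\1_(`]0%R, 1%R[%classic : set R) u)%:E * phi (v, u)))%E; last first.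
    by apply/funext => v; rewrite FE.
  apply: (@measurable_fun_fubini_tonelli_F _ _ (measurableTypeR R) (measurableTypeR R) R leb
    (fun p => (\1_(`]0%R, 1%R[%classic : set R) p.2)%:E * phi p)%E).
    apply: emeasurable_funM => //; apply/measurable_EFinP.
    have mi : measurable_fun setT (\1_(`]0%R, 1%R[%classic) : measurableTypeR R -> R).
      by apply: measurable_indic; exact: measurable_itv.
    by apply: (measurableT_comp mi); exact: measurable_snd.
  by move=> p; rewrite mule_ge0// lee_fin.
rewrite -(integral_unif mF F0); apply: eq_integral => a _.
rewrite (integral_unif (phi := fun u => phi (unif R a, u)))//.
by apply: (measurableT_comp mphi); exact: pair1_measurable.
Qed.

End uniform_pair.

Lemma integral_threshold (R : realType) (a b c : R) : 0 <= a -> 0 <= b -> 0 <= c <= 1 ->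
  (\int[lebesgue_measure]_(u in `]0%R, 1%R[) (a + b * (c <= u)%R%:R)%:E = (a + b * (1 - c))%:E)%E.
Proof.
move=> a0 b0 c01.
transitivity (\int[lebesgue_measure]_(u in `]0%R, 1%R[) (a%:E +
   b%:E * (\1_(`[c, 1[%classic : set (measurableTypeR R)) u)%:E))%E.
  apply: eq_integral => u; rewrite inE/= in_itv/= => /andP[u0 u1].
  rewrite EFinD EFinM indicE; congr (_ + _ * (nat_of_bool _)%:R%:E)%E.
  by apply/idP/idP; rewrite inE/= in_itv/= u1 andbT.
have mI : measurable (`]0, 1[%classic : set (measurableTypeR R)) by exact: measurable_itv.
have m1 : measurable_fun (`]0, 1[%classic : set (measurableTypeR R))
    (fun u => (\1_(`[c, 1[%classic : set (measurableTypeR R)) u)%:E : \bar R).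
  by apply: measurable_funTS; apply/measurable_EFinP; exact: measurable_indic.
rewrite ge0_integralD//; last 2 first.
- by move=> u _; rewrite mule_ge0// lee_fin.
- exact: measurable_funeM.
rewrite ge0_integralZl// integral_cst// integral_indic//.
have L01 : lebesgue_measure (`]0, 1[%classic : set (measurableTypeR R)) = 1%E.
  by apply: (etrans (lebesgue_measure_itv `]0, 1[)); rewrite /= lte_fin ltr01 -EFinB subr0.
rewrite EFinD EFinM; congr (_ + _)%E.
  by transitivity (a%:E * 1)%E; [congr (_ * _)%E; exact: L01|rewrite mule1].
congr (_ * _)%E.
have -> : (`[c, 1[ `&` `]0, 1[)%classic =
    (if c == 0 then `]0, 1[ else `[c, 1[)%classic :> set (measurableTypeR R).
  apply/seteqP; split=> u /=; case: eqP => c0 /=; rewrite !in_itv/=; lra.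
case: eqP => [->|/eqP c0]; first by rewrite subr0; exact: L01.
apply: (etrans (lebesgue_measure_itv `[c, 1[)); rewrite /= lte_fin -EFinB.
by case: ltgtP c01 => // [c1 /andP[_ /eqP]|->]; rewrite ?subrr//; lra.
Qed.

(** * Thinning a planar Poisson process under a decreasing rate *)

Section thinning.
Variables (R : realType) (l Lam : R -> R) (K : R).
Hypothesis l_cont : continuous l.
Hypothesis l_decr : forall s t, s <= t -> l t + (t - s) <= l s.
Hypothesis Lam_super : forall s t, Lam t - Lam s <= l s * (t - s).
Hypothesis l1 : 0 <= l 1.
Hypothesis l0K : l 0 <= K.

(** The continuous rate decreases at speed at least 1 on the whole line, so it takes every value
    exactly once and the default of [xget] never arises. *)
Definition linv z := xget 0 [set s | l s = z].

Lemma linvK z : l (linv z) = z.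
Proof.
suff : exists s, l s = z by exact: xgetPex.
pose b := `|l 0| + `|z|.
have b0 : 0 <= b by rewrite addr_ge0.
have H1 : l b <= z.
  have := l_decr b0; rewrite subr0 /b.
  have := ler_norm (l 0); have := ler_norm (- z); rewrite normrN; lra.
have H2 : z <= l (- b).
  have := @l_decr (- b) 0; rewrite oppr_le0 => /(_ b0); rewrite /b.
  have := ler_norm z; have := ler_norm (- l 0); rewrite normrN; lra.
have bb : - b <= b by lra.
have [||c _ lc] := @IVT R l (- b) b z bb.
- by apply: continuous_subspaceT => x; exact: l_cont.
- by rewrite ge_min le_max H1 H2 orbT.
- by exists c.
Qed.

Lemma l_gt_linv s z : (z < l s) = (s < linv z).
Proof.
apply/idP/idP => H; rewrite ltNge; apply/negP => H'.
  by have := l_decr H'; rewrite linvK; lra.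
have := l_decr (ltW H); rewrite linvK; lra.
Qed.

Lemma linv_lip z w : z <= w -> 0 <= linv z - linv w <= w - z.
Proof.
move=> zw; have [H|H] := leP (linv w) (linv z).
  by have := l_decr H; rewrite !linvK; lra.
by have := l_decr (ltW H); rewrite !linvK; lra.
Qed.

(* The length of the part of [0, 1] on which the rate l exceeds z. *)
Definition excess z := Num.max 0 (Num.min 1 (linv z)).

Lemma excess_itv z : 0 <= excess z <= 1.
Proof. by rewrite /excess le_max lexx /= ge_max ler01 ge_min lexx. Qed.

Lemma excess_lip z w : z <= w -> 0 <= excess z - excess w <= w - z.
Proof.
move=> /[dup] zw /linv_lip; rewrite /excess.
by rewrite /Num.max /Num.min; do ![case: ifP]; lra.
Qed.

Lemma l_gt_excess s z : 0 < s < 1 -> (z < l s) = (s < excess z).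
Proof.
move=> s01; rewrite l_gt_linv /excess lt_max lt_min.
by case/andP: s01 => s0 s1; rewrite s1/= (lt_gtF s0).
Qed.

Lemma excessK z : K <= z -> excess z = 0.
Proof.
move=> Kz; have : linv z <= 0 by rewrite leNgt -l_gt_linv -leNgt; exact: le_trans Kz.
by move=> H; rewrite /excess min_r ?max_l//; lra.
Qed.

Lemma excess0 : excess 0 = 1.
Proof.
have : 1 <= linv 0 by rewrite leNgt; apply/negP => H; have := l_decr (ltW H); rewrite linvK; have := l1; lra.
by move=> H; rewrite /excess min_l// max_r.
Qed.

(* The integral of excess over [z, +oo[, by Lam' = l and integration by parts. *)
Definition area z := Lam (excess z) - Lam 0 - z * excess z.

(** Legendre duality: area z + Lam 0 is the maximum of Lam s - z s over [0, 1], reached where the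
    rate crosses z or at an endpoint. *)
Lemma excess_max s z : 0 <= s <= 1 -> Lam s - z * s <= Lam (excess z) - z * excess z.
Proof.
move=> s01; have := Lam_super (excess z) s.
suff : l (excess z) * (s - excess z) <= z * (s - excess z) by lra.
rewrite /excess; have [h1|h1] := leP 1 (linv z).
  rewrite max_r//; have : z <= l 1 by have := l_decr h1; rewrite linvK; lra.
  nra.
have [h0|h0] := leP 0 (linv z); first by rewrite linvK.
have : l 0 <= z by have := l_decr (ltW h0); rewrite linvK; lra.
nra.
Qed.

(** Each of the two maximisers is tested in the problem of the other level. *)
Lemma area_bounds z w :
  - (w - z) * excess z <= area w - area z <= - (w - z) * excess w.
Proof.
have := excess_max w (excess_itv z); have := excess_max z (excess_itv w).
by rewrite /area; lra.
Qed.

Lemma areaK z : K <= z -> area z = 0.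
Proof. by move=> Kz; rewrite /area excessK// mulr0 !subrr. Qed.

Lemma area0 : area 0 = Lam 1 - Lam 0.
Proof. by rewrite /area excess0 mul0r subr0. Qed.

Lemma area_ge0 z : 0 <= area z.
Proof.
have := excess_max z (_ : 0 <= 0 <= 1); rewrite lexx ler01 => /(_ isT).
by rewrite /area; lra.
Qed.

(** [area_bounds] squeezes the difference quotient between the values of - excess at the two ends,
    and excess is 1-Lipschitz because the rate has slope at most -1. *)
Lemma is_derive_area (z : R) : is_derive z (1 : R) area (- excess z).
Proof.
have cv : h^-1 *: ((area \o shift z) (h *: (1 : R)) - area z) @[h --> 0^'] --> - excess z.
  apply/cvgrPdist_le => e e0; near=> h.
  have h0 : h != 0 by near: h; exact: nbhs_dnbhs_neq.
  have he : `|h| <= e by near: h; exact: dnbhs0_le.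
  rewrite /= /shift/= /GRing.scale/= mulr1.
  have := area_bounds z (h + z); rewrite addrK.
  set D := area _ - _; move=> /andP[D1 D2].
  have DE : D = h * (h^-1 * D) by rewrite mulVKf.
  move: DE; set Q := h^-1 * D => DE.
  have [hp|hn|h00] := ltgtP h 0; last by rewrite h00 eqxx in h0.
    have hz : h + z <= z by lra.
    have /andP[a1 a2] := excess_lip hz.
    have Q1 : Q <= - excess z by rewrite -(ler_nM2l hp) -DE; lra.
    have Q2 : - excess (h + z) <= Q by rewrite -(ler_nM2l hp) -DE; lra.
    by move: he; rewrite ltr0_norm// ler_norml; lra.
  have hz : z <= h + z by lra.
  have /andP[a1 a2] := excess_lip hz.
  have Q1 : - excess z <= Q by rewrite -(ler_pM2l hn) -DE; lra.
  have Q2 : Q <= - excess (h + z) by rewrite -(ler_pM2l hn) -DE; lra.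
  by move: he; rewrite gtr0_norm// ler_norml; lra.
apply: DeriveDef; first by apply/cvg_ex; exists (- excess z); exact: cv.
exact: (cvg_lim _ cv).
Unshelve. all: by end_near.
Qed.

Lemma continuous_area : continuous area.
Proof.
move=> z; apply/differentiable_continuous/derivable1_diffP.
exact: (@ex_derive _ _ _ _ _ _ _ (is_derive_area z)).
Qed.

Lemma continuous_excess : continuous excess.
Proof.
move=> z; apply/cvgrPdist_le => e e0; near=> w.
have we : `|z - w| <= e by near: w; exact: cvgr_dist_le.
have [zw|wz] := leP z w.
  have := excess_lip zw; move: we; rewrite !ler_norml; lra.
have := excess_lip (ltW wz); move: we; rewrite !ler_norml; lra.
Unshelve. all: by end_near.
Qed.

Variables (y g : R).
Hypotheses (g01 : 0 < g <= 1) (yg : excess y <= g).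

Let g0 : 0 < g. Proof. by case/andP: g01. Qed.

(** For uniform v the increment - ln v / g is exponential with rate g: it leads to the height of the
    next Poisson point over a strip of width g. *)
Definition level v := y - ln v / g.

Lemma level_ge v : 0 < v <= 1 -> y <= level v.
Proof.
move=> v01; rewrite /level lerDl oppr_ge0 pmulr_lle0 ?invr_gt0//.
by rewrite ln_le0//; case/andP: v01.
Qed.

Lemma is_derive_survival (v : R) : 0 < v ->
  is_derive v (1 : R) (fun v => v * expR (- area (level v)))
    (expR (- area (level v)) * (1 - excess (level v) / g)).
Proof.
move=> v0.
have dl : is_derive v (1 : R) level (- (v^-1 / g)).
  have dln := is_derive1_ln v0.
  have -> : level = (cst y : R -> R) - g^-1 *: (@ln R).
    by apply/funext => x; rewrite /level/= !fctE mulrC.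
  by apply: is_derive_eq; rewrite sub0r mulrC.
have da := is_derive_area (level v).
have dc : is_derive v (1 : R) (fun v => expR (- area (level v)))
   (expR (- area (level v)) * (excess (level v) * - (v^-1 / g))).
  have d1 : is_derive v (1 : R) (area \o level) (- excess (level v) * - (v^-1 / g)).
    exact: is_derive1_comp.
  have -> : (fun v => expR (- area (level v))) = expR \o (- (area \o level)) by [].
  by apply: is_derive_eq; rewrite mulNr opprK.
apply: is_derive_eq; rewrite /GRing.scale/= mulr1.
by field; rewrite !gt_eqF.
Qed.

(** At height z a uniform point of the strip [0, g] falls under the graph exactly when its abscissa
    is below excess z, so it survives with probability 1 - excess z / g. *)
Lemma inner_survival v : 0 < v < 1 ->
  (\int[lebesgue_measure]_(u in `]0%R, 1%R[) ((l (g * u) <= level v)%R%:R * expR (- area (level v)))%:E =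
   (expR (- area (level v)) * (1 - excess (level v) / g))%:E)%E.
Proof.
move=> /andP[v0 v1]; set z := level v.
have yz : y <= z by apply: level_ge; rewrite v0 ltW.
have /andP[e0 _] := excess_itv z.
have eg : excess z <= g by apply: le_trans yg; have := excess_lip yz; lra.
have eg1 : 0 <= excess z / g <= 1 by rewrite divr_ge0 ?(ltW g0)//= ler_pdivrMr// mul1r.
rewrite mulrBr mulr1 -[RHS]/(_)%:E.
transitivity (\int[lebesgue_measure]_(u in `]0%R, 1%R[)
    (0 + expR (- area z) * (excess z / g <= u)%R%:R)%:E)%E.
  apply: eq_integral => u; rewrite inE/= in_itv/= => u01.
  rewrite add0r mulrC; congr (_ * (nat_of_bool _)%:R)%:E.
  have gu : 0 < g * u < 1.
    by case/andP: u01 => u0 u1; rewrite mulr_gt0//=; case/andP: g01 => _ g1; nra.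
  by rewrite leNgt l_gt_excess// -leNgt ler_pdivrMr// mulrC.
by rewrite integral_threshold ?expR_ge0// add0r mulrBr mulr1.
Qed.

Lemma measurable_level_var : measurable_fun setT level.
Proof.
apply: measurable_funB; first exact: measurable_cst.
by apply: measurable_funM; [exact: measurable_ln|exact: measurable_cst].
Qed.

Lemma measurable_survival : measurable_fun setT (fun p : R * R =>
  (l (g * p.2) <= level p.1)%R%:R * expR (- area (level p.1))).
Proof.
have mE : measurable_fun setT (fun v => expR (- area (level v))).
  apply: (measurableT_comp (@measurable_expR R)); apply: measurableT_comp => //.
  by apply: (measurableT_comp _ measurable_level_var); exact: (continuous_measurable_fun continuous_area).
apply: measurable_funM.
  apply: (@measurableT_comp _ _ _ _ _ _ (fun b : bool => b%:R : R)) => //.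
  apply: measurable_fun_ler.
    apply: (measurableT_comp (continuous_measurable_fun l_cont)).
    by apply: measurable_funM; [exact: measurable_cst|exact: measurable_snd].
  by apply: (measurableT_comp measurable_level_var); exact: measurable_fst.
by apply: (measurableT_comp mE); exact: measurable_fst.
Qed.

(* Given V = v, the integral over U is d/dv (v * expR (- area (level v))). *)
Lemma survival_step :
  (\int[coinP R]_o ((l (g * unif R (unzip o).2) <= level (unif R (unzip o).1))%R%:R *
      expR (- area (level (unif R (unzip o).1))))%:E = (expR (- area y))%:E)%E.
Proof.
have mlev := measurable_level_var.
have mE : measurable_fun setT (fun v => expR (- area (level v))).
  apply: (measurableT_comp (@measurable_expR R)); apply: measurableT_comp => //.
  by apply: (measurableT_comp _ mlev); exact: (continuous_measurable_fun continuous_area).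
pose phi (p : R * R) : \bar R := ((l (g * p.2) <= level p.1)%R%:R * expR (- area (level p.1)))%:E.
rewrite (integral_uniform_pair (phi := phi)).
- rewrite /phi/=; pose S v := expR (- area (level v)) * (1 - excess (level v) / g).
  transitivity (\int[lebesgue_measure]_(v in `]0%R, 1%R[) (S v)%:E)%E.
    by apply: eq_integral => v; rewrite inE/= in_itv/=; exact: inner_survival.
  have S0 v : 0 < v < 1 -> 0 <= S v.
    move=> v01; have /level_ge yz : 0 < v <= 1 by case/andP: v01 => -> /ltW.
    rewrite mulr_ge0 ?expR_ge0// subr_ge0 ler_pdivrMr// mul1r; apply: le_trans yg.
    by have := excess_lip yz; lra.
  have mS : measurable_fun setT S.
    apply: measurable_funM => //; apply: measurable_funB; first exact: measurable_cst.
    apply: measurable_funM; last exact: measurable_cst.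
    by apply: (measurableT_comp _ mlev); exact: (continuous_measurable_fun continuous_excess).
  have [Ky|yK] := leP K y.
    transitivity (\int[lebesgue_measure]_(v in `]0%R, 1%R[) (1 + 0 * (1 <= v)%R%:R : R)%:E)%E.
      apply: eq_integral => v; rewrite inE/= in_itv/= => /andP[v0 v1].
      have /level_ge yz : 0 < v <= 1 by rewrite v0 ltW.
      have Kz := le_trans Ky yz.
      by rewrite /S areaK// excessK// mul0r !(mul0r, subr0, addr0, oppr0) expR0 mulr1.
    by rewrite integral_threshold ?ler01 ?lexx// areaK// oppr0 expR0 mul0r addr0.
  (* For v <= v0 the level is at least K, where area and excess vanish and the integrand is 1; the
     fundamental theorem of calculus is then applied on [v0, 1], away from the singularity of the
     logarithm. *)
  pose v0 := expR (- (g * (K - y))).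
  have v00 : 0 < v0 by exact: expR_gt0.
  have v01 : v0 < 1 by rewrite -expR0 ltr_expR oppr_lt0 mulr_gt0// subr_gt0.
  have levK v : 0 < v <= v0 -> K <= level v.
    move=> /andP[vp vv]; rewrite /level.
    have : ln v <= - (g * (K - y)) by rewrite -[leRHS]expRK ler_ln ?posrE.
    by rewrite -mulrN mulrC -ler_pdivrMr//; lra.
  have -> : `]0, 1[%classic = (`]0, v0] `|` `]v0, 1[)%classic :> set R.
    by apply/seteqP; split=> v /=; rewrite !in_itv/=; [case: (leP v v0)|]; lra.
  have mI a b : measurable ([set` Interval a b] : set (measurableTypeR R)) by exact: measurable_itv.
  rewrite ge0_integral_setU//=; first last.
  - rewrite disj_set2E; apply/eqP/seteqP; split => v //=; rewrite !in_itv/=; lra.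
  - by move=> v [] /=; rewrite in_itv/= => vI; rewrite lee_fin S0//; lra.
  - by apply/measurable_EFinP; apply: measurable_funTS.
  have -> : (\int[lebesgue_measure]_(v in `]0%R, v0]) (S v)%:E = v0%:E)%E.
    transitivity (\int[lebesgue_measure]_(v in `]0%R, v0]) (1%:E : \bar R))%E.
      apply: eq_integral => v; rewrite inE/= in_itv/= => /levK Kz.
      by rewrite /S areaK// excessK// mul0r subr0 oppr0 expR0 mulr1.
    rewrite integral_cst// mul1e.
    by apply: (etrans (lebesgue_measure_itv `]0, v0])); rewrite /= lte_fin v00 -EFinB subr0.
  pose F v := v * expR (- area (level v)).
  have dF (v : R) : 0 < v -> is_derive v (1 : R) F (S v) by move=> vp; exact: is_derive_survival.
  have cF (v : R) : 0 < v -> {for v, continuous F}.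
    move=> vp; apply/differentiable_continuous/derivable1_diffP.
    exact: (@ex_derive _ _ _ _ _ _ _ (dF v vp)).
  have -> : (\int[lebesgue_measure]_(v in `]v0, 1%R[) (S v)%:E =
      \int[lebesgue_measure]_(v in `[v0, 1%R]) (S v)%:E)%E.
    by rewrite integral_itv_obnd_cbnd ?integral_itv_bndo_bndc//;
      apply/measurable_EFinP; apply: measurable_funTS.
  rewrite (continuous_FTC2 (F := F))//; last 2 first.
  - split.
    + move=> v; rewrite in_itv/= => /andP[vv _].
      exact: (@ex_derive _ _ _ _ _ _ _ (dF v (lt_trans v00 vv))).
    + by apply: cvg_at_right_filter; exact: cF.
    + by apply: cvg_at_left_filter; apply: cF.
  - move=> v; rewrite in_itv/= => /andP[vv _].
    by rewrite derive1E; exact: (@derive_val _ _ _ _ _ _ _ (dF v (lt_trans v00 vv))).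
  - rewrite /F [X in (_ + (_ - X))%E](_ : _ = v0%:E); last first.
      by rewrite areaK ?oppr0 ?expR0 ?mulr1//; apply: levK; rewrite v00 lexx.
    by rewrite -EFinB -EFinD mul1r /level ln1 mul0r subr0 addrC subrK.
  - apply: continuous_in_subspaceT => v; rewrite inE/= in_itv/= => /andP[vv _].
    have vp := lt_le_trans v00 vv.
    have clev : {for v, continuous level}.
      apply: cvgB; first exact: cvg_cst.
      by apply: cvgM; [exact: continuous_ln|exact: cvg_cst].
    apply: cvgM.
      apply: continuous_comp; last exact: continuous_expR.
      apply: cvgN; apply: continuous_comp clev _; exact: continuous_area.
    apply: cvgB; first exact: cvg_cst.
    by apply: cvgM; [apply: continuous_comp clev _; exact: continuous_excess|exact: cvg_cst].
- by apply/measurable_EFinP; exact: measurable_survival.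
- by move=> p; rewrite lee_fin mulr_ge0// expR_ge0.
Qed.

End thinning.

(** * Expected length of the thinning chain *)

Section chain_cost.
Variables (R : realType) (K y g : R).
Hypotheses (y0 : 0 <= y) (yK : y < K) (g01 : 0 < g <= 1).

(** Write x = K g. If x >= 1, a factor U < 1/2, of probability 1/2, lowers ln (1 + x) by at least
    1/4, which the coefficient 8 turns into a mean gain of 1. If x < 1, the next height passes K
    with probability at least 1/e >= 1/4, and the additive 4 pays for the step. *)
Lemma cost_step :
  (1 + \int[coinP R]_o (if level y g (unif R (unzip o).1) < K
     then 4 + 8 * ln (1 + K * (g * unif R (unzip o).2)) else 0)%R%:E <=
   (4 + 8 * ln (1 + K * g))%R%:E)%E.
Proof.
have g0 : 0 < g by case/andP: g01.
have K0 : 0 < K by exact: le_lt_trans yK.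
pose x := K * g; have x0 : 0 < x by exact: mulr_gt0.
pose v0 := expR (- (g * (K - y))).
have v00 : 0 < v0 by exact: expR_gt0.
have v01 : v0 <= 1 by rewrite -expR0 ler_expR oppr_le0 mulr_ge0 ?subr_ge0// ltW.
pose gap := ln (1 + x) - ln (1 + x / 2).
have gap0 : 0 <= gap by rewrite subr_ge0 ler_ln ?posrE; lra.
have ln0 : 0 <= ln (1 + x / 2) by apply: ln_ge0; lra.
(* A two-valued majorant: ln (1 + x U) is replaced by its value at U = 1/2 or at U = 1, and the
   continuation event by v0 <= V. *)
pose phi (p : R * R) : \bar R :=
  (0 + ((4 + 8 * ln (1 + x / 2)) + 8 * gap * (2^-1 <= p.2)%R%:R) * (v0 <= p.1)%R%:R)%:E.
have phi0 p : (0 <= phi p)%E by rewrite lee_fin add0r mulr_ge0// addr_ge0// ?mulr_ge0//; lra.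
have mphi : measurable_fun setT (phi : measurableTypeR R * measurableTypeR R -> \bar R).
  apply/measurable_EFinP; apply: measurable_funD; first exact: measurable_cst.
  apply: measurable_funM; [apply: measurable_funD; first exact: measurable_cst|].
    apply: measurable_funM; first exact: measurable_cst.
    apply: (@measurableT_comp _ _ _ _ _ _ (fun b : bool => b%:R : R)) => //.
    by apply: measurable_fun_ler; [exact: measurable_cst|exact: measurable_snd].
  apply: (@measurableT_comp _ _ _ _ _ _ (fun b : bool => b%:R : R)) => //.
  by apply: measurable_fun_ler; [exact: measurable_cst|exact: measurable_fst].
pose c := (4 + 8 * ln (1 + x / 2)) + 8 * gap * (1 - 2^-1).
have c0 : 0 <= c by rewrite /c; nra.
have phiE : (\int[coinP R]_o phi (unif R (unzip o).1, unif R (unzip o).2) = (c * (1 - v0))%:E)%E.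
  rewrite integral_uniform_pair//.
  transitivity (\int[lebesgue_measure]_(v in `]0%R, 1%R[) (0 + c * (v0 <= v)%R%:R)%:E)%E.
    apply: eq_integral => v _; rewrite /phi/=; case: (v0 <= v) => /=.
      under eq_integral do rewrite mulr1 add0r.
      by rewrite integral_threshold ?mulr1 ?add0r//; lra.
    under eq_integral do rewrite mulr0 addr0.
    by rewrite integral0 mulr0 addr0.
  by rewrite integral_threshold// ?add0r// v01 ltW.
have bound : (\int[coinP R]_o (if level y g (unif R (unzip o).1) < K
     then 4 + 8 * ln (1 + K * (g * unif R (unzip o).2)) else 0)%R%:E <= (c * (1 - v0))%:E)%E.
  rewrite -phiE; apply: ge0_le_integral => //.
  - move=> o _; rewrite lee_fin; case: ifP => // _.
    have /andP[u0 _] := unif_itv R (unzip o).2.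
    by rewrite addr_ge0// mulr_ge0// ln_ge0// lerDl mulr_ge0 ?mulr_ge0// ?ltW.
  - apply/measurable_EFinP.
    apply: (measurable_fun_ifT (g := fun o => 4 + 8 * ln (1 + K * (g * unif R (unzip o).2)))).
    + apply: measurable_fun_ltr; last exact: measurable_cst.
      apply: measurable_funB; first exact: measurable_cst.
      apply: measurable_funM; last exact: measurable_cst.
      apply: (measurableT_comp (@measurable_ln R)); apply: (measurableT_comp (@measurable_unif R)).
      exact: measurable_unzip1.
    + apply: measurable_funD; first exact: measurable_cst.
      apply: measurable_funM; first exact: measurable_cst.
      apply: (measurableT_comp (@measurable_ln R)).
      apply: measurable_funD; first exact: measurable_cst.
      apply: measurable_funM; first exact: measurable_cst.
      apply: measurable_funM; first exact: measurable_cst.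
      apply: (measurableT_comp (@measurable_unif R)).
      exact: measurable_unzip2.
    + exact: measurable_cst.
  - apply: (measurableT_comp mphi (g := fun o : coin => (unif R (unzip o).1, unif R (unzip o).2))).
    by apply/measurable_fun_pair; apply: (measurableT_comp (@measurable_unif R));
      [exact: measurable_unzip1|exact: measurable_unzip2].
  - move=> o _; rewrite /phi/= lee_fin add0r.
    have := unif_itv R (unzip o).1; have := unif_itv R (unzip o).2.
    move: (unif R _) (unif R _) => V U /andP[U0 U1] /andP[V0 V1].
    case: ifPn => [lK|_]; last by rewrite mulr_ge0// addr_ge0// ?mulr_ge0//; lra.
    have -> : (v0 <= V).
      rewrite leNgt; apply/negP => Vv0; move: lK; apply/negP; rewrite -leNgt /level.
      have : ln V <= - (g * (K - y)) by rewrite -[leRHS]expRK ler_ln ?posrE// ltW.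
      by rewrite -mulrN mulrC -ler_pdivrMr//; lra.
    rewrite mulr1 mulrA -/x.
    have H : ln (1 + x * U) <= ln (1 + x / 2) + gap * (2^-1 <= U)%R%:R.
      have xU : 0 < x * U by exact: mulr_gt0.
      have [hU|hU] := leP 2^-1 U; last by rewrite mulr0 addr0 ler_ln ?posrE; nra.
      by rewrite mulr1 /gap [leRHS]addrC subrK ler_ln ?posrE; nra.
    by move: H; lra.
apply: le_trans (leeD2l _ bound) _; rewrite -EFinD lee_fin -/x.
have H1 : 8 * ln (1 + x) = 8 * ln (1 + x / 2) + 8 * gap by rewrite /gap; lra.
suff : 1 + c * (1 - v0) <= 4 + (8 * ln (1 + x / 2) + 8 * gap) by rewrite H1.
have cE : c = 4 + 8 * ln (1 + x / 2) + 4 * gap by rewrite /c; lra.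
have [x1|x1] := leP 1 x.
  have : 4^-1 <= gap.
    rewrite /gap -ln_div ?posrE; [|lra|lra].
    (* This gives exp (1/4) <= 4/3, and 4/3 <= (1 + x) / (1 + x/2) for x >= 1. *)
    have e1 : 1 + - 4^-1 <= expR (- 4^-1) :> R by exact: expR_ge1Dx.
    have e2 : expR (- 4^-1) * expR (4^-1) = 1 :> R by rewrite -expRD addNr expR0.
    have e3 := @expR_gt0 R 4^-1.
    rewrite -[leLHS]expRK ler_ln ?posrE//; last by rewrite divr_gt0//; lra.
    by rewrite ler_pdivlMr; nra.
  have : c * (1 - v0) <= c by nra.
  lra.
have : expR (- 1) <= v0.
  by rewrite ler_expR lerN2; have := mulr_ge0 (ltW g0) y0; move: x1; rewrite /x; lra.
have e1 : 1 + - 2^-1 <= expR (- 2^-1) :> R by exact: expR_ge1Dx.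
have e2 : expR (- 1) = expR (- 2^-1) * expR (- 2^-1) :> R by rewrite -expRD; congr expR; lra.
have e4 : 4^-1 <= expR (- 1) :> R by rewrite e2; nra.
move=> ev0; have : c * (1 - v0) <= c * (3 / 4) by rewrite ler_wpM2l//; lra.
lra.
Qed.

End chain_cost.

Lemma continuous_dotp (R : realType) (T : topologicalType) d (F : T -> 'rV[R]_d) (w : 'rV[R]_d) :
  continuous F -> continuous (fun t => dotp (F t) w).
Proof.
move=> cF t; apply: cvg_big => //; first exact: add_continuous.
move=> i _; apply: cvgMr_tmp.
apply: (@continuous_comp _ _ _ F (fun M : 'rV[R]_d => M 0 i)); first exact: cF.
exact: coord_continuous.
Qed.

(** * Hazard rates along a ray *)

Section segment_definitions.
Variables (R : realType) (d : nat) (L M : R).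
Implicit Types (A : 'M[R]_d) (u : 'rV[R]_d) (b : bool).

(** The threshold of [radial_slope]. *)
Definition split_radius : R := 8 * M + 10.

Definition split_ratio u : R :=
  if enorm u <= split_radius then 1 else split_radius / enorm u.

(* The ray [0, u] is cut into a segment (b = false) on which the potential may
   decrease at rate at most M * enorm u, and one (b = true) on which it grows at
   rate at least enorm u / 8; the drifts make both hazard rates nonnegative. *)
Definition seg_start b u : R := if b then split_ratio u else 0.
Definition seg_length b u : R := if b then 1 - split_ratio u else split_ratio u.
Definition seg_drift b u : R := if b then - (enorm u / 8) else M * enorm u.
Definition seg_pos b u t : R := seg_start b u + seg_length b u * t.

(* The summand t makes the rate strictly increasing along the segment. *)
Definition hazard_rate b u (slope t : R) : R := seg_length b u * (slope + seg_drift b u) + t.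

(** One M|u| bounds the slope at 0 and the other the drift; smoothness adds at most L |uA|^2 to the
    slope along the ray, and the summand t at most 1. *)
Definition rate_bound A u : R := 2 * M * enorm u + L * enorm (u *m A) ^+ 2 + 1.

End segment_definitions.

Section segment_bounds.
Variables (R : realType) (d : nat) (M : R).
Hypothesis M0 : 0 < M.
Implicit Type u : 'rV[R]_d.
Local Notation split_ratio := (split_ratio M).
Local Notation seg_length := (seg_length M).

Lemma split_radius_gt0 : 0 < split_radius M.
Proof. by rewrite addr_gt0 ?mulr_gt0. Qed.

Lemma split_ratio_itv u : 0 < split_ratio u <= 1.
Proof.
rewrite /split_ratio; case: ifPn => [_|]; first by rewrite ltr01 lexx.
rewrite -ltNge => H; have r0 := split_radius_gt0.
have n0 : 0 < enorm u by exact: lt_trans r0 H.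
by rewrite divr_gt0//= ler_pdivrMr// mul1r ltW.
Qed.

Lemma seg_length_itv b u : 0 <= seg_length b u <= 1.
Proof. by have := split_ratio_itv u; rewrite /seg_length; case: b; lra. Qed.

End segment_bounds.

Section rates.
Variables (R : realType) (d : nat) (f : 'rV[R]_d -> R) (c : 'rV[R]_d) (A : 'M[R]_d) (M : R).
Variables (b : bool) (u : 'rV[R]_d).
Local Notation h u := (f (c + u *m A)).
Local Notation p0 := (seg_start M b u).
Local Notation q := (seg_length M b u).
Local Notation e := (seg_drift M b u).
Local Notation pos := (seg_pos M b u).

Definition rate t := hazard_rate M b u (dotp (frame_grad f c A (pos t *: u)) u) t.

(** An antiderivative of [rate]; it enters through the subgradient inequality [potential_lower]
    instead of a derivative. *)
Definition potential t := h (pos t *: u) + q * e * t + t ^+ 2 / 2.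

(* The thinning lemmas explore [0, 1] with a decreasing rate. *)
Definition back_rate s := rate (1 - s).
Definition back_potential s := - potential (1 - s).

Definition hazard := back_potential 1 - back_potential 0.

Lemma hazardE : hazard = h ((p0 + q) *: u) - h (p0 *: u) + q * e + 2^-1.
Proof.
rewrite /hazard /back_potential /potential subrr subr0 /seg_pos !mulr0 !mulr1 !addr0.
by rewrite expr1n expr0n/=; lra.
Qed.

End rates.

Section segments.
Variables (R : realType) (d : nat) (L mu : R) (f : 'rV[R]_d -> R).
Hypotheses (mu0 : 0 < mu) (muL : mu <= L) (fC : Cclass L mu f).
Variables (xs c : 'rV[R]_d) (A : 'M[R]_d) (eps M : R).
Hypothesis fmin : forall x, f xs <= f x.
Hypothesis fball : forall x, enorm (x - xs) ^+ 2 <= 2 / L -> f x <= f xs + 1.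
Hypothesis loc : localized f xs c A.
Hypotheses (M0 : 0 < M).
Hypothesis testM : forall i, (i <= d)%N -> enorm (frame_grad f c A (test_point d eps i)) <= M.
Local Notation h u := (f (c + u *m A)).
Local Notation gradh := (frame_grad f c A).
Variables (b : bool) (u : 'rV[R]_d).
Local Notation p0 := (seg_start M b u).
Local Notation q := (seg_length M b u).
Local Notation e := (seg_drift M b u).
Local Notation pos := (seg_pos M b u).
Local Notation rate := (rate f c A M b u).
Local Notation potential := (potential f c A M b u).
Local Notation hazard := (hazard f c A M b u).
Local Notation back_rate := (back_rate f c A M b u).
Local Notation back_potential := (back_potential f c A M b u).

Let L0 : 0 < L. Proof. exact: lt_le_trans muL. Qed.

Lemma slope_pos s : dotp (gradh (s *: u)) u = dotp (grad f (c + s *: (u *m A))) (u *m A).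
Proof. by rewrite /frame_grad dotp_mulmx trmxK -scalemxAl. Qed.

Lemma continuous_rate : continuous rate.
Proof.
have cg : continuous (grad f) by case: fC => -[].
have cF : continuous (fun t => grad f (c + pos t *: (u *m A))).
  move=> t; apply: (@continuous_comp _ _ _ (fun t => c + pos t *: (u *m A)) (grad f)); last exact: cg.
  apply: cvgD; first exact: cvg_cst.
  apply: cvgZr_tmp; apply: cvgD; first exact: cvg_cst.
  by apply: cvgMl_tmp; exact: cvg_id.
have cD := continuous_dotp (w := u *m A) cF.
move=> t; rewrite /rate /hazard_rate; apply: cvgD; last exact: cvg_id.
apply: cvgMl_tmp; apply: cvgD; last exact: cvg_cst.
by under eq_fun do rewrite slope_pos; rewrite slope_pos; exact: cD.
Qed.

Lemma slope_mono s t : s <= t -> dotp (gradh (s *: u)) u <= dotp (gradh (t *: u)) u.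
Proof.
move=> st; have [->//|st'] := eqVneq s t.
have := frame_monotone mu0 fC c A (t *: u) (s *: u).
rewrite -scalerBl dotpZr dotpDl dotpNl pmulr_rge0 ?subr_ge0//.
by rewrite subr_gt0 lt_neqAle st' st.
Qed.

Lemma slope_lipschitz s t : s <= t ->
  dotp (gradh (t *: u)) u - dotp (gradh (s *: u)) u <= L * enorm (u *m A) ^+ 2 * (t - s).
Proof.
move=> st; have [->|st'] := eqVneq s t; first by rewrite !subrr mulr0.
have := frame_lipschitz fC c A (t *: u) (s *: u).
have ts : 0 < t - s by rewrite subr_gt0 lt_neqAle st' st.
rewrite -scalerBl dotpZr dotpDl dotpNl -scalemxAl enormZ exprMn real_normK ?num_real//.
set D := dotp _ u - _; move: (enorm _ ^+ 2) => E H.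
by rewrite -(ler_pM2l ts); apply: le_trans H _; lra.
Qed.

Lemma rate_incr s t : s <= t -> rate s + (t - s) <= rate t.
Proof.
move=> st; have /andP[q0 _] := seg_length_itv M0 b u.
have pst : pos s <= pos t by rewrite lerD2l ler_wpM2l.
have := ler_wpM2l q0 (slope_mono pst).
rewrite !/(rate _) /hazard_rate.
move: (dotp (gradh (pos s *: u)) u) (dotp (gradh (pos t *: u)) u) => S S' H.
lra.
Qed.

Lemma potential_lower s t : potential s + rate s * (t - s) <= potential t.
Proof.
have := frame_lower mu0 fC c A (pos t *: u) (pos s *: u).
have -> : pos t *: u - pos s *: u = (q * (t - s)) *: u.
  by rewrite -scalerBl; congr (_ *: _); rewrite /seg_pos; ring.
rewrite dotpZr; set D := dotp _ _ => H.
have := sqr_ge0 (t - s); rewrite /rate /hazard_rate /potential -/D; lra.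
Qed.

(** By monotonicity the left end decides. On the first segment the slope is at least -M|u|; the
    second, unless it has length 0, starts at distance [split_radius], where [radial_slope]
    applies. *)
Lemma rate0_ge0 : 0 <= rate 0.
Proof.
rewrite /rate /hazard_rate addr0 /seg_pos mulr0 addr0.
have /andP[q0 _] := seg_length_itv M0 b u; have [->|qn0] := eqVneq q 0; first by rewrite mul0r.
rewrite mulr_ge0//; move: qn0; rewrite /seg_length /seg_start /seg_drift; case: b.
  rewrite /split_ratio; case: ifPn => [_|]; first by rewrite subrr eqxx.
  rewrite -ltNge => H _; have R0 := split_radius_gt0 M0.
  have n0 : 0 < enorm u by exact: lt_trans H.
  have r0 : 0 < split_radius M / enorm u by rewrite divr_gt0.
  rewrite subr_ge0; apply: (radial_slope mu0 muL fC fmin fball loc testM) => //.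
  by rewrite divfK ?gt_eqF.
move=> _; rewrite scale0r; have := dotp_le_enorm (gradh 0) u.
have := gradh0_le testM; have := enorm_ge0 u; rewrite ler_norml => n1 n2 /andP[n3 _].
have : enorm (gradh 0) * enorm u <= M * enorm u by rewrite ler_wpM2r.
lra.
Qed.

Lemma rate1_le : rate 1 <= rate_bound L M A u.
Proof.
have /andP[q0 q1] := seg_length_itv M0 b u.
have /andP[a0 a1] := split_ratio_itv M0 u.
have n1 := enorm_ge0 u; have Mn : 0 <= M * enorm u by rewrite mulr_ge0// ltW.
set S := L * enorm (u *m A) ^+ 2.
have S0 : 0 <= S by rewrite mulr_ge0 ?sqr_ge0// ltW.
have pos1 : 0 <= pos 1 <= 1.
  by rewrite /seg_pos mulr1 /seg_start /seg_length; case: b; lra.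
have [pos10 pos11] := andP pos1.
have sl : dotp (gradh (pos 1 *: u)) u <= M * enorm u + S.
  have := slope_lipschitz pos10; rewrite scale0r subr0 -/S => H.
  have := dotp_le_enorm (gradh 0) u; have := gradh0_le testM; rewrite ler_norml => h2 /andP[_ h3].
  have : enorm (gradh 0) * enorm u <= M * enorm u by rewrite ler_wpM2r.
  have : S * pos 1 <= S by rewrite ler_piMr.
  move: H h2 h3; move: (dotp _ u) (dotp _ u) (S * pos 1) => x y z; lra.
have el : e <= M * enorm u by rewrite /seg_drift; case: b => //; lra.
rewrite /rate /hazard_rate /rate_bound -/S lerD2r.
apply: (@le_trans _ _ (q * (2 * M * enorm u + S))).
  by rewrite ler_wpM2l//; lra.
suff : q * (2 * M * enorm u + S) <= 2 * M * enorm u + S by [].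
by rewrite ler_piMl//; lra.
Qed.

Lemma continuous_back_rate : continuous back_rate.
Proof.
move=> s; apply: (@continuous_comp R R R (fun s => 1 - s) rate); last exact: continuous_rate.
by apply: cvgB; [exact: cvg_cst|exact: cvg_id].
Qed.

Lemma back_rate_decr s t : s <= t -> back_rate t + (t - s) <= back_rate s.
Proof.
move=> st; have st' : 1 - t <= 1 - s by lra.
by have := rate_incr st'; rewrite /back_rate; lra.
Qed.

Lemma back_potential_upper s t :
  back_potential t - back_potential s <= back_rate s * (t - s).
Proof.
have := potential_lower (1 - s) (1 - t); rewrite /back_potential /back_rate.
by rewrite (_ : 1 - t - (1 - s) = s - t); [lra|ring].
Qed.

Lemma back_rate1 : 0 <= back_rate 1.
Proof. by rewrite /back_rate subrr rate0_ge0. Qed.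

Lemma back_rate0 : back_rate 0 <= rate_bound L M A u.
Proof. by rewrite /back_rate subr0 rate1_le. Qed.

Lemma hazard_ge0 : 0 <= hazard.
Proof.
have := potential_lower 0 1; rewrite /hazard /back_potential subrr !subr0 mulr1.
by have := rate0_ge0; lra.
Qed.

End segments.

Section hazards.
Variables (R : realType) (d : nat) (f : 'rV[R]_d -> R) (c : 'rV[R]_d) (A : 'M[R]_d) (M : R).
Implicit Types u : 'rV[R]_d.

(* The total drift along the ray [0, u], corrected in the proposal. *)
Definition tilt u : R :=
  M * (split_ratio M u * enorm u) - (1 - split_ratio M u) * enorm u / 8.

(** The two increments of h telescope; the final 1 is twice the 1/2 due to the summand t of the
    rate. *)
Lemma hazard_sum u : hazard f c A M false u + hazard f c A M true u =
  f (c + u *m A) - f c + tilt u + 1.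
Proof.
rewrite !hazardE /seg_start /seg_length /seg_drift /tilt add0r scale0r mul0mx addr0.
by rewrite (addrC (split_ratio M u)) subrK scale1r; field.
Qed.

Lemma split_ratio_norm u : 0 < M -> split_ratio M u * enorm u <= split_radius M.
Proof.
move=> M0.
rewrite /split_ratio; case: ifPn => [|]; first by rewrite mul1r.
rewrite -ltNge => H; rewrite divfK// gt_eqF//; apply: lt_trans H.
exact: split_radius_gt0.
Qed.

(** Beyond [split_radius] the tilt decays at rate 1/8: half of it pays for the term |u|/16, which is
    the growth of the proposal weights, and the other half is kept. *)
Lemma tilt_le u : 0 < M ->
  enorm u / 16 + tilt u <= (M + 16^-1) * split_radius M - (1 - split_ratio M u) * enorm u / 16.
Proof.
move=> M0; have := split_ratio_norm u M0.
rewrite /tilt; set a := split_ratio M u * enorm u => aR.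
have : (M + 16^-1) * a <= (M + 16^-1) * split_radius M by rewrite ler_wpM2l//; lra.
have -> : (1 - split_ratio M u) * enorm u = enorm u - a by rewrite mulrBl mul1r.
lra.
Qed.

End hazards.

Lemma measurable_inv (R : realType) : measurable_fun setT (fun x : R => x^-1).
Proof.
rewrite (_ : (fun x : R => x^-1) = (fun x => x * ((x ^+ 2) `^ (-1)))).
  apply: measurable_funM => //.
  by apply: (measurableT_comp (@measurable_powR R (-1))); exact: measurable_funX.
apply/funext => x; rewrite powR_inv1 ?sqr_ge0//.
have [->|x0] := eqVneq x 0; first by rewrite mul0r invr0.
by rewrite expr2 invfM mulrA divff// mul1r.
Qed.

Section measurable_euclidean.
Variables (R : realType) (n : nat) (dT : measure_display) (T : measurableType dT).

Lemma measurable_dotp (f g : T -> 'rV[R]_n) :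
  measurable_fun setT f -> measurable_fun setT g -> measurable_fun setT (fun x => dotp (f x) (g x)).
Proof.
move=> mf mg; apply: measurable_sum => i; apply: measurable_funM.
  exact: (measurableT_comp (@measurable_coord R n i) mf).
exact: (measurableT_comp (@measurable_coord R n i) mg).
Qed.

Lemma measurable_enorm (f : T -> 'rV[R]_n) :
  measurable_fun setT f -> measurable_fun setT (fun x => enorm (f x)).
Proof.
move=> mf; apply: (measurableT_comp (continuous_measurable_fun (@sqrt_continuous R))).
exact: measurable_dotp.
Qed.

Lemma measurable_subrV (f g : T -> 'rV[R]_n) : measurable_fun setT f -> measurable_fun setT g ->
  measurable_fun setT (fun x => f x - g x).
Proof.
move=> mf mg; under eq_fun do rewrite -scaleN1r.
by apply: measurable_addrV => //; apply: measurable_scalerV => //; exact: measurable_cst.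
Qed.

End measurable_euclidean.

(** * Proposals and acceptance *)

Section mixtures.
Variable R : realType.

(** X is the chance of surviving after the present draw, v the value on restarting. The integral of
    Y may be infinite, so the subtraction is confined to 1 - X. *)
Lemma integral_mix d (T : measurableType d) (P : probability T R) (X Y : T -> R) (v x : R) :
  measurable_fun setT X -> measurable_fun setT Y ->
  (forall t, 0 <= X t <= 1) -> (forall t, 0 <= Y t) -> 0 <= v ->
  (\int[P]_t (X t)%:E = x%:E)%E ->
  (\int[P]_t (v * (1 - X t) + Y t)%:E = (v * (1 - x))%:E + \int[P]_t (Y t)%:E)%E.
Proof.
move=> mX mY X01 Y0 v0 EX.
have X0 t : 0 <= X t by case/andP: (X01 t).
have X1 t : 0 <= 1 - X t by have := X01 t; lra.
have mX1 : measurable_fun setT (fun t => (1 - X t)%:E).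
  by apply/measurable_EFinP; apply: measurable_funB => //; exact: measurable_cst.
have E1 : (\int[P]_t (1 - X t)%:E = (1 - x)%:E)%E.
  have : (\int[P]_t (1 - X t)%:E + \int[P]_t (X t)%:E = 1)%E.
    rewrite -ge0_integralD//; last 3 first.
    - by move=> t _; rewrite lee_fin.
    - by move=> t _; rewrite lee_fin.
    - exact/measurable_EFinP.
    rewrite (eq_integral (fun=> 1%E)) => [|t _]; last by rewrite -EFinD subrK.
    by rewrite integral_cst// mul1e; exact: probability_setT.
  rewrite EX; case: (\int[P]_t _)%E => [r [<-]| |]//.
  by rewrite addrK.
under eq_integral do rewrite EFinD EFinM.
rewrite ge0_integralD//; last 4 first.
- by move=> t _; rewrite mule_ge0// lee_fin.
- exact: measurable_funeM.
- by move=> t _; rewrite lee_fin.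
- exact/measurable_EFinP.
by rewrite ge0_integralZl ?E1// => t _; rewrite lee_fin.
Qed.

Lemma integral_addc d (T : measurableType d) (P : probability T R) (Y : T -> R) (a : R) :
  measurable_fun setT Y -> (forall t, 0 <= Y t) -> 0 <= a ->
  (\int[P]_t (a + Y t)%:E = a%:E + \int[P]_t (Y t)%:E)%E.
Proof.
move=> mY Y0 a0; pose X (t : T) : R := 0.
transitivity (\int[P]_t (a * (1 - X t) + Y t)%:E)%E.
  by apply: eq_integral => t _; rewrite /X subr0 mulr1.
rewrite (@integral_mix _ _ P X Y a 0) ?subr0 ?mulr1//.
- exact: measurable_cst.
- by move=> t; rewrite lexx ler01.
- by rewrite integral0.
Qed.

Lemma integral_le_cst d (T : measurableType d) (P : probability T R) (Y : T -> R) (a : R) :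
  measurable_fun setT Y -> (forall t, 0 <= Y t <= a) -> (\int[P]_t (Y t)%:E <= a%:E)%E.
Proof.
move=> mY Ya; apply: (@le_trans _ _ (\int[P]_t a%:E)%E).
  apply: ge0_le_integral => //; first by move=> t _; rewrite lee_fin; case/andP: (Ya t).
    exact/measurable_EFinP.
  by move=> t _; rewrite lee_fin; case/andP: (Ya t).
rewrite le_eqVlt; apply/orP; left; apply/eqP; apply: (etrans (integral_cst P measurableT _)).
by transitivity (a%:E * 1)%E; [congr (_ * _)%E; exact: probability_setT|exact: mule1].
Qed.

Lemma integral_coin (x y c : R) : 0 <= x -> 0 <= y -> 0 <= c <= 1 ->
  (\int[coinP R]_o (if unif R o < c then x else y)%:E = (x * c + y * (1 - c))%:E)%E.
Proof.
move=> x0 y0 c01.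
pose X (o : coin) : R := (c <= unif R o)%R%:R.
have mX : measurable_fun setT X.
  apply: (@measurableT_comp _ _ _ _ _ _ (fun b : bool => b%:R : R)) => //.
  by apply: measurable_fun_ler; [exact: measurable_cst|exact: measurable_unif].
have EX : (\int[coinP R]_o (X o)%:E = (1 - c)%:E)%E.
  rewrite (integral_unif (phi := fun u => ((c <= u)%R%:R)%:E)).
  - under eq_integral do rewrite -[_%:R]mul1r -[_ * _]add0r.
    by rewrite integral_threshold// add0r mul1r.
  - apply/measurable_EFinP.
    apply: (@measurableT_comp _ _ _ _ _ _ (fun b : bool => b%:R : R)) => //.
    by apply: measurable_fun_ler; [exact: measurable_cst|exact: measurable_id].
  - by move=> u; rewrite lee_fin.
have EY : (\int[coinP R]_o (y * X o)%:E = (y * (1 - c))%:E)%E.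
  under eq_integral do rewrite EFinM.
  by rewrite ge0_integralZl ?EX//; [exact/measurable_EFinP|move=> o _; rewrite lee_fin].
rewrite EFinD -EY -[X in x * X](subKr 1).
rewrite -(@integral_mix _ _ (coinP R) X (fun o => y * X o) x (1 - c))//.
- apply: eq_integral => o _; congr (_%:E); rewrite /X leNgt.
  by case: (unif R o < c) => /=; rewrite ?subr0 ?mulr1 ?mulr0 ?addr0// subrr mulr0 add0r.
- by apply: measurable_funM => //; exact: measurable_cst.
- by move=> o; rewrite /X; case: (c <= _); rewrite ?ler01 ?lexx.
- by move=> o; rewrite mulr_ge0.
Qed.

Lemma integral_thinned (F rho : coin -> R) (v : R) :
  measurable_fun setT F -> measurable_fun setT rho ->
  (forall o, 0 <= F o) -> (forall o, 0 <= rho o <= 1) -> 0 <= v ->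
  (\int[coinP R]_o (if unif R (unzip o).2 < rho (unzip o).1 then F (unzip o).1 else v)%:E =
   \int[coinP R]_a (v * (1 - rho a) + rho a * F a)%:E)%E.
Proof.
move=> mF mrho F0 rho01 v0.
rewrite (integral_unzip (phi := fun p => (if unif R p.2 < rho p.1 then F p.1 else v)%:E)).
- apply: eq_integral => a _; rewrite /= integral_coin//; congr (_%:E); ring.
- apply/measurable_EFinP; apply: measurable_fun_ifT.
  + apply: measurable_fun_ltr; first exact: (measurableT_comp (@measurable_unif R) measurable_snd).
    exact: (measurableT_comp mrho measurable_fst).
  + exact: (measurableT_comp mF measurable_fst).
  + exact: measurable_cst.
- by move=> p; rewrite lee_fin; case: ifP.
Qed.

End mixtures.

Section proposal.
Variables (R : realType) (d : nat) (M : R).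
Hypotheses (d0 : (0 < d)%N) (M0 : 0 < M).

(** Makes the weight bound exp (2 sum |x_i| + 2d) at most exp (|u|/16 + 2d) at u = 32 d x, since
    every |x_i| is at most |u| / (32 d). *)
Definition proposal_scale : R := 32 * d%:R.

Definition proposal (o : coin) : 'rV[R]_d := proposal_scale *: rV_point R d o.

Definition proposal_ceiling : R := expR (2 * d%:R + (M + 16^-1) * split_radius M).

(** The weight converts the law of the point into Lebesgue measure, the exponential cancels the
    drifts of the thinning, and the ceiling makes the product a probability. *)
Definition proposal_rate (o : coin) : R :=
  rV_weight R d o * expR (tilt M (proposal o)) / proposal_ceiling.

Lemma measurable_proposal : measurable_fun setT proposal.
Proof.
by apply: measurable_scalerV; [exact: measurable_cst|exact: measurable_rV_point].
Qed.

Lemma measurable_tilt : measurable_fun setT (tilt M : 'rV[R]_d -> R).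
Proof.
have mn : measurable_fun setT (fun u : 'rV[R]_d => enorm u).
  by apply: measurable_enorm; exact: measurable_id.
have ms : measurable_fun setT (split_ratio M : 'rV[R]_d -> R).
  apply: measurable_fun_ifT.
  - by apply: measurable_fun_ler => //; exact: measurable_cst.
  - exact: measurable_cst.
  - apply: measurable_funM; first exact: measurable_cst.
    exact: (measurableT_comp (@measurable_inv R) mn).
apply: measurable_funB; first by apply: measurable_funM; [exact: measurable_cst|exact: measurable_funM].
apply: measurable_funM; last exact: measurable_cst.
by apply: measurable_funM => //; apply: measurable_funB => //; exact: measurable_cst.
Qed.

Lemma measurable_proposal_rate : measurable_fun setT proposal_rate.
Proof.
apply: measurable_funM; last exact: measurable_cst.
apply: measurable_funM; first exact: measurable_rV_weight.
apply: (measurableT_comp (@measurable_expR R)); apply: (measurableT_comp measurable_tilt).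
exact: measurable_proposal.
Qed.

Lemma scale_gt0 : 0 < proposal_scale.
Proof. by rewrite mulr_gt0// ltr0n. Qed.

Lemma proposal_rate_le o : 0 <= proposal_rate o <=
  expR (- ((1 - split_ratio M (proposal o)) * enorm (proposal o) / 16)).
Proof.
have /andP[w0 w1] := rV_weight_bound R d o.
rewrite divr_ge0 ?mulr_ge0 ?expR_ge0//= ler_pdivrMr ?expR_gt0//.
apply: le_trans (ler_wpM2r (expR_ge0 _) w1) _.
rewrite -!expRD ler_expR.
have dp : 0 < d%:R :> R by rewrite ltr0n.
have S : 2 * (\sum_i `|rV_point R d o 0 i|) <= enorm (proposal o) / 16.
  have : \sum_i `|rV_point R d o 0 i| <= \sum_(i < d) enorm (proposal o) / proposal_scale.
    apply: ler_sum => i _; rewrite ler_pdivlMr ?scale_gt0//.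
    by have := enorm_coord (proposal o) i; rewrite mxE normrM gtr0_norm ?scale_gt0// mulrC.
  rewrite sumr_const card_ord -[leRHS]mulr_natr.
  have -> : enorm (proposal o) / proposal_scale * d%:R = enorm (proposal o) / 32.
    by rewrite /proposal_scale; field; rewrite gt_eqF.
  lra.
have := tilt_le (proposal o) M0; lra.
Qed.

Lemma proposal_rate01 o : 0 <= proposal_rate o <= 1.
Proof.
have /andP[-> H] := proposal_rate_le o; apply: le_trans H _.
rewrite -[leRHS]expR0 ler_expR oppr_le0 divr_ge0// mulr_ge0 ?enorm_ge0//.
by have := split_ratio_itv M0 (proposal o); lra.
Qed.

(** The part of the ray within [split_radius] is bounded outright; for the length z beyond it, z exp
    (-z/16) <= 16. Thinning costs grow linearly in |u|, so this bounds their mean. *)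
Lemma proposal_rate_norm o : proposal_rate o * enorm (proposal o) <= split_radius M + 16.
Proof.
have /andP[r0 r1] := proposal_rate_le o; have /andP[_ r2] := proposal_rate01 o.
set u := proposal o in r1 *; set r := proposal_rate o in r0 r1 r2 *.
have aR := split_ratio_norm u M0.
pose z := (1 - split_ratio M u) * enorm u.
have z0 : 0 <= z by rewrite mulr_ge0 ?enorm_ge0//; have := split_ratio_itv M0 u; lra.
have -> : enorm u = split_ratio M u * enorm u + z by rewrite /z; ring.
have E1 : expR (- (z / 16)) * expR (z / 16) = 1 by rewrite -expRD addNr expR0.
have E2 := expR_ge1Dx (z / 16); have E3 := expR_gt0 (- (z / 16)).
have H1 : r * z <= 16.
  apply: (@le_trans _ _ (expR (- (z / 16)) * z)); first by rewrite ler_wpM2r.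
  apply: (@le_trans _ _ (expR (- (z / 16)) * (16 * expR (z / 16)))).
    by rewrite ler_wpM2l ?(ltW E3)//; lra.
  by rewrite mulrCA E1 mulr1.
rewrite mulrDr lerD//.
apply: le_trans aR; rewrite ler_piMl// mulr_ge0 ?enorm_ge0//.
by have := split_ratio_itv M0 u; lra.
Qed.

End proposal.

(** * Law and probability of an accepted proposal *)

Section acceptance.
Variables (R : realType) (d : nat) (L mu : R) (f : 'rV[R]_d -> R).
Hypotheses (d0 : (0 < d)%N) (mu0 : 0 < mu) (muL : mu <= L) (fC : Cclass L mu f).
Variables (xs c : 'rV[R]_d) (A : 'M[R]_d) (eps M : R).
Hypothesis fmin : forall x, f xs <= f x.
Hypothesis fball : forall x, enorm (x - xs) ^+ 2 <= 2 / L -> f x <= f xs + 1.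
Hypothesis loc : localized f xs c A.
Hypotheses (eps0 : 0 < eps) (M0 : 0 < M) (epsM : eps * M = 1).
Hypothesis testM : forall i, (i <= d)%N -> enorm (frame_grad f c A (test_point d eps i)) <= M.
Local Notation prop := (@proposal R d).
Local Notation rho := (@proposal_rate R d M).
Local Notation h u := (f (c + u *m A)).

(* The probability that neither segment of the ray carries a point. *)
Definition acceptance (u : 'rV[R]_d) : R :=
  expR (- hazard f c A M false u) * expR (- hazard f c A M true u).

Lemma acceptance01 u : 0 <= acceptance u <= 1.
Proof.
have H b := hazard_ge0 mu0 muL fC fmin fball loc M0 testM b u.
rewrite mulr_ge0 ?expR_ge0// mulr_ile1 ?expR_ge0// -expR0 ler_expR oppr_le0//.
Qed.

Lemma measurable_potential : measurable_fun setT f.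
Proof.
case: fC => -[df _] _ _; apply: continuous_measurable_rV => x.
exact: differentiable_continuous.
Qed.

Lemma measurable_mulmx_cst dT (T : measurableType dT) (g : T -> 'rV[R]_d) (B : 'M[R]_d) :
  measurable_fun setT g -> measurable_fun setT (fun x => g x *m B).
Proof. by move=> mg; apply: measurable_mulmx => // i j; exact: measurable_cst. Qed.

Lemma measurable_acceptance : measurable_fun setT acceptance.
Proof.
rewrite (_ : acceptance = (fun u => expR (- (h u - f c + tilt M u + 1)))).
  apply: (measurableT_comp (@measurable_expR R)); apply: measurableT_comp => //.
  apply: measurable_funD; last exact: measurable_cst.
  apply: measurable_funD; last exact: measurable_tilt.
  apply: measurable_funB; last exact: measurable_cst.
  apply: (measurableT_comp measurable_potential).
  by apply: measurable_addrV; [exact: measurable_cst|exact: measurable_mulmx_cst].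
by apply/funext => u; rewrite /acceptance -expRD -opprD hazard_sum.
Qed.

(** The tilt cancels, so the density of accepted points against Lebesgue measure is a constant times
    exp (-h). *)
Lemma rate_acceptance o : rho o * acceptance (prop o) =
  rV_weight R d o * (expR (- 1) / proposal_ceiling d M * expR (f c - h (prop o))).
Proof.
rewrite /acceptance -expRD -opprD hazard_sum /proposal_rate.
have -> : - (h (prop o) - f c + tilt M (prop o) + 1) =
  - tilt M (prop o) + - 1 + (f c - h (prop o)) by ring.
have E3 (p q r : R) : expR (p + q + r) = expR p * expR q * expR r by rewrite !expRD.
rewrite E3.
have : expR (tilt M (prop o)) * expR (- tilt M (prop o)) = 1 by rewrite -expRD subrr expR0.
move: (expR (tilt M _)) (expR (- tilt M _)) => x y xy.
transitivity (x * y * (rV_weight R d o * (expR (- 1) / proposal_ceiling d M * expR (f c - h (prop o))))).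
  by ring.
by rewrite xy mul1r.
Qed.

Lemma frame_scale_unit : proposal_scale R d *: A \in unitmx.
Proof.
rewrite unitmxZ ?(localized_unitmx mu0 muL fball loc)//.
by rewrite unitfE gt_eqF// scale_gt0.
Qed.

(** The constant [kap] collects the scaling of the proposals, the linear change of variables and exp
    (f c); being the same for all B, it cancels on normalising. *)
Lemma acceptance_integral : exists2 kap : R, 0 < kap & forall B, measurable B ->
  (\int[coinP R]_o (rho o * acceptance (prop o) * \1_B (c + prop o *m A))%:E =
   kap%:E * \int[lebesgue_rV R d]_(x in B) (expR (- f x))%:E)%E.
Proof.
have [k k0 kE] := integral_linear frame_scale_unit.
pose C0 := expR (- 1) / proposal_ceiling d M * expR (f c).
have C00 : 0 < C0 by rewrite !mulr_gt0 ?expR_gt0// invr_gt0 expR_gt0.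
exists (C0 * k); first by rewrite mulr_gt0.
move=> B mB; pose phi x : \bar R := (C0 * (expR (- f (c + x)) * \1_B (c + x)))%:E.
have maddc : measurable_fun setT (fun x : 'rV[R]_d => c + x).
  by apply: measurable_addrV; [exact: measurable_cst|exact: measurable_id].
have mpsi : measurable_fun setT (fun x => (expR (- f x) * \1_B x)%:E : \bar R).
  apply/measurable_EFinP; apply: measurable_funM; last exact: measurable_indic.
  apply: (measurableT_comp (@measurable_expR R)); apply: measurableT_comp => //.
  exact: measurable_potential.
have mphi1 : measurable_fun setT (fun x => (expR (- f (c + x)) * \1_B (c + x))%:E : \bar R).
  exact: (measurableT_comp mpsi maddc).
have mphi : measurable_fun setT phi.
  rewrite /phi; under eq_fun do rewrite EFinM; exact: measurable_funeM.
have phi0 x : (0 <= phi x)%E by rewrite lee_fin (mulr_ge0 (ltW C00))// mulr_ge0 ?expR_ge0.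
transitivity (\int[lebesgue_rV R d]_x phi (x *m (proposal_scale R d *: A)))%E.
  rewrite -integral_rV_point.
  - apply: eq_integral => o _; rewrite -EFinM rate_acceptance; congr (_%:E).
    rewrite /prop -scalemxAl -scalemxAr -mulrA; congr (_ * _).
    by rewrite /C0 addrC expRD; ring.
  - exact: (measurableT_comp mphi (measurable_mulmx_cst _ (@measurable_id _ _ _))).
  - by move=> x.
rewrite kE// [C0 * k]mulrC EFinM -muleA; congr (_ * _)%E.
transitivity (C0%:E * \int[lebesgue_rV R d]_x (expR (- f (c + x)) * \1_B (c + x))%:E)%E.
  by rewrite -ge0_integralZl ?lee_fin ?(ltW C00).
congr (_ * _)%E.
under eq_integral do rewrite addrC.
rewrite (integral_shiftrV c (phi := fun x => (expR (- f x) * \1_B x)%:E))//.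
rewrite [RHS]integral_mkcond; apply: eq_integral => x _.
by rewrite patchE indicE; case: (x \in B); rewrite ?mulr1 ?mulr0.
Qed.

(** The contribution of the cube of [cube_potential], of side eps / d in u: one factor exp (-1)
    stems from [hazard_sum], the other from h <= h 0 + 1 there. *)
Definition acceptance_floor : R :=
  expR (- 2) / proposal_ceiling d M * ((eps / d%:R / proposal_scale R d) ^+ d).

Lemma acceptance_probability : exists2 p : R, acceptance_floor <= p &
  (\int[coinP R]_o (rho o * acceptance (prop o))%:E = p%:E)%E.
Proof.
have mra : measurable_fun setT (fun o => (rho o * acceptance (prop o))%:E : \bar R).
  apply/measurable_EFinP; apply: measurable_funM; first exact: measurable_proposal_rate.
  by apply: (measurableT_comp measurable_acceptance); exact: measurable_proposal.
have H1 : (\int[coinP R]_o (rho o * acceptance (prop o))%:E <= 1)%E.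
  apply: (@le_trans _ _ (\int[coinP R]_o 1)%E); last first.
    by rewrite integral_cst// mul1e le_eqVlt; apply/orP; left; apply/eqP; exact: probability_setT.
  apply: ge0_le_integral => //.
  - move=> o _; have /andP[r0 _] := proposal_rate01 d0 M0 o; have /andP[a0 _] := acceptance01 (prop o).
    by rewrite lee_fin mulr_ge0.
  - move=> o _; have /andP[r0 r1] := proposal_rate01 d0 M0 o; have /andP[a0 a1] := acceptance01 (prop o).
    by rewrite lee_fin mulr_ile1.
set box := rbox 0 (eps / d%:R / proposal_scale R d) : set 'rV[R]_d.
have dp : 0 < d%:R :> R by rewrite ltr0n.
have sp := @scale_gt0 R d d0.
have mbox : measurable box by exact: measurable_rbox.
pose C1 := expR (- 1) / proposal_ceiling d M.
have C10 : 0 < C1 by rewrite mulr_gt0 ?expR_gt0// invr_gt0 expR_gt0.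
have H2 : (acceptance_floor%:E <= \int[coinP R]_o (rho o * acceptance (prop o))%:E)%E.
  pose phi (x : 'rV[R]_d) : \bar R := (C1 * expR (f c - h (proposal_scale R d *: x)))%:E.
  have mphi : measurable_fun setT phi.
    apply/measurable_EFinP; apply: measurable_funM; first exact: measurable_cst.
    apply: (measurableT_comp (@measurable_expR R)); apply: measurable_funB; first exact: measurable_cst.
    apply: (measurableT_comp measurable_potential).
    apply: measurable_addrV; first exact: measurable_cst.
    apply: measurable_mulmx_cst; apply: measurable_scalerV; [exact: measurable_cst|exact: measurable_id].
  have phi0 x : (0 <= phi x)%E by rewrite lee_fin mulr_ge0 ?expR_ge0 ?(ltW C10).
  have -> : (\int[coinP R]_o (rho o * acceptance (prop o))%:E = \int[lebesgue_rV R d]_x phi x)%E.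
    rewrite -integral_rV_point//; apply: eq_integral => o _.
    by rewrite -EFinM rate_acceptance.
  apply: (@le_trans _ _ (\int[lebesgue_rV R d]_(x in box) (C1 * expR (- 1))%:E)%E).
    have -> : (\int[lebesgue_rV R d]_(x in box) (C1 * expR (- 1))%:E =
        (C1 * expR (- 1))%:E * ((eps / d%:R / proposal_scale R d - 0) ^+ d)%:E)%E.
      apply: (etrans (integral_cst _ mbox _)); congr (_ * _)%E.
      by apply: lebesgue_rbox; rewrite !divr_ge0// ltW.
    rewrite subr0 -EFinM lee_fin /acceptance_floor -/C1 /C1.
    have -> : expR (- 2) = expR (- 1) * expR (- 1) :> R by rewrite -expRD; congr expR; lra.
    by rewrite le_eqVlt; apply/orP; left; apply/eqP; ring.
  apply: (@le_trans _ _ (\int[lebesgue_rV R d]_(x in box) phi x)%E); last first.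
    exact: ge0_subset_integral.
  apply: ge0_le_integral => //.
  - by move=> x _; rewrite lee_fin mulr_ge0 ?expR_ge0 ?(ltW C10).
  - exact: measurable_funTS.
  - move=> x xbox; rewrite lee_fin ler_pM2l// ler_expR.
    have := cube_potential mu0 fC eps0 epsM testM (u := proposal_scale R d *: x) d0.
    rewrite mul0mx addr0 => /(_ _)/[!lerBrDr] Hc.
    suff : h (proposal_scale R d *: x) <= f c + 1 by lra.
    apply: Hc => i; rewrite mxE; have /andP[x0 x1] := xbox i.
    by rewrite mulr_ge0 ?(ltW sp)//= mulrC -ler_pdivlMr.
move: H1 H2; case: (\int[coinP R]_o _)%E => [p| |]//= _.
by rewrite lee_fin => Hp; exists p.
Qed.

Lemma acceptance_floor_gt0 : 0 < acceptance_floor.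
Proof.
have dp : 0 < d%:R :> R by rewrite ltr0n.
by rewrite mulr_gt0 ?exprn_gt0 ?divr_gt0 ?expR_gt0 ?scale_gt0.
Qed.

End acceptance.

(** * The sampler *)

Section sampler.
Variables (R : realType) (d : nat) (L : R).

(** The three constants satisfy 4 d tau^2 = tau/2, so that a cut lowers the log-volume by at least
    tau/2; 1/M + eps = tau, so that a cut is admissible at every test point; and eps M = 1 for
    [cube_potential]. *)
Definition cut_depth : R := (8 * d%:R)^-1.
Definition test_level : R := 16 * d%:R.
Definition test_step : R := (16 * d%:R)^-1.

Local Notation tau := cut_depth.
Local Notation M := test_level.
Local Notation eps := test_step.

(* Modes 0, ..., d test the current ellipsoid at d + 1 points, mode d + 1 draws
   a proposal, modes d + 2 and d + 3 thin the two segments of its ray, and the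
   machine is halted in the higher modes. *)
Definition sampler_state : Type :=
  (nat * (('rV[R]_d * 'rV[R]_(d * d)) * ('rV[R]_d * (R * R))))%type.

HB.instance Definition _ := Measurable.on sampler_state.

Implicit Types (z : sampler_state) (c u : 'rV[R]_d) (A : 'M[R]_d).

(** The frame is stored flattened, row vectors being the type that carries the sigma-algebra. *)
Definition mk_state m c A u (y g : R) : sampler_state := (m, ((c, mxvec A), (u, (y, g)))).
Definition mode z : nat := z.1.
Definition centre z : 'rV[R]_d := z.2.1.1.
Definition frame z : 'M[R]_d := vec_mx z.2.1.2.
Definition ray z : 'rV[R]_d := z.2.2.1.
Definition lvl z : R := z.2.2.2.1.
Definition gap z : R := z.2.2.2.2.

(** The position 1 - gap reflects the reversal in [back_rate]; mode d + 3 thins the outer segment.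
    The reply in mode d + 1 is ignored. *)
Definition sampler_ask z : 'rV[R]_d :=
  centre z + (if (mode z <= d)%N then test_point d eps (mode z)
     else seg_pos M (mode z == d.+3) (ray z) (1 - gap z) *: ray z) *m frame z.

Definition test_next z (G : 'rV[R]_d) : sampler_state :=
  if enorm G <= M then mk_state (mode z).+1 (centre z) (frame z) (ray z) (lvl z) (gap z)
  else let gh := (enorm G)^-1 *: G in
    mk_state 0 (centre z - tau *: (gh *m frame z)) (cut_mx tau gh *m frame z)
      (ray z) (lvl z) (gap z).

Definition draw_next z (o : coin) : sampler_state :=
  if unif R (unzip o).2 < @proposal_rate R d M (unzip o).1
  then mk_state d.+2 (centre z) (frame z) (@proposal R d (unzip o).1) 0 1 else z.

(** The pair (gap, lvl) is the candidate drawn in the previous step, judged by the present reply;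
    gap 1 marks the start of a segment, when there is no candidate yet. A candidate under the graph
    rejects the proposal, and a level above the rate bound ends the segment. *)
Definition thin_next z (G : 'rV[R]_d) (o : coin) : sampler_state :=
  if (gap z < 1) && (lvl z < hazard_rate M (mode z == d.+3) (ray z) (dotp G (ray z)) (1 - gap z))
  then mk_state d.+1 (centre z) (frame z) (ray z) (lvl z) (gap z)
  else if rate_bound L M (frame z) (ray z) <= lvl z
  then mk_state (mode z).+1 (centre z) (frame z) (ray z) 0 1
  else mk_state (mode z) (centre z) (frame z) (ray z)
    (level (lvl z) (gap z) (unif R (unzip o).1)) (gap z * unif R (unzip o).2).

Definition sampler_next (p : (sampler_state * 'rV[R]_d) * coin) : sampler_state :=
  let z := p.1.1 in let G := p.1.2 *m (frame z)^T in
  if (mode z <= d)%N then test_next z G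
  else if (mode z <= d.+1)%N then draw_next z p.2
  else if (mode z <= d.+3)%N then thin_next z G p.2 else z.

Definition halted z : bool := (d.+3 < mode z)%N.

Definition sample z : 'rV[R]_d := centre z + ray z *m frame z.

(** * Measurability of the sampler *)

Section measurability.
Variables (dT : measure_display) (T : measurableType dT).

Lemma measurable_mk_state (m : T -> nat) (c : T -> 'rV[R]_d) (A : T -> 'M[R]_d)
    (u : T -> 'rV[R]_d) (y g : T -> R) :
  measurable_fun setT m -> measurable_fun setT c ->
  (forall i j, measurable_fun setT (fun t => A t i j)) -> measurable_fun setT u ->
  measurable_fun setT y -> measurable_fun setT g ->
  measurable_fun setT (fun t => mk_state (m t) (c t) (A t) (u t) (y t) (g t)).
Proof.
move=> mm mc mA mu my mg.
apply/measurable_fun_pair => //; apply/measurable_fun_pair; apply/measurable_fun_pair => //.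
  apply: measurable_fun_rV => k; case/mxvec_indexP: k => i j.
  rewrite (_ : (fun t => _) = (fun t => A t i j)); first exact: mA.
  by apply/funext => t; rewrite mxvecE.
by apply/measurable_fun_pair.
Qed.

Variable z : T -> sampler_state.
Hypothesis mz : measurable_fun setT z.

Let mz1 : measurable_fun setT (fun t => (z t).2.1).
Proof. by apply: (measurableT_comp measurable_fst); exact: (measurableT_comp measurable_snd). Qed.

Let mz2 : measurable_fun setT (fun t => (z t).2.2).
Proof. by apply: (measurableT_comp measurable_snd); exact: (measurableT_comp measurable_snd). Qed.

Lemma measurable_mode : measurable_fun setT (fun t => mode (z t)).
Proof. exact: (measurableT_comp measurable_fst). Qed.

Lemma measurable_centre : measurable_fun setT (fun t => centre (z t)).
Proof. exact: (measurableT_comp measurable_fst). Qed.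

Lemma measurable_frame i j : measurable_fun setT (fun t => frame (z t) i j).
Proof.
under eq_fun do rewrite mxE.
apply: (measurableT_comp (@measurable_coord R (d * d) (mxvec_index i j))).
exact: (measurableT_comp measurable_snd).
Qed.

Lemma measurable_ray : measurable_fun setT (fun t => ray (z t)).
Proof. exact: (measurableT_comp measurable_fst). Qed.

Lemma measurable_lvl : measurable_fun setT (fun t => lvl (z t)).
Proof. by apply: (measurableT_comp measurable_fst); exact: (measurableT_comp measurable_snd). Qed.

Lemma measurable_gap : measurable_fun setT (fun t => gap (z t)).
Proof. by apply: (measurableT_comp measurable_snd); exact: (measurableT_comp measurable_snd). Qed.

Lemma measurable_mode_test (P : nat -> bool) : measurable_fun setT (fun t => P (mode (z t))).
Proof. by apply: (@measurableT_comp _ _ _ _ _ _ P) => //; exact: measurable_mode. Qed.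

End measurability.

Section measurability_rules.
Variables (dT : measure_display) (T : measurableType dT).

Lemma measurable_enorm_mulVn (G : T -> 'rV[R]_d) : measurable_fun setT G ->
  measurable_fun setT (fun t => (enorm (G t))^-1 *: G t).
Proof.
move=> mG; apply: measurable_scalerV => //.
by apply: (measurableT_comp (@measurable_inv R)); exact: measurable_enorm.
Qed.

Lemma measurable_cut_mx (g : T -> 'rV[R]_d) (t : R) i j : measurable_fun setT g ->
  measurable_fun setT (fun x => cut_mx t (g x) i j).
Proof.
move=> mg; under eq_fun do rewrite !mxE.
apply: measurable_funD; first exact: measurable_cst.
apply: measurable_funM; first exact: measurable_cst.
apply: measurable_sum => k.
rewrite (_ : (fun x => _) = (fun x => g x 0 i * g x 0 j)); last by apply/funext => x; rewrite mxE (ord1 k).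
by apply: measurable_funM; exact: (measurableT_comp (@measurable_coord R d _) mg).
Qed.

Lemma measurable_test_point (m : T -> nat) : measurable_fun setT m ->
  measurable_fun setT (fun t => test_point d eps (m t)).
Proof. exact: (@measurableT_comp _ _ _ _ _ _ (test_point d eps)). Qed.

Lemma measurable_split_ratio (u : T -> 'rV[R]_d) : measurable_fun setT u ->
  measurable_fun setT (fun t => split_ratio M (u t)).
Proof.
move=> mu; apply: measurable_fun_ifT.
- by apply: measurable_fun_ler; [exact: measurable_enorm|exact: measurable_cst].
- exact: measurable_cst.
- apply: measurable_funM; first exact: measurable_cst.
  by apply: (measurableT_comp (@measurable_inv R)); exact: measurable_enorm.
Qed.

Lemma measurable_seg_start (b : T -> bool) (u : T -> 'rV[R]_d) :
  measurable_fun setT b -> measurable_fun setT u ->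
  measurable_fun setT (fun t => seg_start M (b t) (u t)).
Proof.
move=> mb mu; apply: measurable_fun_ifT => //; exact: measurable_split_ratio.
Qed.

Lemma measurable_seg_length (b : T -> bool) (u : T -> 'rV[R]_d) :
  measurable_fun setT b -> measurable_fun setT u ->
  measurable_fun setT (fun t => seg_length M (b t) (u t)).
Proof.
move=> mb mu; apply: measurable_fun_ifT => //; last exact: measurable_split_ratio.
by apply: measurable_funB; [exact: measurable_cst|exact: measurable_split_ratio].
Qed.

Lemma measurable_seg_drift (b : T -> bool) (u : T -> 'rV[R]_d) :
  measurable_fun setT b -> measurable_fun setT u ->
  measurable_fun setT (fun t => seg_drift M (b t) (u t)).
Proof.
move=> mb mu; apply: measurable_fun_ifT => //.
  apply: measurableT_comp => //; apply: measurable_funM; last exact: measurable_cst.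
  exact: measurable_enorm.
by apply: measurable_funM; [exact: measurable_cst|exact: measurable_enorm].
Qed.

Lemma measurable_level (y g v : T -> R) : measurable_fun setT y -> measurable_fun setT g ->
  measurable_fun setT v -> measurable_fun setT (fun t => level (y t) (g t) (v t)).
Proof.
move=> my mg mv; apply: measurable_funB => //; apply: measurable_funM.
  exact: (measurableT_comp (@measurable_ln R)).
exact: (measurableT_comp (@measurable_inv R)).
Qed.

Lemma measurable_rate_bound (A : T -> 'M[R]_d) (u : T -> 'rV[R]_d) :
  (forall i j, measurable_fun setT (fun t => A t i j)) -> measurable_fun setT u ->
  measurable_fun setT (fun t => rate_bound L M (A t) (u t)).
Proof.
move=> mA mu; apply: measurable_funD; last exact: measurable_cst.
apply: measurable_funD; first by apply: measurable_funM; [exact: measurable_cst|exact: measurable_enorm].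
apply: measurable_funM; first exact: measurable_cst.
by apply: measurable_funX; apply: measurable_enorm; exact: measurable_mulmx.
Qed.

End measurability_rules.

Lemma measurable_sampler_ask : measurable_fun setT sampler_ask.
Proof.
have mz := @measurable_id _ sampler_state setT.
apply: measurable_addrV; first exact: measurable_centre.
apply: measurable_mulmx; last exact: measurable_frame.
apply: measurable_fun_ifT.
- exact: (measurable_mode_test mz (fun m => (m <= d)%N)).
- by apply: measurable_test_point; exact: measurable_mode.
- have mb : measurable_fun setT (fun z : sampler_state => mode z == d.+3).
    exact: (measurable_mode_test mz (fun m => m == d.+3)).
  have mr := measurable_ray mz.
  apply: measurable_scalerV => //; apply: measurable_funD; first exact: measurable_seg_start.
  apply: measurable_funM; first exact: measurable_seg_length.
  by apply: measurable_funB; [exact: measurable_cst|exact: measurable_gap].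
Qed.

Lemma measurable_sampler_next : measurable_fun setT sampler_next.
Proof.
have mz : measurable_fun setT (fun p : (sampler_state * 'rV[R]_d) * coin => p.1.1).
  by apply: (measurableT_comp measurable_fst); exact: measurable_fst.
have mG0 : measurable_fun setT (fun p : (sampler_state * 'rV[R]_d) * coin => p.1.2).
  by apply: (measurableT_comp measurable_snd); exact: measurable_fst.
have mV : measurable_fun setT (fun p : (sampler_state * 'rV[R]_d) * coin => unif R (unzip p.2).1).
  apply: (measurableT_comp (@measurable_unif R)); apply: (measurableT_comp measurable_unzip1).
  exact: measurable_snd.
have mU : measurable_fun setT (fun p : (sampler_state * 'rV[R]_d) * coin => unif R (unzip p.2).2).
  apply: (measurableT_comp (@measurable_unif R)); apply: (measurableT_comp measurable_unzip2).
  exact: measurable_snd.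
have mo : measurable_fun setT (fun p : (sampler_state * 'rV[R]_d) * coin => (unzip p.2).1).
  by apply: (measurableT_comp measurable_unzip1); exact: measurable_snd.
have mm := measurable_mode mz; have mc := measurable_centre mz.
have mA := measurable_frame mz; have mr := measurable_ray mz.
have ml := measurable_lvl mz; have mg := measurable_gap mz.
have mtest P := measurable_mode_test mz P.
have mS : measurable_fun setT (fun p : (sampler_state * 'rV[R]_d) * coin => (mode p.1.1).+1).
  exact: (@measurableT_comp _ _ _ _ _ _ succn).
have mG : measurable_fun setT (fun p : (sampler_state * 'rV[R]_d) * coin => p.1.2 *m (frame p.1.1)^T).
  apply: measurable_mulmx => // i j; rewrite (_ : (fun _ => _) = (fun p => frame p.1.1 j i)); first exact: mA.
  by apply/funext => p; rewrite [LHS]mxE.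
have mcst a : measurable_fun setT (fun p : (sampler_state * 'rV[R]_d) * coin => a : R).
  exact: measurable_cst.
have mcstn (a : nat) : measurable_fun setT (fun p : (sampler_state * 'rV[R]_d) * coin => a).
  exact: measurable_cst.
apply: measurable_fun_ifT; first exact: (mtest (fun m => (m <= d)%N)).
  apply: measurable_fun_ifT; first by apply: measurable_fun_ler => //; exact: measurable_enorm.
    exact: measurable_mk_state.
  have mgh := measurable_enorm_mulVn mG.
  apply: measurable_mk_state => //.
    by apply: measurable_subrV => //; apply: measurable_scalerV => //; exact: measurable_mulmx.
  move=> i j; rewrite (_ : (fun _ => _) = (fun p => \sum_k
      cut_mx tau ((enorm (p.1.2 *m (frame p.1.1)^T))^-1 *: (p.1.2 *m (frame p.1.1)^T)) i k *
      frame p.1.1 k j)); last by apply/funext => p; rewrite [LHS]mxE.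
  by apply: measurable_sum => k; apply: measurable_funM => //; exact: measurable_cut_mx.
apply: measurable_fun_ifT; first exact: (mtest (fun m => (m <= d.+1)%N)).
  apply: measurable_fun_ifT => //.
    apply: measurable_fun_ltr => //.
    by apply: (measurableT_comp (@measurable_proposal_rate R d M)).
  apply: measurable_mk_state => //.
  exact: (measurableT_comp (@measurable_proposal R d)).
apply: measurable_fun_ifT => //; first exact: (mtest (fun m => (m <= d.+3)%N)).
have mb := mtest (fun m => m == d.+3).
apply: measurable_fun_ifT.
- apply: measurable_and; first exact: measurable_fun_ltr.
  apply: measurable_fun_ltr => //; apply: measurable_funD; last exact: measurable_funB.
  apply: measurable_funM; first exact: measurable_seg_length.
  by apply: measurable_funD; [exact: measurable_dotp|exact: measurable_seg_drift].
- exact: measurable_mk_state.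
- apply: measurable_fun_ifT.
  + by apply: measurable_fun_ler => //; exact: measurable_rate_bound.
  + exact: measurable_mk_state.
  + by apply: measurable_mk_state => //; [exact: measurable_level|exact: measurable_funM].
Qed.

Lemma measurable_halted : measurable_fun setT halted.
Proof. exact: (measurable_mode_test (@measurable_id _ _ _) (fun m => (d.+3 < m)%N)). Qed.

Lemma measurable_sample : measurable_fun setT sample.
Proof.
have mz := @measurable_id _ sampler_state setT.
apply: measurable_addrV; first exact: measurable_centre.
by apply: measurable_mulmx; [exact: measurable_ray|exact: measurable_frame].
Qed.

End sampler.

(** * Correctness and cost of the sampler *)

Section verification.
Variables (R : realType) (d : nat) (L mu : R) (f : 'rV[R]_d -> R).
Hypotheses (d0 : (0 < d)%N) (mu0 : 0 < mu) (muL : mu <= L) (fC : Cclass L mu f).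
Variable xs : 'rV[R]_d.
Hypothesis fmin : forall x, f xs <= f x.
Hypothesis fball : forall x, enorm (x - xs) ^+ 2 <= 2 / L -> f x <= f xs + 1.
Hypothesis fsub : forall x, f x <= f xs + 1 -> enorm (x - xs) ^+ 2 <= 2 / mu.
Hypothesis xs_near : enorm xs <= (Num.sqrt mu)^-1.

Local Notation tau := (cut_depth R d).
Local Notation M := (test_level R d).
Local Notation eps := (test_step R d).
Implicit Types (c u : 'rV[R]_d) (A : 'M[R]_d).

Let L0 : 0 < L. Proof. exact: lt_le_trans muL. Qed.
Let dp : 0 < d%:R :> R. Proof. by rewrite ltr0n. Qed.
Let d1 : 1 <= d%:R :> R. Proof. by rewrite ler1n. Qed.

Lemma test_level_gt0 : 0 < M. Proof. by rewrite mulr_gt0. Qed.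
Lemma test_step_gt0 : 0 < eps. Proof. by rewrite invr_gt0 mulr_gt0. Qed.
Lemma test_stepM : eps * M = 1. Proof. by rewrite mulVf// gt_eqF// mulr_gt0. Qed.

Lemma cut_depth_itv : 0 < tau <= 8^-1.
Proof. by rewrite invr_gt0 mulr_gt0//= lef_pV2 ?posrE ?mulr_gt0// ler_peMr. Qed.

Let M0 := test_level_gt0.

Definition initial_radius : R := 3 / Num.sqrt mu.

Definition initial_frame : 'M[R]_d := initial_radius%:M.

Definition excess_volume A : R := ln `|\det A| - ln (det_floor d L).

(** The second clause limits the stretch of the frame by the volume already lost to cuts; it bounds
    |uA|, hence the rates, polynomially in kappa. *)
Definition framed c A := localized f xs c A /\
  forall u, enorm (u *m A) <=
    initial_radius * expR (excess_volume initial_frame - excess_volume A) * enorm u.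

Lemma initial_radius_gt0 : 0 < initial_radius.
Proof. by rewrite divr_gt0// sqrtr_gt0. Qed.

Lemma excess_volume_ge0 c A : localized f xs c A -> 0 <= excess_volume A.
Proof.
move=> /(localized_det mu0 muL fball) H; have F := det_floor_gt0 d mu0 muL.
by rewrite subr_ge0 ler_ln ?posrE//; exact: lt_le_trans H.
Qed.

Lemma framed_initial : framed 0 initial_frame.
Proof.
have r0 := initial_radius_gt0; split; last first.
  by move=> u; rewrite subrr expR0 mulr1 mul_mx_scalar enormZ gtr0_norm.
move=> x fx; exists (initial_radius^-1 *: x); split.
  by rewrite add0r mul_mx_scalar scalerA divff ?scale1r// gt_eqF.
rewrite dotpZl dotpZr mulrA -invfM -expr2 -enorm_sqr mulrC ler_pdivrMr ?exprn_gt0// mul1r.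
rewrite ler_sqr ?nnegrE ?enorm_ge0 ?(ltW r0)//.
have s0 : 0 < Num.sqrt mu by rewrite sqrtr_gt0.
have sx : enorm (x - xs) <= 2 / Num.sqrt mu.
  rewrite -ler_sqr ?nnegrE ?enorm_ge0 ?divr_ge0 ?(ltW s0)//; apply: le_trans (fsub fx) _.
  by rewrite expr_div_n sqr_sqrtr ?(ltW mu0)// ler_pM2r ?invr_gt0//; lra.
have := enormD (x - xs) xs; rewrite subrK /initial_radius => H.
apply: le_trans H _; have -> : 3 / Num.sqrt mu = 2 / Num.sqrt mu + (Num.sqrt mu)^-1 by ring.
exact: lerD.
Qed.

(** The cut is admissible at off-centre test points too: dotp v g <= eps and 1/|G| <= 1/M add up to
    at most tau. *)
Lemma framed_cut c A (i : nat) : framed c A -> (i <= d)%N ->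
  let G := frame_grad f c A (test_point d eps i) in let g := (enorm G)^-1 *: G in
  M < enorm G ->
  framed (c - tau *: (g *m A)) (cut_mx tau g *m A) /\
  excess_volume (cut_mx tau g *m A) + tau / 2 <= excess_volume A.
Proof.
move=> [loc bnd] id G g MG; have /andP[t0 t8] := cut_depth_itv.
have nG : 0 < enorm G by exact: lt_trans MG.
have g1 : dotp g g = 1.
  by rewrite dotpZl dotpZr -enorm_sqr expr2 mulrA -invfM mulVf// gt_eqF// mulr_gt0.
have ng : enorm g = 1 by rewrite /enorm g1 sqrtr1.
have loc' : localized f xs (c - tau *: (g *m A)) (cut_mx tau g *m A).
  apply: (localized_cut mu0 fC fmin cut_depth_itv loc (v := test_point d eps i) (M := enorm G)) => //.
    by rewrite scalerA divff ?scale1r// gt_eqF.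
  have e1 : (enorm G)^-1 <= M^-1 by rewrite lef_pV2 ?posrE// ltW.
  have e2 : dotp (test_point d eps i) g <= eps.
    have H := dotp_le_enorm (test_point d eps i) g; apply: le_trans (ler_norm _) _.
    apply: le_trans H _; rewrite ng mulr1.
    move: id; rewrite leq_eqVlt => /predU1P[->|id].
      by rewrite test_pointd /enorm dotp0l sqrtr0 ltW// test_step_gt0.
    rewrite (test_point_ord _ (Ordinal id)) enormZ gtr0_norm ?test_step_gt0//.
    by rewrite /enorm dotp_delta eqxx sqrtr1 mulr1.
  apply: le_trans (lerD e1 e2) _; rewrite /M /eps /tau le_eqVlt; apply/orP; left; apply/eqP.
  by field; rewrite gt_eqF.
have [D0 Dl] := det_cut_mx cut_depth_itv g1 d0.
have A0 : 0 < `|\det A|.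
  exact: lt_le_trans (det_floor_gt0 d mu0 muL) (localized_det mu0 muL fball loc).
have dt : d%:R * (4 * tau ^+ 2) = tau / 2 by rewrite /tau; field; rewrite gt_eqF.
have vol : excess_volume (cut_mx tau g *m A) + tau / 2 <= excess_volume A.
  rewrite /excess_volume det_mulmx normrM (gtr0_norm D0) lnM ?posrE//.
  by move: Dl; rewrite dt; lra.
split=> //; split=> // u; rewrite mulmxA; apply: le_trans (bnd _) _.
have r0 := initial_radius_gt0.
have H1 := enorm_cut_mx cut_depth_itv g1 u.
(* As tau <= 1/8, the stretch of one cut is covered by its loss of volume. *)
have H2 : 1 + 4 * tau ^+ 2 <= expR (tau / 2).
  apply: le_trans (expR_ge1Dx _) _; rewrite ler_expR; have := sqr_ge0 tau; nra.
set E := excess_volume initial_frame in bnd *.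
have H3 : expR (E - excess_volume A) * expR (tau / 2) <= expR (E - excess_volume (cut_mx tau g *m A)).
  by rewrite -expRD ler_expR; lra.
rewrite -mulrA -[leRHS]mulrA; apply: ler_wpM2l; first exact: ltW.
apply: (@le_trans _ _ (expR (E - excess_volume A) * (expR (tau / 2) * enorm u))).
  apply: ler_wpM2l; first exact: expR_ge0.
  by apply: le_trans H1 _; apply: ler_wpM2r; first exact: enorm_ge0.
by rewrite mulrA; apply: ler_wpM2r; first exact: enorm_ge0.
Qed.

Definition tested c A := forall i, (i <= d)%N -> enorm (frame_grad f c A (test_point d eps i)) <= M.

(** An upper bound for the remaining test steps: those of the current round, plus a full round of d
    + 1 for each loss of tau/2 of excess volume. *)
Definition test_budget (m : nat) A : R :=
  (d.+1 - m)%:R + d.+1%:R * (2 / tau) * excess_volume A.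

Lemma test_budget_ge0 m c A : localized f xs c A -> 0 <= test_budget m A.
Proof.
move=> /excess_volume_ge0 H; have /andP[t0 _] := cut_depth_itv.
by rewrite addr_ge0// !mulr_ge0// invr_ge0 ltW.
Qed.

Lemma test_budget_pass (m : nat) A : (m <= d)%N -> test_budget m.+1 A + 1 = test_budget m A.
Proof. by move=> md; rewrite /test_budget addrAC natr1 subSS subSn. Qed.

Lemma test_budget_cut (m : nat) A A' : (m <= d)%N ->
  excess_volume A' + tau / 2 <= excess_volume A -> test_budget 0 A' + 1 <= test_budget m A.
Proof.
move=> md H; have /andP[t0 _] := cut_depth_itv; rewrite /test_budget subn0.
have m1 : 1 <= (d.+1 - m)%:R :> R by rewrite ler1n subn_gt0.
suff : d.+1%:R + d.+1%:R * (2 / tau) * excess_volume A' <= d.+1%:R * (2 / tau) * excess_volume A by lra.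
have -> : d.+1%:R + d.+1%:R * (2 / tau) * excess_volume A' =
    d.+1%:R * (2 / tau) * (excess_volume A' + tau / 2).
  by field; rewrite gt_eqF.
by rewrite ler_wpM2l// !mulr_ge0// invr_ge0 ltW.
Qed.

(** The testing phase is deterministic and its budget falls by 1 at each step, so it ends. *)
Lemma tested_frame_exists : exists c A, framed c A /\ tested c A.
Proof.
suff H (n m : nat) c A : (m <= d.+1)%N -> framed c A ->
    (forall i : nat, (i < m)%N -> enorm (frame_grad f c A (test_point d eps i)) <= M) ->
    test_budget m A <= n%:R -> exists c A, framed c A /\ tested c A.
  apply: (H (Num.bound (test_budget 0 initial_frame)) 0%N 0 initial_frame) => //.
    exact: framed_initial.
  by apply/ltW/archi_boundP; exact: test_budget_ge0 framed_initial.1.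
elim: n m c A => [|n IH] m c A md fr tst bud.
  have := excess_volume_ge0 fr.1 => ev; move: bud.
  have /andP[t0 _] := cut_depth_itv.
  have [mE|mn] := eqVneq m d.+1.
    by move=> _; exists c, A; split=> // i id; apply: tst; rewrite mE ltnS.
  have m1 : 1 <= (d.+1 - m)%:R :> R by rewrite ler1n subn_gt0 ltn_neqAle mn.
  have : 0 <= d.+1%:R * (2 / tau) * excess_volume A by rewrite !mulr_ge0// invr_ge0 ltW.
  by rewrite /test_budget; lra.
have [mE|mn] := eqVneq m d.+1.
  by exists c, A; split=> // i id; apply: tst; rewrite mE ltnS.
have {}md : (m <= d)%N by rewrite -ltnS ltn_neqAle mn.
have [Gm|Gm] := leP (enorm (frame_grad f c A (test_point d eps m))) M.
  have bud' : test_budget m.+1 A <= n%:R by rewrite -(lerD2r 1) (test_budget_pass A md) natr1.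
  apply: (IH m.+1 c A _ fr _ bud'); first by rewrite ltnS.
  by move=> i; rewrite ltnS leq_eqVlt => /predU1P[->//|]; exact: tst.
have [fr' ev'] := framed_cut fr md Gm.
have bud' : test_budget 0 (cut_mx tau ((enorm (frame_grad f c A (test_point d eps m)))^-1 *:
    frame_grad f c A (test_point d eps m)) *m A) <= n%:R.
  by rewrite -(lerD2r 1) natr1; apply: le_trans bud; exact: test_budget_cut.
exact: (IH 0%N _ _ _ fr' _ bud').
Qed.

Definition mass (B : set 'rV[R]_d) : \bar R := (\int[lebesgue_rV R d]_(x in B) (expR (- f x))%:E)%E.

Definition partition : R := fine (partition_function f).

Definition law (B : set 'rV[R]_d) : R := fine (target f B).

Let mexp : measurable_fun setT (fun x => (expR (- f x))%:E : \bar R).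
Proof.
apply/measurable_EFinP; apply: (measurableT_comp (@measurable_expR R)).
by apply: measurableT_comp => //; exact: measurable_potential fC.
Qed.

(** At a tested frame the partition function times [kap] is the acceptance probability, which is
    finite and positive. *)
Lemma partitionP : 0 < partition /\ partition_function f = partition%:E.
Proof.
have [c [A [[loc _] tst]]] := tested_frame_exists.
have [kap k0 kE] := acceptance_integral d0 mu0 muL fC M fball loc.
have [p pf pE] := acceptance_probability d0 mu0 muL fC fmin fball loc test_step_gt0 M0 test_stepM tst.
have p0 : 0 < p by apply: lt_le_trans pf; exact: (acceptance_floor_gt0 d0 M test_step_gt0).
have E : (kap%:E * partition_function f = p%:E)%E.
  by rewrite -pE -(kE setT)//; apply: eq_integral => o _; rewrite indicT mulr1.
have F : partition_function f = (p / kap)%:E.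
  rewrite mulrC EFinM -E muleA -EFinM mulVf ?gt_eqF// mul1e//.
by rewrite /partition F /=; split=> //; rewrite divr_gt0.
Qed.

Lemma lawP (B : set 'rV[R]_d) : measurable B ->
  [/\ target f B = (law B)%:E, mass B = (partition * law B)%:E & 0 <= law B <= 1].
Proof.
move=> mB; have [Z0 ZE] := partitionP.
have m0 : (0 <= mass B)%E by apply: integral_ge0 => x _; rewrite lee_fin expR_ge0.
have m1 : (mass B <= partition%:E)%E.
  rewrite -ZE; exact: ge0_subset_integral.
have TE : target f B = (partition^-1%:E * mass B)%E by rewrite /target ZE inver gt_eqF.
rewrite /law TE; move: m0 m1; case: (mass B) => [m| |]//; rewrite !lee_fin /= => m0 m1; split=> //.
  by rewrite mulrA divff ?mul1r// gt_eqF.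
by rewrite mulr_ge0 ?invr_ge0 ?(ltW Z0)//= mulrC ler_pdivrMr// mul1r.
Qed.

Lemma law_setC (B : set 'rV[R]_d) : measurable B -> law B + law (~` B) = 1.
Proof.
move=> mB; have [Z0 ZE] := partitionP.
have [_ E1 _] := lawP mB; have [_ E2 _] := lawP (measurableC mB).
have : (mass B + mass (~` B) = partition%:E)%E.
  rewrite /mass -ge0_integral_setU//.
  - by rewrite setUv -ZE.
  - exact: measurableC.
  - by rewrite setUv.
  - by rewrite disj_set2E setICr.
rewrite E1 E2 -EFinD -mulrDr => -[] /eqP; rewrite -[X in _ == X -> _]mulr1.
by move=> /eqP/(mulfI _) ->//; rewrite gt_eqF.
Qed.

(** * Survival probabilities within a proposal round *)

Section thinning.
Variables (c : 'rV[R]_d) (A : 'M[R]_d).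
Hypotheses (fr : framed c A) (tst : tested c A).

Let loc : localized f xs c A. Proof. by case: fr. Qed.

Lemma acceptance_law (B : set 'rV[R]_d) (p : R) : measurable B ->
  (\int[coinP R]_o (@proposal_rate R d M o * acceptance f c A M (proposal R d o))%:E = p%:E)%E ->
  (\int[coinP R]_o (@proposal_rate R d M o * acceptance f c A M (proposal R d o) *
     \1_B (c + proposal R d o *m A))%:E = (p * law B)%:E)%E.
Proof.
move=> mB pE; have [Z0 ZE] := partitionP; have [_ mE _] := lawP mB.
have [kap k0 kE] := acceptance_integral d0 mu0 muL fC M fball loc.
have : (kap%:E * partition_function f = p%:E)%E.
  by rewrite -pE -(kE setT)//; apply: eq_integral => o _; rewrite indicT mulr1.
rewrite ZE => -[<-]; rewrite kE//.
by move: mE; rewrite /mass => ->; rewrite -EFinM mulrA.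
Qed.

Section segment.
Variables (b : bool) (u : 'rV[R]_d).
Local Notation l := (back_rate f c A M b u).
Local Notation Lam := (back_potential f c A M b u).
Local Notation K := (rate_bound L M A u).

Let lc : continuous l := @continuous_back_rate _ _ _ _ _ fC c A M b u.
Let ld : forall s t : R, s <= t -> l t + (t - s) <= l s :=
  fun s t => @back_rate_decr _ _ _ _ _ mu0 fC c A _ M0 b u s t.
Let Ls : forall s t : R, Lam t - Lam s <= l s * (t - s) :=
  fun s t => back_potential_upper mu0 fC c A M b u s t.
Let l1 : 0 <= l 1 := back_rate1 mu0 muL fC fmin fball loc M0 tst b u.
Let lK : l 0 <= K := back_rate0 mu0 muL fC M0 tst b u.

(** The probability that the current proposal will be accepted: the present candidate is not under
    the graph, no point lies under the graph above level y, and the outer segment, if still to come,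
    is empty. *)
Definition survival (y g : R) : R :=
  ((1 <= g) || (l g <= y))%:R * expR (- area l Lam y) *
  (if b then 1 else expR (- hazard f c A M true u)).

Lemma survival01 y g : 0 <= survival y g <= 1.
Proof.
have hz := hazard_ge0 mu0 muL fC fmin fball loc M0 tst true u.
have a0 := area_ge0 lc ld Ls y.
have e1 : expR (- area l Lam y) <= 1 by rewrite -[leRHS]expR0 ler_expR oppr_le0.
have e2 : 0 <= (if b then 1 else expR (- hazard f c A M true u)) <= 1.
  by case: b; rewrite ?ler01 ?lexx// expR_ge0 -[leRHS]expR0 ler_expR oppr_le0.
case/andP: e2 => e2 e3; rewrite /survival; case: (_ || _) => /=; last by rewrite !mul0r lexx ler01.
by rewrite mul1r mulr_ge0 ?expR_ge0//= mulr_ile1 ?expR_ge0.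
Qed.

Lemma survival_start : survival 0 1 =
  expR (- hazard f c A M b u) * (if b then 1 else expR (- hazard f c A M true u)).
Proof. by rewrite /survival lexx mul1r (area0 Lam lc ld l1). Qed.

Lemma survival_end y g : K <= y -> l g <= y -> survival y g =
  (if b then 1 else expR (- hazard f c A M true u)).
Proof. by move=> Ky ly; rewrite /survival ly orbT mul1r (areaK Lam lc ld lK)// oppr0 expR0 mul1r. Qed.

Definition chain_pos (y g : R) := (y = 0 /\ g = 1) \/ (0 <= y /\ 0 < g < 1).

Lemma chain_pos_gap y g : chain_pos y g -> 0 < g <= 1.
Proof. by case=> [[_ ->]|[_ /andP[-> /ltW]]] //; rewrite ltr01 lexx. Qed.

Lemma chain_pos_step y g V U : chain_pos y g -> 0 < V < 1 -> 0 < U < 1 ->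
  chain_pos (level y g V) (g * U).
Proof.
move=> cp /andP[V0 V1] /andP[U0 U1]; right; have g01 := chain_pos_gap cp; case/andP: (g01) => g0 g1.
have y0 : 0 <= y by case: cp => [[-> _]|[]].
split; first by apply: le_trans y0 _; apply: level_ge => //; rewrite V0 ltW.
by rewrite mulr_gt0//=; nra.
Qed.

Lemma chain_pos_excess y g : chain_pos y g -> (1 <= g) || (l g <= y) -> excess l y <= g.
Proof.
case=> [[-> ->] _|[_ g01]]; first by have /andP[] := excess_itv l 0.
case/andP: (g01) => _ g1; rewrite leNgt g1/= => ly.
by rewrite leNgt -(l_gt_excess lc ld)// -leNgt.
Qed.

Lemma survival_stepE y g : chain_pos y g -> forall o,
  survival (level y g (unif R (unzip o).1)) (g * unif R (unzip o).2) =
  (l (g * unif R (unzip o).2) <= level y g (unif R (unzip o).1))%R%:R *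
    expR (- area l Lam (level y g (unif R (unzip o).1))) *
    (if b then 1 else expR (- hazard f c A M true u)).
Proof.
move=> cp o; rewrite /survival.
have /andP[_] : 0 < g * unif R (unzip o).2 < 1.
  have /andP[g0 g1] := chain_pos_gap cp; have /andP[U0 U1] := unif_itv R (unzip o).2.
  by rewrite mulr_gt0//=; nra.
by rewrite ltNge => /negbTE ->.
Qed.

Lemma measurable_survival_step y g : chain_pos y g ->
  measurable_fun setT (fun o => survival (level y g (unif R (unzip o).1)) (g * unif R (unzip o).2)).
Proof.
move=> cp; rewrite (funext (survival_stepE cp)).
apply: measurable_funM; last exact: measurable_cst.
have ms := measurable_survival lc ld Ls y g.
apply: (measurableT_comp ms (g := fun o : coin => (unif R (unzip o).1, unif R (unzip o).2))).
apply/measurable_fun_pair; apply: (measurableT_comp (@measurable_unif R)).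
  exact: measurable_unzip1.
exact: measurable_unzip2.
Qed.

(** [survival] is a martingale as long as the candidate is not rejected; this is [survival_step],
    with the width condition supplied by [chain_pos_excess]. *)
Lemma integral_survival_step y g : chain_pos y g -> (1 <= g) || (l g <= y) ->
  (\int[coinP R]_o (survival (level y g (unif R (unzip o).1)) (g * unif R (unzip o).2))%:E =
   (survival y g)%:E)%E.
Proof.
move=> cp al; have ex := chain_pos_excess cp al; have g01 := chain_pos_gap cp.
set e := (if b then 1 else expR (- hazard f c A M true u)).
have e0 : 0 <= e by rewrite /e; case: b; rewrite ?expR_ge0.
transitivity (\int[coinP R]_o (e%:E * ((l (g * unif R (unzip o).2) <= level y g (unif R (unzip o).1))%R%:R *
    expR (- area l Lam (level y g (unif R (unzip o).1))))%:E))%E.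
  by apply: eq_integral => o _; rewrite survival_stepE// -EFinM mulrC.
have mp : measurable_fun setT (fun o : coin => (unif R (unzip o).1, unif R (unzip o).2)).
  apply/measurable_fun_pair; apply: (measurableT_comp (@measurable_unif R)).
    exact: measurable_unzip1.
  exact: measurable_unzip2.
rewrite ge0_integralZl//.
- by rewrite (survival_step lc ld Ls lK g01 ex) -EFinM /survival al mul1r mulrC.
- apply/measurable_EFinP.
  exact: (measurableT_comp (measurable_survival lc ld Ls y g)
    (g := fun o : coin => (unif R (unzip o).1, unif R (unzip o).2)) mp).
Qed.

End segment.
End thinning.

Local Notation state := (sampler_state R d).
Implicit Types z : state.

Definition step z (o : coin) : state := transition (@sampler_ask R d) (@sampler_next R d L) f (z, o).

Definition sampler_inv z := (mode z <= d.+3)%N ->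
  [/\ framed (centre z) (frame z),
     forall i, (i < mode z)%N -> (i <= d)%N ->
       enorm (frame_grad f (centre z) (frame z) (test_point d eps i)) <= M &
     (d.+1 < mode z)%N -> chain_pos (lvl z) (gap z)].

Lemma frame_mk m c A u (y g : R) : frame (mk_state m c A u y g) = A.
Proof. exact: mxvecK. Qed.

Lemma draw_mode z : mode z = d.+1 -> (d < mode z <= d.+3)%N.
Proof. by move=> ->; rewrite leqnn leqW. Qed.

Lemma inv_tested z : sampler_inv z -> (d < mode z <= d.+3)%N -> tested (centre z) (frame z).
Proof.
move=> iz /andP[dm md] i id; case: (iz md) => _ H _; apply: H => //.
exact: leq_ltn_trans dm.
Qed.

Lemma step_test z o : (mode z <= d)%N ->
  step z o = test_next z (frame_grad f (centre z) (frame z) (test_point d eps (mode z))).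
Proof. by move=> md; rewrite /step /transition /sampler_next /sampler_ask /= md. Qed.

Lemma step_draw z o : mode z = d.+1 -> step z o = draw_next z o.
Proof. by move=> md; rewrite /step /transition /sampler_next /= md ltnn leqnn. Qed.

Definition slope z : R := back_rate f (centre z) (frame z) M (mode z == d.+3) (ray z) (gap z).

Lemma step_thin z o : (d.+1 < mode z <= d.+3)%N -> step z o =
  if (gap z < 1) && (lvl z < slope z)
  then mk_state d.+1 (centre z) (frame z) (ray z) (lvl z) (gap z)
  else if rate_bound L M (frame z) (ray z) <= lvl z
  then mk_state (mode z).+1 (centre z) (frame z) (ray z) 0 1
  else mk_state (mode z) (centre z) (frame z) (ray z)
    (level (lvl z) (gap z) (unif R (unzip o).1)) (gap z * unif R (unzip o).2).
Proof.
move=> /andP[dm md]; rewrite /step /transition /sampler_next /sampler_ask /= md.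
have -> : (mode z <= d)%N = false by rewrite leqNgt (ltn_trans _ dm).
by rewrite leqNgt dm.
Qed.

Lemma step_halted z g o : halted z -> sampler_next L ((z, g), o) = z.
Proof.
rewrite /halted => hz; rewrite /sampler_next /=.
have H k : (k <= d.+3)%N -> (mode z <= k)%N = false.
  by move=> kd; apply/negbTE; rewrite -ltnNge (leq_ltn_trans kd hz).
have h1 : (d.+1 <= d.+3)%N by exact: leqW.
by rewrite (H _ (ltnW h1)) (H _ h1) (H _ (leqnn _)).
Qed.

Lemma inv_mk m c A u (y g : R) : framed c A ->
  (forall i, (i < m)%N -> (i <= d)%N -> enorm (frame_grad f c A (test_point d eps i)) <= M) ->
  ((d.+1 < m <= d.+3)%N -> chain_pos y g) -> sampler_inv (mk_state m c A u y g).
Proof.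
move=> fr ts cp; rewrite /sampler_inv frame_mk /= => md; split=> // dm.
by apply: cp; rewrite [(d.+1 < m)%N]dm.
Qed.

Lemma inv_step z o : sampler_inv z -> sampler_inv (step z o).
Proof.
move=> iz.
have [md|dm] := leqP (mode z) d.
  have [fr ts _] := iz (leq_trans md (leqW (leqW (leqnSn _)))).
  rewrite (step_test o md) /test_next; case: leP => H.
    apply: (inv_mk fr); last by case/andP; rewrite ltnS ltnNge md.
    move=> i; rewrite ltnS leq_eqVlt => /predU1P[-> _|im id]; first exact: H.
    exact: ts.
  have [fr' _] := framed_cut fr md H.
  by apply: (inv_mk fr'); last by case/andP.
have [md3|hz] := leqP (mode z) d.+3; last by rewrite /step /transition (step_halted _ _ hz).
have [fr ts cp] := iz md3.
have tst : tested (centre z) (frame z) by apply: inv_tested; rewrite ?dm.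
have ts' m i : (i < m)%N -> (i <= d)%N ->
    enorm (frame_grad f (centre z) (frame z) (test_point d eps i)) <= M.
  by move=> _; exact: tst.
have [mE|mN] := eqVneq (mode z) d.+1.
  rewrite (step_draw o mE) /draw_next; case: ifP => _; last exact: iz.
  by apply: (inv_mk fr (ts' _)) => _; left.
have dm1 : (d.+1 < mode z)%N by rewrite ltn_neqAle eq_sym mN.
rewrite step_thin ?dm1 ?md3//; case: ifP => _.
  by apply: (inv_mk fr (ts' _)); rewrite ltnn.
case: ifP => _; first by apply: (inv_mk fr (ts' _)) => _; left.
apply: (inv_mk fr (ts' _)) => _.
by apply: chain_pos_step; [exact: cp|exact: unif_itv|exact: unif_itv].
Qed.

Definition surv z : R :=
  survival (centre z) (frame z) (mode z == d.+3) (ray z) (lvl z) (gap z).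

Lemma surv_mk m c A u (y g : R) :
  surv (mk_state m c A u y g) = survival c A (m == d.+3) u y g.
Proof. by rewrite /surv frame_mk. Qed.

(* The common shape of the expected number of queries and of the output law as
   functions of the current state. *)
Definition value (v : R) (T0 : nat -> 'M[R]_d -> R) (Y : state -> R) z : R :=
  if (mode z <= d)%N then T0 (mode z) (frame z)
  else if (mode z <= d.+1)%N then v
  else if (mode z <= d.+3)%N then v * (1 - surv z) + Y z else Y z.

Section value.
Variables (v : R) (T0 : nat -> 'M[R]_d -> R) (Y : state -> R).
Hypothesis v0 : 0 <= v.
Local Notation val := (value v T0 Y).

Lemma value_chain z : (d.+1 < mode z <= d.+3)%N -> val z = v * (1 - surv z) + Y z.
Proof.
move=> /andP[dm md]; rewrite /value md leqNgt (ltn_trans _ dm)//=.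
by rewrite leqNgt dm.
Qed.

Lemma value_halted z : halted z -> val z = Y z.
Proof.
rewrite /halted /value => hz.
have H k : (k <= d.+3)%N -> (mode z <= k)%N = false.
  by move=> kd; apply/negbTE; rewrite -ltnNge (leq_ltn_trans kd hz).
have h1 : (d.+1 <= d.+3)%N by exact: leqW.
by rewrite (H _ (ltnW h1)) (H _ h1) (H _ (leqnn _)).
Qed.

Section fixed_state.
Variable z : state.
Hypothesis iz : sampler_inv z.
Local Notation c := (centre z).
Local Notation A := (frame z).
Local Notation u := (ray z).
Local Notation y := (lvl z).
Local Notation g := (gap z).
Local Notation start o := (mk_state d.+2 c A (proposal R d o) 0 1).
Local Notation cont o := (mk_state (mode z) c A u
   (level y g (unif R (unzip o).1)) (g * unif R (unzip o).2)).
Hypothesis Y0 : forall z', (d.+1 < mode z' <= d.+3)%N -> 0 < gap z' -> sampler_inv z' -> 0 <= Y z'.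
Hypothesis mYstart : mode z = d.+1 -> measurable_fun setT (fun o => Y (start o)).
Hypothesis mYcont : (d.+1 < mode z <= d.+3)%N -> measurable_fun setT (fun o => Y (cont o)).

Lemma framed_inv : (mode z <= d.+3)%N -> framed c A.
Proof. by move=> /iz[]. Qed.

Lemma surv_start o : mode z = d.+1 -> surv (start o) = acceptance f c A M (proposal R d o).
Proof.
move=> mE; have fr : framed c A by apply: framed_inv; case/andP: (draw_mode mE).
have tst : tested c A by apply: inv_tested => //; exact: draw_mode.
by rewrite surv_mk (survival_start fr tst) ltn_eqF.
Qed.

Let rho := @proposal_rate R d M.
Let acc o := acceptance f c A M (proposal R d o).

Lemma value_start o : mode z = d.+1 -> val (start o) = v * (1 - acc o) + Y (start o).
Proof. by move=> mE; rewrite value_chain ?surv_start//= ltnSn leqnSn. Qed.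

Lemma inv_start o : mode z = d.+1 -> sampler_inv (start o).
Proof.
move=> mE; have fr : framed c A by apply: framed_inv; case/andP: (draw_mode mE).
have tst : tested c A by apply: inv_tested => //; exact: draw_mode.
by apply: (inv_mk fr) => [i _|_]; [exact: tst|left].
Qed.

Lemma start_ge0 o : mode z = d.+1 -> 0 <= Y (start o).
Proof. by move=> mE; apply: Y0; rewrite ?ltr01//= ?ltnSn ?leqnSn//; exact: inv_start. Qed.

(** p is the acceptance probability of a whole round: a refusal at once and a point found later on
    the ray both lead back to the value v. *)
Lemma value_draw p : mode z = d.+1 ->
  (\int[coinP R]_o (rho o * acc o)%:E = p%:E)%E ->
  (\int[coinP R]_o (val (step z o))%:E =
   (v * (1 - p))%:E + \int[coinP R]_o (rho o * Y (start o))%:E)%E.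
Proof.
move=> mE pE; have mYs := mYstart mE; have fr : framed c A by apply: framed_inv; case/andP: (draw_mode mE).
have tst : tested c A by apply: inv_tested => //; exact: draw_mode.
have [loc _] := fr.
have macc : measurable_fun setT acc.
  by apply: (measurableT_comp (measurable_acceptance fC c A M)); exact: measurable_proposal.
have mrho : measurable_fun setT rho by exact: measurable_proposal_rate.
have acc01 o : 0 <= acc o <= 1 by exact: (acceptance01 mu0 muL fC fmin fball loc M0 tst).
have rho01 o : 0 <= rho o <= 1 by exact: proposal_rate01.
pose F o := v * (1 - acc o) + Y (start o).
have F0 o : 0 <= F o.
  by rewrite addr_ge0 ?start_ge0// mulr_ge0//; have := acc01 o; lra.
transitivity (\int[coinP R]_o (if unif R (unzip o).2 < rho (unzip o).1 then F (unzip o).1 else v)%:E)%E.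
  apply: eq_integral => o _; rewrite (step_draw o mE) /draw_next -/rho; case: ifP => _.
    by rewrite value_start.
  by rewrite /value mE ltnn leqnn.
rewrite integral_thinned//; last first.
  apply: measurable_funD => //; apply: measurable_funM; first exact: measurable_cst.
  by apply: measurable_funB => //; exact: measurable_cst.
rewrite -(@integral_mix _ _ _ (coinP R) (fun o => rho o * acc o) (fun o => rho o * Y (start o)) v p)//.
- by apply: eq_integral => o _; congr (_%:E); rewrite /F; ring.
- exact: measurable_funM.
- exact: measurable_funM.
- move=> o; have /andP[r0 r1] := rho01 o; have /andP[a0 a1] := acc01 o.
  by rewrite mulr_ge0//= mulr_ile1.
- by move=> o; rewrite mulr_ge0 ?start_ge0//; case/andP: (rho01 o).
Qed.

Section chain_state.
Hypothesis zc : (d.+1 < mode z <= d.+3)%N.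

Let fr : framed c A. Proof. by apply: framed_inv; case/andP: zc. Qed.

Let tst : tested c A.
Proof. by apply: inv_tested => //; case/andP: zc => dm ->; rewrite (ltn_trans _ dm). Qed.

Let cp : chain_pos y g.
Proof. by case/andP: zc => dm md; case: (iz md) => _ _; apply. Qed.

Let dead := (g < 1) && (y < slope z).

Lemma aliveP : ~~ dead -> (1 <= g) || (slope z <= y).
Proof. by rewrite negb_and -!leNgt. Qed.

Lemma surv_dead : dead -> surv z = 0.
Proof.
case/andP => g1 ys; rewrite /surv /survival -/(slope z).
by rewrite !leNgt g1 ys/= !mul0r.
Qed.

Lemma value_dead o : dead -> val (step z o) = v.
Proof. by move=> dd; rewrite step_thin// -/dead dd /value /= ltnn leqnn. Qed.

Lemma step_pass o : ~~ dead -> rate_bound L M A u <= y ->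
  step z o = mk_state (mode z).+1 c A u 0 1.
Proof. by move=> /negbTE nd Ky; rewrite step_thin// -/dead nd Ky. Qed.

Lemma surv_pass : rate_bound L M A u <= y ->
  surv z = if mode z == d.+3 then 1 else expR (- hazard f c A M true u).
Proof.
move=> Ky; apply: (survival_end tst) => //.
have /andP[g0 _] := chain_pos_gap cp.
have := back_rate_decr mu0 fC c A M0 (mode z == d.+3) u (ltW g0).
have := back_rate0 mu0 muL fC M0 tst (mode z == d.+3) u.
by move=> h1 h2; apply: le_trans Ky; apply: le_trans h1; apply: le_trans h2; rewrite lerDl subr0 ltW.
Qed.

Lemma surv_pass_start : mode z = d.+2 ->
  surv (mk_state d.+3 c A u 0 1) = expR (- hazard f c A M true u).
Proof. by move=> mE; rewrite surv_mk (survival_start fr tst) eqxx mulr1. Qed.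

Lemma step_cont o : ~~ dead -> y < rate_bound L M A u -> step z o = cont o.
Proof. by move=> /negbTE nd; rewrite ltNge => /negbTE Ky; rewrite step_thin// -/dead nd Ky. Qed.

Lemma cont_ge0 o : 0 <= Y (cont o).
Proof.
have cp' : chain_pos (level y g (unif R (unzip o).1)) (g * unif R (unzip o).2).
  by apply: chain_pos_step => //; exact: unif_itv.
apply: Y0 => //; first by have /andP[] := chain_pos_gap cp'.
by apply: (inv_mk fr) => // i _; exact: tst.
Qed.

(** The martingale property of the survival probability leaves the restart part unchanged, so only Y
    moves. *)
Lemma value_cont : ~~ dead -> y < rate_bound L M A u ->
  (\int[coinP R]_o (val (step z o))%:E =
   (v * (1 - surv z))%:E + \int[coinP R]_o (Y (cont o))%:E)%E.
Proof.
move=> nd Ky; have mYc := mYcont zc; pose X o := surv (cont o).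
have XE : X = fun o => survival c A (mode z == d.+3) u
    (level y g (unif R (unzip o).1)) (g * unif R (unzip o).2).
  by apply/funext => o; rewrite /X surv_mk.
rewrite -(@integral_mix _ _ _ (coinP R) X (fun o => Y (cont o)) v (surv z))//.
- by apply: eq_integral => o _; rewrite step_cont// value_chain.
- by rewrite XE; exact: measurable_survival_step.
- by move=> o; rewrite XE; exact: (survival01 fr tst).
- by move=> o; exact: cont_ge0.
- rewrite XE; apply: (integral_survival_step tst) => //; exact: aliveP.
Qed.

End chain_state.

Lemma measurable_value : measurable_fun setT (fun o => val (step z o)).
Proof.
have [md|dm] := leqP (mode z) d.
  have -> : (fun o => val (step z o)) = cst (val (test_next z
      (frame_grad f c A (test_point d eps (mode z))))); last exact: measurable_cst.
  by apply/funext => o; rewrite (step_test _ md).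
have [md3|hz] := leqP (mode z) d.+3; last first.
  have -> : (fun o => val (step z o)) = cst (val z); last exact: measurable_cst.
  by apply/funext => o; rewrite /step /transition step_halted.
have [mE|mN] := eqVneq (mode z) d.+1.
  have mYs := mYstart mE; have fr : framed c A by exact: framed_inv.
  have -> : (fun o => val (step z o)) = (fun o => if unif R (unzip o).2 < rho (unzip o).1
      then v * (1 - acc (unzip o).1) + Y (start (unzip o).1) else v).
    apply/funext => o; rewrite (step_draw o mE) /draw_next -/rho; case: ifP => _.
      by rewrite value_start.
    by rewrite /value mE ltnn leqnn.
  have macc : measurable_fun setT acc.
    by apply: (measurableT_comp (measurable_acceptance fC c A M)); exact: measurable_proposal.
  apply: measurable_fun_ifT; last exact: measurable_cst.
    apply: measurable_fun_ltr.
      by apply: (measurableT_comp (@measurable_unif R)); exact: measurable_unzip2.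
    apply: (measurableT_comp (@measurable_proposal_rate R d M)); exact: measurable_unzip1.
  apply: (@measurableT_comp _ _ _ _ _ _ (fun o => v * (1 - acc o) + Y (start o))).
    apply: measurable_funD => //; apply: measurable_funM; first exact: measurable_cst.
    by apply: measurable_funB => //; exact: measurable_cst.
  exact: measurable_unzip1.
have zc : (d.+1 < mode z <= d.+3)%N by rewrite ltn_neqAle eq_sym mN dm.
have mYc := mYcont zc; have fr : framed c A by exact: framed_inv.
have tst : tested c A by apply: inv_tested; rewrite ?dm.
have cp : chain_pos y g by case/andP: zc => dm1 _; case: (iz md3) => _ _; apply.
have [dd|nd] := boolP ((g < 1) && (y < slope z)).
  have -> : (fun o => val (step z o)) = cst v; last exact: measurable_cst.
  by apply/funext => o; rewrite value_dead.
have [Ky|yK] := leP (rate_bound L M A u) y.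
  have -> : (fun o => val (step z o)) = cst (val (mk_state (mode z).+1 c A u 0 1)); last exact: measurable_cst.
  by apply/funext => o; rewrite step_pass.
have -> : (fun o => val (step z o)) = (fun o => v * (1 - survival c A (mode z == d.+3) u
    (level y g (unif R (unzip o).1)) (g * unif R (unzip o).2)) + Y (cont o)).
  by apply/funext => o; rewrite step_cont// value_chain// surv_mk.
apply: measurable_funD => //; apply: measurable_funM; first exact: measurable_cst.
apply: measurable_funB; first exact: measurable_cst.
exact: measurable_survival_step.
Qed.

End fixed_state.
End value.

(** * Expected cost of the proposal rounds *)

Definition growth_bound : R :=
  2 + 2 * M + L * initial_radius ^+ 2 * expR (2 * excess_volume initial_frame).

Lemma growth_bound_ge : 2 + 2 * M <= growth_bound.
Proof.
have : 0 <= L * initial_radius ^+ 2 * expR (2 * excess_volume initial_frame).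
  by rewrite !mulr_ge0 ?sqr_ge0 ?expR_ge0// ltW.
by rewrite /growth_bound; lra.
Qed.

Lemma growth_bound_ge1 : 1 <= growth_bound.
Proof. by have := growth_bound_ge; have := M0; lra. Qed.

Lemma rate_bound_ge1 A u : 1 <= rate_bound L M A u.
Proof.
by rewrite lerDr addr_ge0// ?mulr_ge0 ?enorm_ge0 ?sqr_ge0// ?(ltW L0)// ltW// M0.
Qed.

(** With B = [growth_bound], 1 + K <= B (1 + |u|)^2 <= B exp (2|u|), the stretch clause of [framed]
    bounding |uA|. Only |u| is left, which [proposal_rate_norm] controls on average. *)
Lemma ln_rate_bound c A u : framed c A ->
  0 <= ln (1 + rate_bound L M A u) <= ln growth_bound + 2 * enorm u.
Proof.
move=> [loc bnd]; have K1 := rate_bound_ge1 A u.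
rewrite ln_ge0 ?lerDl ?(le_trans ler01 K1)//=.
have n0 := enorm_ge0 u; have B1 := growth_bound_ge1.
have r0 := initial_radius_gt0.
pose E := expR (excess_volume initial_frame).
have uA : enorm (u *m A) <= initial_radius * E * enorm u.
  apply: le_trans (bnd u) _; rewrite ler_wpM2r// ler_wpM2l ?(ltW r0)// ler_expR.
  by have := excess_volume_ge0 loc; lra.
have uA2 : L * enorm (u *m A) ^+ 2 <= (growth_bound - 2 - 2 * M) * enorm u ^+ 2.
  have -> : growth_bound - 2 - 2 * M = L * (initial_radius * E) ^+ 2.
    have -> : growth_bound = 2 + 2 * M + L * initial_radius ^+ 2 * E ^+ 2 by rewrite /E -expRM_natl.
    ring.
  rewrite -mulrA ler_wpM2l ?(ltW L0)// -exprMn ler_sqr ?nnegrE ?enorm_ge0//.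
  by rewrite !mulr_ge0 ?expR_ge0 ?(ltW r0).
have KB : 1 + rate_bound L M A u <= growth_bound * expR (enorm u) ^+ 2.
  apply: (@le_trans _ _ (growth_bound * (1 + enorm u) ^+ 2)).
    have B2 := growth_bound_ge; have mM := M0; rewrite /rate_bound.
    move: uA2; set X := L * _ => uA2; set B := growth_bound in B2 uA2 *; set n := enorm u in n0 uA2 *.
    have : 0 <= (B - M) * n by rewrite mulr_ge0//; lra.
    have : 0 <= (1 + M) * n ^+ 2 by rewrite mulr_ge0 ?sqr_ge0//; lra.
    lra.
  rewrite ler_wpM2l//; first by lra.
  by rewrite ler_sqr ?nnegrE ?expR_ge0 ?addr_ge0// expR_ge1Dx.
have B0 : 0 < growth_bound by lra.
apply: (@le_trans _ _ (ln (growth_bound * expR (enorm u) ^+ 2))).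
  by rewrite ler_ln ?posrE ?mulr_gt0 ?exprn_gt0 ?expR_gt0//; lra.
by rewrite lnM ?posrE ?exprn_gt0 ?expR_gt0// -expRM_natl expRK mulr_natl.
Qed.

(** Solves the renewal inequality v >= 1 + v (1 - p) + E for p at least the floor: E is the mean
    cost of thinning, at most 10 + 16 times the mean bound on ln (1 + K). *)
Definition restart_cost : R :=
  (11 + 16 * (ln growth_bound + 2 * (split_radius M + 16))) / acceptance_floor d eps M.

Lemma restart_cost_ge0 : 0 <= restart_cost.
Proof.
rewrite divr_ge0 ?(ltW (acceptance_floor_gt0 d0 M test_step_gt0))//.
have := ln_ge0 growth_bound_ge1; have := split_radius_gt0 M0; lra.
Qed.

(** One step to end the current segment, the bound of [cost_step] for its candidates, and 5 = 1 + 4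
    in the same way for the outer segment while it is still to come. *)
Definition chain_cost z : R :=
  let K := rate_bound L M (frame z) (ray z) in
  if (mode z <= d.+3)%N then
    1 + (if lvl z < K then 4 + 8 * ln (1 + K * gap z) else 0) +
    (if mode z == d.+3 then 0 else 5 + 8 * ln (1 + K))
  else 0.

(** Bounds the number of chain steps left; each step takes two queries, counting its
    announcement. *)
Definition queries : state -> R :=
  value restart_cost (fun m A => restart_cost + test_budget m A) chain_cost.

Lemma chain_cost_ge0 z : 0 < gap z -> 0 <= chain_cost z.
Proof.
move=> g0; rewrite /chain_cost; case: ifP => // _.
have K1 := rate_bound_ge1 (frame z) (ray z); set K := rate_bound _ _ _ _ in K1 *.
have a1 : 0 <= ln (1 + K * gap z) by apply: ln_ge0; rewrite lerDl mulr_ge0 ?(ltW g0)//; lra.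
have a2 : 0 <= ln (1 + K) by apply: ln_ge0; lra.
by case: ifP; case: ifP; lra.
Qed.

Lemma measurable_cost_start z : measurable_fun setT (fun o =>
  chain_cost (mk_state d.+2 (centre z) (frame z) (proposal R d o) 0 1)).
Proof.
have mK : measurable_fun setT (fun o => rate_bound L M (frame z) (proposal R d o)).
  apply: measurable_rate_bound; last exact: measurable_proposal.
  by move=> i j; exact: measurable_cst.
have -> : (fun o => chain_cost (mk_state d.+2 (centre z) (frame z) (proposal R d o) 0 1)) =
   (fun o => 10 + 16 * ln (1 + rate_bound L M (frame z) (proposal R d o))).
  apply/funext => o; rewrite /chain_cost frame_mk /= leqnSn ltn_eqF//.
  have K1 := rate_bound_ge1 (frame z) (proposal R d o).
  rewrite ifT; last by rewrite (lt_le_trans ltr01).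
  by rewrite mulr1; ring.
apply: measurable_funD; first exact: measurable_cst.
apply: measurable_funM; first exact: measurable_cst.
apply: (measurableT_comp (@measurable_ln R)).
by apply: measurable_funD => //; exact: measurable_cst.
Qed.

Lemma measurable_cost_term (y g K : R) : measurable_fun setT (fun o : coin =>
  if level y g (unif R (unzip o).1) < K then 4 + 8 * ln (1 + K * (g * unif R (unzip o).2)) else 0).
Proof.
have mV : measurable_fun setT (fun o : coin => unif R (unzip o).1).
  by apply: (measurableT_comp (@measurable_unif R)); exact: measurable_unzip1.
have mU : measurable_fun setT (fun o : coin => unif R (unzip o).2).
  by apply: (measurableT_comp (@measurable_unif R)); exact: measurable_unzip2.
apply: measurable_fun_ifT; last exact: measurable_cst.
  apply: measurable_fun_ltr; last exact: measurable_cst.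
  by apply: measurable_level => //; exact: measurable_cst.
apply: measurable_funD; first exact: measurable_cst.
apply: measurable_funM; first exact: measurable_cst.
apply: (measurableT_comp (@measurable_ln R)).
apply: measurable_funD; first exact: measurable_cst.
apply: measurable_funM; first exact: measurable_cst.
by apply: measurable_funM; first exact: measurable_cst.
Qed.

Lemma measurable_cost_cont z : measurable_fun setT (fun o =>
  chain_cost (mk_state (mode z) (centre z) (frame z) (ray z)
   (level (lvl z) (gap z) (unif R (unzip o).1)) (gap z * unif R (unzip o).2))).
Proof.
pose K := rate_bound L M (frame z) (ray z).
have -> : (fun o => chain_cost (mk_state (mode z) (centre z) (frame z) (ray z)
   (level (lvl z) (gap z) (unif R (unzip o).1)) (gap z * unif R (unzip o).2))) =
  (fun o => if (mode z <= d.+3)%N then 1 + (if level (lvl z) (gap z) (unif R (unzip o).1) < K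
     then 4 + 8 * ln (1 + K * (gap z * unif R (unzip o).2)) else 0) +
    (if mode z == d.+3 then 0 else 5 + 8 * ln (1 + K)) else 0).
  by apply/funext => o; rewrite /chain_cost frame_mk.
case: (mode z <= d.+3)%N; last exact: measurable_cst.
apply: measurable_funD; last exact: measurable_cst.
by apply: measurable_funD; [exact: measurable_cst|exact: measurable_cost_term].
Qed.

Lemma integral_coinP_cst (r : R) : (\int[coinP R]_o r%:E = r%:E)%E.
Proof.
rewrite integral_cst//; transitivity (r%:E * 1)%E; last exact: mule1.
by congr (_ * _)%E; exact: probability_setT.
Qed.

Lemma queries_super z : sampler_inv z -> ~~ halted z ->
  (1 + \int[coinP R]_o (queries (step z o))%:E <= (queries z)%:E)%E.
Proof.
move=> iz nh; have md3 : (mode z <= d.+3)%N by move: nh; rewrite /halted -leqNgt.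
have [fr ts cp] := iz md3; have v0 := restart_cost_ge0.
have [md|dm] := leqP (mode z) d.
  pose z' := test_next z (frame_grad f (centre z) (frame z) (test_point d eps (mode z))).
  have -> : (\int[coinP R]_o (queries (step z o))%:E = (queries z')%:E)%E.
    by under eq_integral do rewrite (step_test _ md); rewrite integral_coinP_cst.
  rewrite -EFinD lee_fin /queries /z' /test_next [leRHS]/value md.
  case: (leP (enorm _) M) => H.
    rewrite /value frame_mk /= -(test_budget_pass (frame z) md).
    have [md'|] := ltnP (mode z) d; first by lra.
    by move=> _; rewrite ltnS md; have := test_budget_ge0 (mode z).+1 fr.1; lra.
  have [fr' ev'] := framed_cut fr md H.
  by rewrite /value frame_mk /=; have := test_budget_cut md ev'; lra.
have tst : tested (centre z) (frame z) by apply: inv_tested => //; rewrite dm.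
have Y0 z' : (d.+1 < mode z' <= d.+3)%N -> 0 < gap z' -> sampler_inv z' -> 0 <= chain_cost z'.
  by move=> _ g0 _; exact: chain_cost_ge0.
have [mE|mN] := eqVneq (mode z) d.+1.
  have [p pf pE] := acceptance_probability d0 mu0 muL fC fmin fball fr.1 test_step_gt0 M0 test_stepM tst.
  rewrite (value_draw _ v0 iz Y0 (fun=> measurable_cost_start z) mE pE).
  rewrite /queries /value mE ltnn leqnn.
  pose bnd := 10 + 16 * (ln growth_bound + 2 * (split_radius M + 16)).
  have HY : (\int[coinP R]_o (@proposal_rate R d M o *
      chain_cost (mk_state d.+2 (centre z) (frame z) (proposal R d o) 0 1))%:E <= bnd%:E)%E.
    apply: integral_le_cst.
      by apply: measurable_funM; [exact: measurable_proposal_rate|exact: measurable_cost_start].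
    move=> o; have /andP[r0 r1] := proposal_rate01 d0 M0 o; have rn := proposal_rate_norm d0 M0 o.
    rewrite mulr_ge0 ?chain_cost_ge0//= /chain_cost frame_mk /= leqnSn ltn_eqF//.
    have K1 := rate_bound_ge1 (frame z) (proposal R d o).
    rewrite ifT; last by rewrite (lt_le_trans ltr01).
    rewrite mulr1; have /andP[l0 l1] := ln_rate_bound (proposal R d o) fr.
    have B0 := ln_ge0 growth_bound_ge1.
    move: l0 l1 rn r0 r1; rewrite /bnd; move: (ln (1 + _)) (enorm _) (@proposal_rate R d M o) => l n r l0 l1 rn r0 r1.
    have : r * l <= r * (ln growth_bound + 2 * n) by rewrite ler_wpM2l.
    have : r * ln growth_bound <= ln growth_bound by rewrite ler_piMl.
    lra.
  apply: le_trans (leeD2l _ (leeD2l _ HY)) _; rewrite -!EFinD lee_fin.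
  have F0 := acceptance_floor_gt0 d0 M test_step_gt0.
  (* By definition the left side equals 1 + [bnd]: the present step and the mean cost of
     thinning. *)
  have : restart_cost * acceptance_floor d eps M <= restart_cost * p by rewrite ler_wpM2l.
  by rewrite {1}/restart_cost divfK ?gt_eqF// /bnd; lra.
have zc : (d.+1 < mode z <= d.+3)%N by rewrite ltn_neqAle eq_sym mN dm.
have {}cp : chain_pos (lvl z) (gap z) by apply: cp; case/andP: zc.
have /andP[g0 g1] := chain_pos_gap cp.
have costE : chain_cost z = 1 + (if lvl z < rate_bound L M (frame z) (ray z)
    then 4 + 8 * ln (1 + rate_bound L M (frame z) (ray z) * gap z) else 0) +
    (if mode z == d.+3 then 0 else 5 + 8 * ln (1 + rate_bound L M (frame z) (ray z))).
  by rewrite /chain_cost md3.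
have K1 := rate_bound_ge1 (frame z) (ray z).
have [dd|nd] := boolP ((gap z < 1) && (lvl z < slope z)).
  rewrite (eq_integral (fun=> restart_cost%:E)) => [|o _]; last by rewrite /queries value_dead.
  rewrite integral_coinP_cst -EFinD lee_fin /queries value_chain// surv_dead// subr0 mulr1.
  have : 1 <= chain_cost z.
    rewrite costE; have a1 : 0 <= ln (1 + rate_bound L M (frame z) (ray z)) by apply: ln_ge0; lra.
    have a2 : 0 <= ln (1 + rate_bound L M (frame z) (ray z) * gap z).
      by apply: ln_ge0; rewrite lerDl mulr_ge0 ?ltW//; lra.
    by case: ifP; case: ifP; lra.
  by lra.
have [Ky|yK] := leP (rate_bound L M (frame z) (ray z)) (lvl z).
  rewrite (eq_integral (fun=> (queries (mk_state (mode z).+1 (centre z) (frame z) (ray z) 0 1))%:E)) => [|o _];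
    last by rewrite step_pass.
  rewrite integral_coinP_cst -EFinD lee_fin {2}/queries value_chain// (surv_pass iz)// costE ltNge Ky/=.
  have [m3|m3] := eqVneq (mode z) d.+3.
    rewrite /queries value_halted; last by rewrite /halted /= m3.
    by rewrite /chain_cost /= m3 ltnn; lra.
  have m2 : mode z = d.+2.
    have /andP[a _] := zc; have b : (mode z < d.+3)%N by rewrite ltn_neqAle m3.
    by apply/eqP; rewrite eqn_leq; apply/andP.
  rewrite m2 /queries value_chain /= ?ltnSn ?leqnn//; last by rewrite leqnSn.
  rewrite (surv_pass_start iz)// /chain_cost frame_mk /= leqnn eqxx.
  rewrite ifT; last by rewrite (lt_le_trans ltr01).
  by rewrite mulr1; lra.
rewrite /queries (value_cont _ v0 iz Y0 (fun=> measurable_cost_cont z) zc nd yK).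
rewrite value_chain// costE yK.
have y0 : 0 <= lvl z by case: cp => [[-> _]|[]].
have := cost_step y0 yK (_ : 0 < gap z <= 1); rewrite g0 g1 => /(_ isT).
set I := (\int[coinP R]_o _)%E => HI.
pose rest : R := if mode z == d.+3 then 0 else 5 + 8 * ln (1 + rate_bound L M (frame z) (ray z)).
have rest0 : 0 <= rest.
  by rewrite /rest; case: ifP => // _; have := @ln_ge0 R (1 + rate_bound L M (frame z) (ray z)); lra.
have -> : (\int[coinP R]_o (chain_cost (mk_state (mode z) (centre z) (frame z) (ray z)
   (level (lvl z) (gap z) (unif R (unzip o).1)) (gap z * unif R (unzip o).2)))%:E = (1 + rest)%:E + I)%E.
  rewrite /I -integral_addc.
  - apply: eq_integral => o _; congr (_%:E).
    rewrite (_ : chain_cost _ = if (mode z <= d.+3)%N then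
      1 + (if level (lvl z) (gap z) (unif R (unzip o).1) < rate_bound L M (frame z) (ray z)
        then 4 + 8 * ln (1 + rate_bound L M (frame z) (ray z) * (gap z * unif R (unzip o).2)) else 0) +
      rest else 0); last by rewrite /chain_cost frame_mk.
    by rewrite md3 addrAC.
  - exact: measurable_cost_term.
  - move=> o; have /andP[U0 _] := unif_itv R (unzip o).2; case: ifP => // _.
    by rewrite addr_ge0// mulr_ge0// ln_ge0// lerDl !mulr_ge0 ?(ltW U0) ?(ltW g0)//; lra.
  - lra.
rewrite -/rest.
have E (p q : R) (J : \bar R) : (1 + (p%:E + (q%:E + J)) = (p + q)%:E + (1 + J))%E.
  by rewrite EFinD -addeA [LHS]addeCA; congr (p%:E + _)%E; exact: addeCA.
rewrite E.
apply: le_trans (leeD2l _ HI) _.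
by rewrite -EFinD lee_fin; lra.
Qed.

Lemma chain_surv01 z : sampler_inv z -> (d.+1 < mode z <= d.+3)%N -> 0 <= surv z <= 1.
Proof.
move=> iz zc; have /andP[dm md] := zc; have [fr _ _] := iz md.
have tst : tested (centre z) (frame z) by apply: inv_tested; rewrite ?(ltnW dm).
exact: (survival01 fr tst).
Qed.

Lemma queries_ge0 z : sampler_inv z -> 0 <= queries z.
Proof.
move=> iz; have v0 := restart_cost_ge0; rewrite /queries /value.
case: ifPn => [md|dm].
  rewrite addr_ge0//; apply: test_budget_ge0 (_ : framed (centre z) _).1.
  by case: (iz (leq_trans md (leqW (leqW (leqnSn _))))).
case: ifPn => // dm1; rewrite -ltnNge in dm1.
case: ifPn => [md3|hz]; last by rewrite /chain_cost (negbTE hz).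
have zc : (d.+1 < mode z <= d.+3)%N by rewrite dm1.
have /andP[s0 s1] := chain_surv01 iz zc.
have [_ _ cp] := iz md3; have /andP[g0 _] := chain_pos_gap (cp dm1).
by rewrite addr_ge0 ?chain_cost_ge0// mulr_ge0//; lra.
Qed.

(** * The law of the output *)

Section outcome.
Variable B : set 'rV[R]_d.
Hypothesis mB : measurable B.

(** The proposal is already fixed during thinning, so this is the chance of halting in B in the
    present round; [value] adds the chance of doing so after a restart. *)
Definition outcome z : R :=
  if (mode z <= d.+3)%N then \1_B (sample z) * surv z else \1_B (sample z).

Definition law_value : state -> R := value (law B) (fun _ _ => law B) outcome.

Let nu0 : 0 <= law B. Proof. by have [_ _ /andP[]] := lawP mB. Qed.

Lemma outcome_ge0 z : (d.+1 < mode z <= d.+3)%N -> 0 < gap z -> sampler_inv z -> 0 <= outcome z.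
Proof.
move=> zc _ iz; have /andP[_ md] := zc; rewrite /outcome md mulr_ge0//.
by have /andP[] := chain_surv01 iz zc.
Qed.

Lemma law_value_ge0 z : sampler_inv z -> 0 <= law_value z.
Proof.
move=> iz; rewrite /law_value /value; case: ifPn => // dm; case: ifPn => // dm1.
rewrite -ltnNge in dm1; case: ifPn => [md3|hz]; last by rewrite /outcome (negbTE hz).
have zc : (d.+1 < mode z <= d.+3)%N by rewrite dm1.
have /andP[s0 s1] := chain_surv01 iz zc.
by rewrite addr_ge0//; [rewrite mulr_ge0//; lra|rewrite /outcome md3 mulr_ge0].
Qed.

Lemma measurable_outcome_start z : sampler_inv z -> mode z = d.+1 -> measurable_fun setT (fun o =>
  outcome (mk_state d.+2 (centre z) (frame z) (proposal R d o) 0 1)).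
Proof.
move=> iz mE.
have -> : (fun o => outcome (mk_state d.+2 (centre z) (frame z) (proposal R d o) 0 1)) =
  (fun o => \1_B (centre z + proposal R d o *m frame z) *
     acceptance f (centre z) (frame z) M (proposal R d o)).
  by apply/funext => o; rewrite -(surv_start iz o mE) /outcome /sample frame_mk /= leqnSn.
apply: measurable_funM.
  apply: (measurableT_comp (measurable_indic mB)).
  by apply: measurable_addrV; [exact: measurable_cst|apply: measurable_mulmx_cst; exact: measurable_proposal].
by apply: (measurableT_comp (measurable_acceptance fC _ _ _)); exact: measurable_proposal.
Qed.

Lemma outcome_cont z o : (mode z <= d.+3)%N ->
  outcome (mk_state (mode z) (centre z) (frame z) (ray z)
     (level (lvl z) (gap z) (unif R (unzip o).1)) (gap z * unif R (unzip o).2)) =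
  \1_B (sample z) * survival (centre z) (frame z) (mode z == d.+3) (ray z)
     (level (lvl z) (gap z) (unif R (unzip o).1)) (gap z * unif R (unzip o).2).
Proof. by move=> md; rewrite /outcome surv_mk /sample frame_mk ifT. Qed.

Lemma measurable_outcome_cont z : sampler_inv z -> (d.+1 < mode z <= d.+3)%N -> measurable_fun setT (fun o =>
  outcome (mk_state (mode z) (centre z) (frame z) (ray z)
     (level (lvl z) (gap z) (unif R (unzip o).1)) (gap z * unif R (unzip o).2))).
Proof.
move=> iz /andP[dm md]; have [_ _ cp] := iz md.
rewrite (funext (fun o => outcome_cont o md)).
apply: measurable_funM; first exact: measurable_cst.
by apply: measurable_survival_step; exact: cp.
Qed.

(** A round accepts with probability p, the accepted point has law [law] by [acceptance_law], and a
    failed round returns to [law B]: p law B + (1 - p) law B = law B. *)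
Lemma law_super z : sampler_inv z -> (\int[coinP R]_o (law_value (step z o))%:E <= (law_value z)%:E)%E.
Proof.
move=> iz; have [hz|nh] := boolP (halted z).
  rewrite (eq_integral (fun=> (law_value z)%:E)) => [|o _]; last by rewrite /step /transition step_halted.
  by rewrite integral_coinP_cst.
have md3 : (mode z <= d.+3)%N by move: nh; rewrite /halted -leqNgt.
have [fr ts cp] := iz md3.
have [md|dm] := leqP (mode z) d.
  rewrite (eq_integral (fun=> (law B)%:E)) => [|o _].
    by rewrite integral_coinP_cst /law_value /value md.
  rewrite (step_test _ md) /test_next; case: ifP => _; last by [].
  by rewrite /law_value /value; case: ifP => // _; rewrite /= ltnS md.
have tst : tested (centre z) (frame z) by apply: inv_tested => //; rewrite dm.
have [mE|mN] := eqVneq (mode z) d.+1.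
  have [p pf pE] := acceptance_probability d0 mu0 muL fC fmin fball fr.1 test_step_gt0 M0 test_stepM tst.
  rewrite /law_value (value_draw _ nu0 iz outcome_ge0 (measurable_outcome_start iz) mE pE).
  rewrite (_ : (\int[coinP R]_o _)%E = (p * law B)%:E); last first.
    rewrite -(acceptance_law fr mB pE); apply: eq_integral => o _; congr (_%:E).
    rewrite -(surv_start iz o mE) /outcome /= leqnSn /sample frame_mk /=; ring.
  rewrite -EFinD lee_fin /value mE ltnn leqnn; lra.
have zc : (d.+1 < mode z <= d.+3)%N by rewrite ltn_neqAle eq_sym mN dm.
have {}cp : chain_pos (lvl z) (gap z) by apply: cp; case/andP: zc.
have oE : outcome z = \1_B (sample z) * surv z by rewrite /outcome md3.
have [dd|nd] := boolP ((gap z < 1) && (lvl z < slope z)).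
  rewrite (eq_integral (fun=> (law B)%:E)) => [|o _]; last by rewrite /law_value value_dead.
  by rewrite integral_coinP_cst lee_fin /law_value value_chain// oE surv_dead// subr0 mulr1 mulr0 addr0.
have [Ky|yK] := leP (rate_bound L M (frame z) (ray z)) (lvl z).
  rewrite (eq_integral (fun=> (law_value (mk_state (mode z).+1 (centre z) (frame z) (ray z) 0 1))%:E)) => [|o _];
    last by rewrite step_pass.
  rewrite integral_coinP_cst lee_fin /law_value [leRHS]value_chain// oE (surv_pass iz)//.
  have [m3|m3] := eqVneq (mode z) d.+3.
    rewrite value_halted; last by rewrite /halted /= m3.
    by rewrite /outcome /= m3 ltnn /sample frame_mk subrr mulr0 add0r mulr1.
  have m2 : mode z = d.+2.
    have /andP[a _] := zc; have b : (mode z < d.+3)%N by rewrite ltn_neqAle m3.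
    by apply/eqP; rewrite eqn_leq; apply/andP.
  rewrite m2 value_chain /= ?ltnSn ?leqnn//; last by rewrite leqnSn.
  by rewrite /outcome /= leqnn (surv_pass_start iz)// /sample frame_mk.
rewrite /law_value (value_cont _ nu0 iz outcome_ge0 (measurable_outcome_cont iz) zc nd yK).
rewrite value_chain// oE.
rewrite (_ : (\int[coinP R]_o _)%E = (\1_B (sample z) * surv z)%:E) ?EFinD//.
rewrite -[surv z]/(survival _ _ _ _ _ _) EFinM -(integral_survival_step tst cp); last exact: aliveP.
rewrite -ge0_integralZl//.
- by apply: eq_integral => o _; rewrite outcome_cont.
- by apply/measurable_EFinP; exact: measurable_survival_step.
- by move=> o _; rewrite lee_fin; case/andP: (survival01 fr tst (mode z == d.+3) (ray z)
    (level (lvl z) (gap z) (unif R (unzip o).1)) (gap z * unif R (unzip o).2)).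
Qed.

End outcome.

End verification.

(** * The expected number of queries *)

Section query_bound.
Variables (R : realType) (d : nat) (L mu : R).
Hypotheses (d0 : (0 < d)%N) (mu0 : 0 < mu) (muL : mu <= L).

Local Notation M := (test_level R d).
Local Notation tau := (cut_depth R d).
Local Notation lk := (ln (1 + L / mu)).

Let L0 : 0 < L. Proof. exact: lt_le_trans muL. Qed.
Let k1 : 1 <= L / mu. Proof. by rewrite ler_pdivlMr// mul1r. Qed.

Definition volume_constant : R := 2 * d%:R + ln (d`!%:R).

Lemma ln_kappa : 0 <= ln (L / mu) <= lk.
Proof.
have k0 : 0 < L / mu by rewrite divr_gt0.
by rewrite ln_ge0//= ler_ln ?posrE ?lerDr ?addr_gt0.
Qed.

(** The squared ratio of the initial radius 3 / sqrt mu to the inner radius sqrt (2/L) is 9/2 kappa,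
    and ln (9/2) <= 7/2; ln d! comes from [det_floor]. *)
Lemma excess_volume_initial :
  excess_volume L (initial_frame d mu) <= volume_constant + d%:R * lk.
Proof.
have r0 := initial_radius_gt0 mu0.
have s0 : 0 < Num.sqrt (2 / L) by rewrite sqrtr_gt0 divr_gt0.
have f0 : 0 < d`!%:R :> R by rewrite ltr0n fact_gt0.
rewrite /excess_volume /initial_frame det_scalar ger0_norm ?exprn_ge0 ?(ltW r0)//.
rewrite /det_floor ln_div ?posrE ?exprn_gt0// !lnXn//.
rewrite -[ln (initial_radius mu) *+ d]mulr_natl -[ln (Num.sqrt _) *+ d]mulr_natl.
have H : 2 * (ln (initial_radius mu) - ln (Num.sqrt (2 / L))) <= 4 + lk.
  have -> : 2 * (ln (initial_radius mu) - ln (Num.sqrt (2 / L))) =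
      ln (initial_radius mu ^+ 2) - ln (Num.sqrt (2 / L) ^+ 2).
    by rewrite !lnXn// !mulr2n; ring.
  rewrite sqr_sqrtr ?divr_ge0 ?(ltW L0)// /initial_radius expr_div_n sqr_sqrtr ?(ltW mu0)//.
  rewrite -ln_div ?posrE ?divr_gt0 ?exprn_gt0//.
  have -> : 3 ^+ 2 / mu / (2 / L) = (9 / 2) * (L / mu) by field; rewrite !gt_eqF.
  have k0 : 0 < L / mu by rewrite divr_gt0.
  have n9 : 0 < 9 / 2 :> R by rewrite divr_gt0.
  rewrite lnM ?posrE//.
  rewrite lerD//; last by case/andP: ln_kappa.
  have -> : 9 / 2 = 1 + 7 / 2 :> R by lra.
  by apply: le_trans (le_ln1Dx _) _; lra.
have l0 : 0 <= lk by case/andP: ln_kappa => h1 h2; exact: le_trans h1 h2.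
have dn : 0 <= d%:R :> R by [].
have : d%:R * (2 * (ln (initial_radius mu) - ln (Num.sqrt (2 / L)))) <= d%:R * (4 + lk).
  exact: ler_wpM2l.
have : 0 <= d%:R * lk by rewrite mulr_ge0.
rewrite /volume_constant; lra.
Qed.

Lemma ln_growth_bound :
  ln (growth_bound d L mu) <= ln (11 + 2 * M) + 2 * volume_constant + (1 + 2 * d%:R) * lk.
Proof.
have M0 := test_level_gt0 R d0; have E := excess_volume_initial.
have /andP[l0 l1] := ln_kappa; have k0 : 0 < L / mu by rewrite divr_gt0.
set X := expR (2 * (volume_constant + d%:R * lk)).
have vc : 0 <= volume_constant.
  by rewrite addr_ge0 ?mulr_ge0// ln_ge0// ler1n fact_gt0.
have X1 : 1 <= X.
  rewrite -[leLHS]expR0 ler_expR mulr_ge0// addr_ge0// mulr_ge0//; exact: le_trans l0 l1.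
have G : growth_bound d L mu <= (11 + 2 * M) * (L / mu) * X.
  have : L * initial_radius mu ^+ 2 * expR (2 * excess_volume L (initial_frame d mu)) <= 9 * (L / mu) * X.
    have -> : L * initial_radius mu ^+ 2 = 9 * (L / mu).
      by rewrite /initial_radius expr_div_n sqr_sqrtr ?(ltW mu0)//; ring.
    apply: ler_wpM2l; first by rewrite mulr_ge0// ltW.
    by rewrite /X ler_expR; lra.
  have : 2 + 2 * M <= (2 + 2 * M) * ((L / mu) * X).
    rewrite ler_peMr//; first by lra.
    by rewrite mulr_ege1.
  rewrite /growth_bound; lra.
have G1 := growth_bound_ge1 d0 mu0 muL.
apply: (@le_trans _ _ (ln ((11 + 2 * M) * (L / mu) * X))).
  by rewrite ler_ln ?posrE//; [lra|lra].
have m11 : 0 < 11 + 2 * M by lra.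
have X0 : 0 < X by exact: expR_gt0.
have m11k : 0 < (11 + 2 * M) * (L / mu) by exact: mulr_gt0.
have -> : ln ((11 + 2 * M) * (L / mu) * X) = ln (11 + 2 * M) + ln (L / mu) + ln X.
  by rewrite lnM ?posrE//; congr (_ + _); exact: lnM.
by rewrite /X expRK; lra.
Qed.

(** The cost is at most a + b ln (1 + kappa), and kappa >= 1 gives ln (1 + kappa) >= ln 2, which
    absorbs a. The outer 2 counts the announcements. *)
Definition sampler_constant : R :=
  let F := acceptance_floor d (test_step R d) M in
  let a := (11 + 16 * (ln (11 + 2 * M) + 2 * volume_constant + 2 * (split_radius M + 16))) / F +
    d.+1%:R + d.+1%:R * (2 / tau) * volume_constant in
  let b := 16 * (1 + 2 * d%:R) / F + d.+1%:R * (2 / tau) * d%:R in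
  2 * (a / ln 2 + b).

Lemma query_bound :
  2 * (restart_cost d L mu + test_budget L 0 (initial_frame d mu)) <= sampler_constant * lk.
Proof.
have M0 := test_level_gt0 R d0.
have F0 : 0 < acceptance_floor d (test_step R d) M by apply: acceptance_floor_gt0 => //; exact: test_step_gt0.
have /andP[t0 _] := cut_depth_itv R d0.
have ln20 : 0 < ln 2 :> R by rewrite ln_gt0//; lra.
have k0 : 0 < L / mu by rewrite divr_gt0.
have l2 : ln 2 <= lk.
  by rewrite ler_ln ?posrE ?addr_gt0// (_ : 2 = 1 + 1)// lerD2l.
have vc : 0 <= volume_constant.
  by rewrite addr_ge0 ?mulr_ge0// ln_ge0// ler1n fact_gt0.
have lM : 0 <= ln (11 + 2 * M) by apply: ln_ge0; lra.
have R0 := split_radius_gt0 M0.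
rewrite /sampler_constant; set F := acceptance_floor _ _ _ in F0 *.
set a := (X in 2 * (X / ln 2 + _)); set b := (X in 2 * (_ / ln 2 + X)).
have tt0 : 0 <= d.+1%:R * (2 / tau) by rewrite mulr_ge0// divr_ge0// ltW.
have a0 : 0 <= a by rewrite addr_ge0 ?addr_ge0 ?mulr_ge0 ?invr_ge0 ?(ltW F0)//; lra.
have ha : a <= a / ln 2 * lk.
  by rewrite mulrAC ler_pdivlMr// ler_wpM2l.
suff H : restart_cost d L mu + test_budget L 0 (initial_frame d mu) <= a + b * lk.
  by rewrite -mulrA ler_pM2l// mulrDl; lra.
have H1 : restart_cost d L mu <= (11 + 16 * (ln (11 + 2 * M) + 2 * volume_constant + 2 * (split_radius M + 16))) / F
    + 16 * (1 + 2 * d%:R) / F * lk.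
  rewrite /restart_cost -/F [_ / F * lk]mulrAC -mulrDl ler_wpM2r ?invr_ge0 ?(ltW F0)//.
  by have := ln_growth_bound; lra.
have H2 : test_budget L 0 (initial_frame d mu) <= d.+1%:R + d.+1%:R * (2 / tau) * volume_constant +
    d.+1%:R * (2 / tau) * d%:R * lk.
  rewrite /test_budget subn0 -addrA lerD2l -[d.+1%:R * (2 / tau) * d%:R * lk]mulrA -mulrDr.
  by rewrite ler_wpM2l// excess_volume_initial.
rewrite /a /b; lra.
Qed.

End query_bound.

Theorem corollary5p1 (R : realType) (d : nat) (d_ge1 : (1 <= d)%N) :
  exists C : R, forall L mu : R, 0 < mu -> mu <= L ->
  exists A : algorithm R d,
    (forall f : 'rV[R]_d -> R, Cclass L mu f -> forall r : exact_run A f,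
       [/\ forall B, measurable B -> output_law r B = target f B,
           terminates_as r &
           is_stopping_time (query_count (r := r))]) /\
    (ereal_sup [set e | exists2 f : 'rV[R]_d -> R, Cclass L mu f &
                        exists r : exact_run A f, e = expected_query_count r]
     <= (C * ln (1 + L / mu))%:E)%E.
Proof.
exists (sampler_constant R d) => L mu mu0 muL.
pose z0 := mk_state 0 0 (initial_frame d mu) 0 0 0.
pose S := machine z0 (@measurable_sampler_ask R d) (@measurable_sampler_next R d L)
  (@measurable_halted R d) (@measurable_sample R d).
have nh0 : ~~ halted z0 by [].
have facts (f : 'rV[R]_d -> R) (fC : Cclass L mu f) (r : exact_run S f) :
    [/\ forall B, measurable B -> output_law r B = target f B, terminates_as r,
       is_stopping_time (query_count (r := r)) &
       (expected_query_count r <= 2%:E * (queries L mu f z0)%:E)%E].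
  have [xs [fmin fball fsub xs_near]] := minimizerP mu0 muL fC.
  have mgrad : measurable_fun setT (grad f).
    apply: measurable_fun_rV => i; apply: continuous_measurable_rV => x.
    apply: (@continuous_comp _ _ _ (grad f) (fun v : 'rV[R]_d => v 0 i)).
      by case: fC => -[_ cg] _ _; exact: cg.
    exact: coord_continuous.
  have inv0 : sampler_inv L mu f xs z0.
    by apply: inv_mk => //; exact: framed_initial.
  have istep z a : sampler_inv L mu f xs z ->
      sampler_inv L mu f xs (transition (@sampler_ask R d) (@sampler_next R d L) f (z, a)).
    exact: (inv_step d_ge1 mu0 muL fC fmin fball).
  have stuck (z : sampler_state R d) g a : halted z -> sampler_next L ((z, g), a) = z by exact: step_halted.
  have V0 z : sampler_inv L mu f xs z -> (0 <= (queries L mu f z)%:E)%E.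
    by move=> iz; rewrite lee_fin; exact: (queries_ge0 d_ge1 mu0 muL fC fmin fball iz).
  have v0 := restart_cost_ge0 d_ge1 mu0 muL.
  have mV z : sampler_inv L mu f xs z -> measurable_fun setT (fun a =>
      (queries L mu f (transition (@sampler_ask R d) (@sampler_next R d L) f (z, a)))%:E).
    move=> iz; apply/measurable_EFinP.
    apply: (measurable_value d_ge1 mu0 muL fC fmin fball _ _ iz) => _.
      exact: (measurable_cost_start mu0 muL).
    exact: measurable_cost_cont.
  have sV z : sampler_inv L mu f xs z -> ~~ halted z -> (1 + \int[coinP R]_a
      (queries L mu f (transition (@sampler_ask R d) (@sampler_next R d L) f (z, a)))%:E <=
      (queries L mu f z)%:E)%E.
    exact: (queries_super d_ge1 mu0 muL fC fmin fball).
  split.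
  - move=> B mB.
    have [-> _ _] := lawP d_ge1 mu0 muL fC fmin fball fsub xs_near mB.
    (* Nonnegativity and the bound on halted states are required for all sets; the value 1 satisfies
       both where [law_value] has no meaning. *)
    pose H (B : set 'rV[R]_d) z : \bar R := if pselect (measurable B) then (law_value f B z)%:E else 1%E.
    have HE C : measurable C -> H C = fun z => (law_value f C z)%:E.
      by move=> mC; apply/funext => z; rewrite /H; case: pselect.
    rewrite (machine_output_law r mgrad d_ge1 nh0 (V := fun z => (queries L mu f z)%:E) (H := H) inv0)//.
    + by rewrite HE.
    + by rewrite ltry.
    + move=> C z iz; rewrite /H; case: pselect => // mC.
      by rewrite lee_fin; exact: (law_value_ge0 d_ge1 mu0 muL fC fmin fball fsub xs_near mC iz).
    + move=> C z mC iz; rewrite (HE C mC).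
      apply/measurable_EFinP; apply: (measurable_value d_ge1 mu0 muL fC fmin fball _ _ iz).
        exact: (measurable_outcome_start d_ge1 mu0 muL fC fmin fball mC iz).
      exact: (measurable_outcome_cont d_ge1 mu0 fC C iz).
    + move=> C z iz hz Cz; rewrite /H; case: pselect => // mC.
      rewrite lee_fin /law_value value_halted// /outcome.
      by rewrite leqNgt [(d.+3 < mode z)%N]hz/= indicE mem_set.
    + move=> C z mC iz; rewrite (HE C mC).
      exact: (law_super d_ge1 mu0 muL fC fmin fball fsub xs_near mC iz).
    + move=> C mC; rewrite (HE C mC) (HE _ (measurableC mC)).
      by rewrite -EFinD (law_setC d_ge1 mu0 muL fC fmin fball fsub xs_near mC).
  - apply: (machine_terminates r mgrad d_ge1 nh0 inv0 istep stuck V0 mV sV).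
    by rewrite ltry.
  - exact: machine_stopping_time.
  - exact: (machine_expected_count r mgrad d_ge1 nh0 inv0 istep stuck V0 mV sV).
exists S; split=> [f fC r|]; first by have [] := facts f fC r.
apply: ub_ereal_sup => e [f fC [r ->]].
have [_ _ _ H] := facts f fC r; apply: le_trans H _.
rewrite -EFinM lee_fin; apply: le_trans (query_bound d_ge1 mu0 muL).
by rewrite /queries /value frame_mk.
Qed.
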